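(* (i) Every nonempty shell of the even selfdual lattice $W_8$ of rank $8$ is a spherical $7\tfrac12$-design. (ii) Every nonempty shell of each even selfdual lattice of rank $16$ is a spherical $3\tfrac12$-design. (iii) Every nonempty shell of the Leech lattice is a spherical $11\tfrac12$-design. (iv) Every nonempty shell of every even selfdual lattice of rank $24$ and minimum $2$ is a spherical $3$-design.
   Context: A selfdual lattice is an integral lattice equal to its dual; it is even if all norms $\langle x,x\rangle$ are even. $W_8=\{x\in\mathbb R^8:2x_i\in\mathbb Z,\ x_i-x_1\in\mathbb Z,\ \sum x_i\in2\mathbb Z\}$ is (up to isometry) the unique even selfdual lattice of rank 8. The Leech lattice is the (unique up to isometry) even selfdual lattice of rank $24$ with minimum $4$ (no vectors of norm 2). Shell of norm $m$: $\Lambda_m=\{x\in\Lambda:\langle x,x\rangle=m\}$. Designs (antipodal sets $X$): $(C_{2j})$ means $\sum_{x\in X}P(x)=0$ for every homogeneous harmonic polynomial $P$ of degree $2j$; $X$ is a spherical $t$-design iff $(C_{2j})$ holds for all $2\le 2j\le t$; $X$ is a spherical $(2s+1+\tfrac12)$-design iff $(C_{2j})$ holds for $2\le2j\le2s$ and for $2j=2s+4$ (e.g. a $7\tfrac12$-design satisfies $(C_2),(C_4),(C_6),(C_{10})$; an $11\tfrac12$-design satisfies $(C_2),\dots,(C_{10}),(C_{14})$). *)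

(* Defs.v *)
From HB Require Import structures.
From mathcomp Require Import all_boot all_order all_algebra.
From mathcomp Require Import reals.
From mathcomp Require Import mpoly.

Set Implicit Arguments.
Unset Strict Implicit.
Unset Printing Implicit Defensive.

Import Order.TTheory GRing.Theory Num.Theory.
Local Open Scope ring_scope.

Section LatticeDefs.
Variable R : realType.

Definition dotv (n : nat) (u v : 'rV[R]_n) : R := \sum_(i < n) u 0 i * v 0 i.

Definition is_intR (r : R) : Prop := exists k : int, r = k%:~R.

Definition Zspan (n : nat) (B : 'M[R]_n) (x : 'rV[R]_n) : Prop :=
  exists z : 'rV[int]_n, x = map_mx (fun k : int => k%:~R) z *m B.

Definition is_lattice (n : nat) (L : 'rV[R]_n -> Prop) : Prop :=
  exists B : 'M[R]_n, B \in unitmx /\ forall x, L x <-> Zspan B x.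

Definition dual_lattice (n : nat) (L : 'rV[R]_n -> Prop) (y : 'rV[R]_n) : Prop :=
  forall x, L x -> is_intR (dotv x y).

Definition integral (n : nat) (L : 'rV[R]_n -> Prop) : Prop :=
  forall x y, L x -> L y -> is_intR (dotv x y).

Definition selfdual (n : nat) (L : 'rV[R]_n -> Prop) : Prop :=
  integral L /\ forall y, L y <-> dual_lattice L y.

Definition even_lattice (n : nat) (L : 'rV[R]_n -> Prop) : Prop :=
  forall x, L x -> exists k : int, dotv x x = 2%:R * k%:~R.

Definition even_selfdual (n : nat) (L : 'rV[R]_n -> Prop) : Prop :=
  [/\ is_lattice L, selfdual L & even_lattice L].

Definition lattice_min (n : nat) (L : 'rV[R]_n -> Prop) (m : R) : Prop :=
  (exists x, [/\ L x, x != 0 & dotv x x = m]) /\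
  (forall x, L x -> x != 0 -> m <= dotv x x).

Definition shell (n : nat) (L : 'rV[R]_n -> Prop) (m : R) (x : 'rV[R]_n) : Prop :=
  L x /\ dotv x x = m.

Definition W8 (x : 'rV[R]_8) : Prop :=
  [/\ forall i : 'I_8, is_intR (2%:R * x 0 i),
      forall i : 'I_8, is_intR (x 0 i - x 0 ord0)
    & exists k : int, \sum_(i < 8) x 0 i = 2%:R * k%:~R].

Definition harmonic (n : nat) (P : {mpoly R[n]}) : Prop :=
  \sum_(i < n) (P^`M(i))^`M(i) = 0.

Definition enumerates (n : nat) (s : seq 'rV[R]_n) (X : 'rV[R]_n -> Prop) : Prop :=
  uniq s /\ forall x, x \in s <-> X x.

Definition cond_C (n : nat) (s : seq 'rV[R]_n) (k : nat) : Prop :=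
  forall P : {mpoly R[n]}, P \is k.-homog -> harmonic P ->
    \sum_(x <- s) P.@[fun i => x 0 i] = 0.

Definition sph_design (n : nat) (t : nat) (X : 'rV[R]_n -> Prop) : Prop :=
  exists s, enumerates s X /\
    forall j : nat, (1 <= j)%N -> (j.*2 <= t)%N -> cond_C s j.*2.

(* X is a (finite) spherical (2s+1+1/2)-design:
   (C_2j) for 2 <= 2j <= 2s, and (C_{2s+4}) *)
Definition sph_half_design (n : nat) (sd : nat) (X : 'rV[R]_n -> Prop) : Prop :=
  exists s, enumerates s X /\
    (forall j : nat, (1 <= j)%N -> (j <= sd)%N -> cond_C s j.*2) /\
    cond_C s (sd.*2 + 4)%N.

End LatticeDefs.

(* Main.v *)
(** For a harmonic form P of degree 2e, Poisson summation turns the theta series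
    f(al) = sum over x in L of P(x) exp(- pi al |x|^2) of an even selfdual lattice of
    rank n into a multiple of itself under al -> 1/al; as f is also invariant under
    al -> al + i, it is a modular form of weight k = n/2 + 2e. Its expansion in
    q = exp(- 2 pi al) has no term below q^m0, where m0 = 1, or m0 = 2 for minimum 4.
    The sums of P over the shells are the coefficients of f, so it suffices that f = 0.

    The functional equation forces zeros of f at al = 1 (if e is odd) and at
    al = (sqrt 3 + i)/2 (if 3 does not divide k). The invariant function
    Phi = (Re al)^(k/2) |f| is bounded, and every orbit meets Re al >= 17/20. Dividing f
    by q^m0 and by the forced zeros and applying Cauchy's estimates on the circle
    Re al = 1/2 gives Phi <= c sup Phi with an explicit c < 1, whence f = 0.

    For the functional equation, the theta series is differentiated along the
    translates of the Gaussian: P is a combination of powers of linear forms apolar to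
    the multiples of |x|^2, so only the top coefficient of the Taylor expansion survives.
    Poisson summation itself follows by discrete Fourier inversion from the fact that
    Riemann sums of a Gaussian are, up to O(mesh), independent of translations. *)
Require Import Defs.
From HB Require Import structures.
From mathcomp Require Import all_boot all_order all_algebra.
From mathcomp Require Import reals.
From mathcomp Require Import mpoly.
From mathcomp Require Import complex finmap ring lra zify.
From mathcomp Require Import boolp classical_sets topology normedtype sequences derive realfun.
From mathcomp Require Import exp trigo.
Set Implicit Arguments.
Unset Strict Implicit.
Unset Printing Implicit Defensive.
Import Order.TTheory GRing.Theory Num.Theory.
Import numFieldNormedType.Exports.
Local Open Scope complex_scope.
Local Open Scope ring_scope.

Local Notation nrm := (@Normc.normc _).
Local Notation Re := (@complex.Re _).
Local Notation Im := (@complex.Im _).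

Local Arguments Normc.normc : simpl never.

(** * Unconditional sums *)

Section Norm.
Variable R : realType.
Local Notation C := R[i].
Implicit Types (x y : R) (z w : C).

(** The degree skipped by each half-design is where the method has to stop: at [e = sd + 1] the
    weight is 12 m0, that of Delta^m0, which vanishes at infinity to the exact order m0, and no zero
    is forced, [e] being even and [e + h] divisible by 3. In the next even degree the weight is 12
    m0 + 2 and both zeros are forced. That case with m0 = 2 is the tightest, with c about 0.93, so
    the numerical bounds have to be fairly sharp.

    No integral occurs anywhere. Averages over roots of unity stand for Fourier coefficients and
    contour integrals, subdivided segments for integration along paths, polynomials with a remainder
    for derivatives.

    The Poisson factor [K] is known only through [K ^+ 2 = al ^- n], so no branch of a square root
    of [al] is followed: absolute values, the normalisation [K = 1] at [al = 1] and a squared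
    identity at the point of order 3 suffice.

    The linear forms are real, whereas the classical proof takes isotropic complex vectors; only
    their weighted sum behaves isotropically, and that is all the top coefficient sees. *)

Lemma nrmD z w : nrm (z + w) <= nrm z + nrm w.
Proof. exact: le_normcD. Qed.

Lemma nrmN z : nrm (- z) = nrm z.
Proof. exact: normcN. Qed.

Lemma nrmM z w : nrm (z * w) = nrm z * nrm w.
Proof. exact: Normc.normcM. Qed.

Lemma nrmV z : nrm (z^-1) = (nrm z)^-1.
Proof. exact: Normc.normcV. Qed.

Lemma nrm0 : nrm (0 : C) = 0.
Proof. exact: Normc.normc0. Qed.

Lemma nrm1 : nrm (1 : C) = 1.
Proof. exact: Normc.normc1. Qed.

Lemma nrm_ge0 z : 0 <= nrm z.
Proof. by case: z => a b; rewrite /Normc.normc sqrtr_ge0. Qed.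

Lemma nrm_real x : nrm (x%:C : C) = `|x|.
Proof. by rewrite /Normc.normc /= expr0n /= addr0 sqrtr_sqr. Qed.

Lemma nrm_eq0 z : nrm z = 0 -> z = 0.
Proof. exact: Normc.eq0_normc. Qed.

Lemma nrmX z n : nrm (z ^+ n) = nrm z ^+ n.
Proof. by elim: n => [|n IH]; rewrite ?expr0 ?nrm1 // !exprS nrmM IH. Qed.

Lemma nrmB z w : nrm (z - w) = nrm (w - z).
Proof. by rewrite -nrmN opprB. Qed.

Lemma nrm_le_add z w : nrm z <= nrm w + nrm (z - w).
Proof. by rewrite -{1}(subrK w z) addrC nrmD. Qed.

Lemma nrm_sqr z : nrm z ^+ 2 = Re z ^+ 2 + Im z ^+ 2.
Proof. by case: z => a b; rewrite /Normc.normc sqr_sqrtr // addr_ge0 ?sqr_ge0. Qed.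

Lemma sqr_normr x : `|x| ^+ 2 = x ^+ 2.
Proof. by rewrite -normrX ger0_norm ?sqr_ge0. Qed.

Lemma Re_le_nrm z : `|Re z| <= nrm z.
Proof.
rewrite -(ler_pXn2r (n := 2)) ?nnegrE ?nrm_ge0 // nrm_sqr -normrX.
by rewrite ger0_norm ?sqr_ge0 // lerDl sqr_ge0.
Qed.

Lemma Im_le_nrm z : `|Im z| <= nrm z.
Proof.
rewrite -(ler_pXn2r (n := 2)) ?nnegrE ?nrm_ge0 // nrm_sqr -normrX.
by rewrite ger0_norm ?sqr_ge0 // lerDr sqr_ge0.
Qed.

Lemma nrm_i : nrm ('i : C) = 1.
Proof. by rewrite /Normc.normc /= expr0n expr1n add0r sqrtr1. Qed.

Lemma nrm_sum (I : Type) (s : seq I) (P : pred I) (f : I -> C) :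
  nrm (\sum_(i <- s | P i) f i) <= \sum_(i <- s | P i) nrm (f i).
Proof.
elim/big_rec2: _ => [|i x z _ h]; first by rewrite nrm0.
exact: le_trans (nrmD _ _) (lerD _ _).
Qed.

Lemma complex_split z : z = (Re z)%:C + 'i * (Im z)%:C.
Proof. by case: z => a b; simpc. Qed.

Lemma nrm_small_eq0 z (K : R) : (forall e : R, 0 < e -> nrm z <= e * K) -> z = 0.
Proof.
move=> h; apply: nrm_eq0; apply/eqP; rewrite eq_le nrm_ge0 andbT.
have K1 : 0 < `|K| + 1 by rewrite ltr_wpDl.
apply/ler_addgt0Pl => e e0; rewrite addr0.
have := h (e / (`|K| + 1)) (divr_gt0 e0 K1) => /le_trans; apply.
rewrite -mulrA ger_pMr // mulrC ler_pdivrMr // mul1r.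
by rewrite (le_trans (ler_norm _)) // lerDl.
Qed.

End Norm.

Section FsetSums.
Variables (I : choiceType) (V : zmodType).

Lemma fsum_split (A B : {fset I}) (f : I -> V) : (A `<=` B)%fset ->
  \sum_(i <- B) f i = \sum_(i <- A) f i + \sum_(i <- (B `\` A)%fset) f i.
Proof.
move=> AB; rewrite -big_cat; apply: perm_big; apply: uniq_perm.
- exact: fset_uniq.
- rewrite cat_uniq !fset_uniq /= andbT; apply/hasPn => i.
  by rewrite in_fsetD => /andP[].
- move=> i; rewrite mem_cat in_fsetD.
  by case: (boolP (i \in A)) => //= /(fsubsetP AB) ->.
Qed.

Lemma fsum_seq (s : seq I) (f : I -> V) : uniq s ->
  \sum_(i <- [fset i in s]%fset) f i = \sum_(i <- s) f i.
Proof.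
move=> us; apply: perm_big; apply: uniq_perm => //.
by move=> i; rewrite !inE.
Qed.

End FsetSums.

Section Summation.
Variable R : realType.
Local Notation C := R[i].

(** Convergence along the directed set of finite subsets: the index set (integer vectors, pairs,
    naturals) is never enumerated. *)
Definition has_sum (I : choiceType) (f : I -> C) (s : C) : Prop :=
  forall e : R, 0 < e -> exists A : {fset I}, forall B : {fset I},
    (A `<=` B)%fset -> nrm (\sum_(i <- B) f i - s) <= e.

Definition sum_le (I : choiceType) (g : I -> R) (K : R) : Prop :=
  forall A : {fset I}, \sum_(i <- A) g i <= K.

Definition summable (I : choiceType) (f : I -> C) : Prop :=
  exists K, sum_le (fun i => nrm (f i)) K.

(** The value is 0 when there is no sum, which is why the algebraic rules below carry summability
    hypotheses. *)
Definition tsum (I : choiceType) (f : I -> C) : C :=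
  xget 0 [set s | has_sum f s]%classic.

Section Basic.
Variable I : choiceType.
Implicit Types (f g : I -> C) (u v : I -> R) (A B : {fset I}).

Lemma fsum_le u A B : (forall i, 0 <= u i) -> (A `<=` B)%fset ->
  \sum_(i <- A) u i <= \sum_(i <- B) u i.
Proof. by move=> u0 /fsum_split ->; rewrite lerDl sumr_ge0. Qed.

Lemma has_sum_uniq f s t : has_sum f s -> has_sum f t -> s = t.
Proof.
move=> hs ht; apply/eqP; rewrite -subr_eq0; apply/eqP.
apply: (@nrm_small_eq0 _ _ 2) => e e0.
have [A hA] := hs e e0; have [B hB] := ht e e0.
have := hA (A `|` B)%fset (fsubsetUl _ _); have := hB (A `|` B)%fset (fsubsetUr _ _).
set S := \sum_(i <- _) _; move=> h1 h2.
rewrite (_ : s - t = (S - t) - (S - s)); last by ring.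
rewrite (le_trans (nrmD _ _)) // nrmN mulr2n mulrDr mulr1; exact: lerD.
Qed.

Lemma tsum_eq f s : has_sum f s -> tsum f = s.
Proof.
move=> h; apply: (@has_sum_uniq f) => //.
exact: (@xgetPex _ 0 [set s | has_sum f s]%classic (ex_intro _ s h)).
Qed.

Lemma has_sumD f g s t : has_sum f s -> has_sum g t ->
  has_sum (fun i => f i + g i) (s + t).
Proof.
move=> hs ht e e0; have e2 : 0 < e / 2 by rewrite divr_gt0.
have [A hA] := hs _ e2; have [B hB] := ht _ e2.
exists (A `|` B)%fset => D hD.
rewrite big_split /= opprD addrACA (le_trans (nrmD _ _)) // (splitr e).
apply: lerD; [apply: hA|apply: hB]; apply: fsubset_trans hD.
  exact: fsubsetUl.
exact: fsubsetUr.
Qed.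

Lemma has_sumZ f s c : has_sum f s -> has_sum (fun i => c * f i) (c * s).
Proof.
move=> hs e e0; have c1 : 0 < nrm c + 1 by rewrite ltr_wpDl ?nrm_ge0.
have [A hA] := hs _ (divr_gt0 e0 c1); exists A => B /hA h.
rewrite -mulr_sumr -mulrBr nrmM.
apply: (@le_trans _ _ ((nrm c + 1) * (e / (nrm c + 1)))).
  by apply: ler_pM; rewrite ?nrm_ge0 // lerDl.
by rewrite mulrCA divff ?mulr1 // gt_eqF.
Qed.

Lemma real_has_sum u K : (forall i, 0 <= u i) -> sum_le u K ->
  exists S, has_sum (fun i => (u i)%:C) S%:C.
Proof.
move=> u0 hu; pose E : set R := [set x | exists A : {fset I}, x = \sum_(i <- A) u i]%classic.
have E1 : has_sup E.
  split; first by exists (\sum_(i <- fset0) u i), fset0.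
  by exists K => x [A ->]; exact: hu.
exists (sup E) => e e0; have [x [A ->] hx] := sup_adherent e0 E1.
exists A => B AB; rewrite -rmorph_sum -rmorphB nrm_real ler_distlC.
have h1 := fsum_le u0 AB.
have h2 : \sum_(i <- B) u i <= sup E by apply: ub_le_sup; [case: E1|exists B].
apply/andP; split; lra.
Qed.

Lemma summable_has_sum f : summable f -> exists s, has_sum f s.
Proof.
case=> K hK.
have part (v : I -> R) : (forall i, `|v i| <= nrm (f i)) ->
    exists s, has_sum (fun i => (v i)%:C) s.
  move=> hv.
  (* Positive and negative parts of [v]; each is dominated by [nrm (f i)], so its partial sums have
     a supremum. *)
  have [||S1 h1] := @real_has_sum (fun i => (`|v i| + v i) / 2) K.
  - by move=> i; have := ler_norm (- v i); rewrite normrN; lra.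
  - move=> A; apply: le_trans (hK A); apply: ler_sum => i _.
    by have := ler_norm (v i); have := hv i; lra.
  have [||S2 h2] := @real_has_sum (fun i => (`|v i| - v i) / 2) K.
  - by move=> i; have := ler_norm (v i); lra.
  - move=> A; apply: le_trans (hK A); apply: ler_sum => i _.
    by have := ler_norm (- v i); rewrite normrN; have := hv i; lra.
  exists (S1%:C + (-1) * S2%:C); have := has_sumD h1 (has_sumZ (-1) h2).
  congr has_sum; apply: funext => i; rewrite mulN1r -rmorphB; congr (_%:C).
  by field.
have [s1 h1] := part (fun i => Re (f i)) (fun i => Re_le_nrm _).
have [s2 h2] := part (fun i => Im (f i)) (fun i => Im_le_nrm _).
exists (s1 + 'i * s2); have := has_sumD h1 (has_sumZ 'i h2).
by congr has_sum; apply: funext => i; rewrite [RHS]complex_split.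
Qed.

Lemma tsumP f : summable f -> has_sum f (tsum f).
Proof. by move=> /summable_has_sum[s hs]; rewrite (tsum_eq hs). Qed.

Lemma summable_dom f u K : (forall i, nrm (f i) <= u i) -> sum_le u K -> summable f.
Proof.
move=> fu hu; exists K => A; apply: le_trans (hu A); exact: ler_sum.
Qed.

Lemma has_sum_nrm_le f s K : has_sum f s -> sum_le (fun i => nrm (f i)) K -> nrm s <= K.
Proof.
move=> hs hK; apply/ler_addgt0Pl => e /hs[A] /(_ A (fsubset_refl _)) h.
rewrite (le_trans (nrm_le_add _ (\sum_(i <- A) f i))) // addrC lerD //.
  by rewrite nrmB.
exact: le_trans (nrm_sum _ _ _) (hK A).
Qed.

Lemma tsum_nrm_le f K : sum_le (fun i => nrm (f i)) K -> nrm (tsum f) <= K.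
Proof. by move=> hK; exact: has_sum_nrm_le (tsumP (ex_intro _ K hK)) hK. Qed.

Lemma tsum_dom f u K : (forall i, nrm (f i) <= u i) -> sum_le u K -> nrm (tsum f) <= K.
Proof.
move=> fu hu; apply: tsum_nrm_le => A; apply: le_trans (hu A); exact: ler_sum.
Qed.

Lemma summableD f g : summable f -> summable g -> summable (fun i => f i + g i).
Proof.
move=> [K hK] [L hL]; exists (K + L) => A; apply: le_trans (lerD (hK A) (hL A)).
rewrite -big_split /=; apply: ler_sum => i _; exact: nrmD.
Qed.

Lemma summableZ f c : summable f -> summable (fun i => c * f i).
Proof.
move=> [K hK]; exists (nrm c * K) => A.
under eq_bigr do rewrite nrmM.
by rewrite -mulr_sumr ler_wpM2l ?nrm_ge0.
Qed.

Lemma summableB f g : summable f -> summable g -> summable (fun i => f i - g i).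
Proof.
move=> hf hg; have := summableD hf (summableZ (-1) hg).
by congr summable; apply: funext => i; rewrite mulN1r.
Qed.

Lemma tsumD f g : summable f -> summable g ->
  tsum (fun i => f i + g i) = tsum f + tsum g.
Proof. by move=> hf hg; apply: tsum_eq; apply: has_sumD; apply: tsumP. Qed.

Lemma tsumZ f c : summable f -> tsum (fun i => c * f i) = c * tsum f.
Proof. by move=> hf; apply: tsum_eq; apply: has_sumZ; apply: tsumP. Qed.

Lemma tsumB f g : summable f -> summable g ->
  tsum (fun i => f i - g i) = tsum f - tsum g.
Proof.
move=> hf hg; rewrite -mulN1r -tsumZ // -tsumD //; last exact: summableZ.
by congr tsum; apply: funext => i; rewrite mulN1r.
Qed.

Lemma eq_tsum f g : f =1 g -> tsum f = tsum g.
Proof. by move=> /funext ->. Qed.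

Lemma eq_summable f g : f =1 g -> summable f -> summable g.
Proof. by move=> /funext ->. Qed.

Lemma summable0 : summable (fun _ : I => 0 : C).
Proof. by exists 0 => A; rewrite big1 // => i _; rewrite nrm0. Qed.

Lemma tsum0 : tsum (fun _ : I => 0 : C) = 0.
Proof.
apply: tsum_eq => e e0; exists fset0 => B _; rewrite big1 // subr0 nrm0; exact: ltW.
Qed.

Lemma summable_sum (T : Type) (s : seq T) (F : T -> I -> C) :
  (forall t, summable (F t)) -> summable (fun i => \sum_(t <- s) F t i).
Proof.
move=> hF; elim: s => [|t s IH].
  by apply: eq_summable summable0 => i; rewrite big_nil.
by apply: eq_summable (summableD (hF t) IH) => i; rewrite big_cons.
Qed.

Lemma tsum_sum (T : Type) (s : seq T) (F : T -> I -> C) :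
  (forall t, summable (F t)) ->
  tsum (fun i => \sum_(t <- s) F t i) = \sum_(t <- s) tsum (F t).
Proof.
move=> hF; elim: s => [|t s IH].
  by rewrite big_nil -[RHS]tsum0; apply: eq_tsum => i; rewrite big_nil.
rewrite big_cons -IH -tsumD //; last exact: summable_sum.
by apply: eq_tsum => i; rewrite big_cons.
Qed.

Lemma fin_supp_has_sum f A : (forall i, i \notin A -> f i = 0) ->
  has_sum f (\sum_(i <- A) f i).
Proof.
move=> h e e0; exists A => B AB; rewrite (fsum_split _ AB) addrC addrA.
rewrite addNr add0r big1_seq ?nrm0 ?ltW // => i /=; rewrite in_fsetD => /andP[/h ->].
by [].
Qed.

Lemma fin_supp_tsum f A : (forall i, i \notin A -> f i = 0) ->
  tsum f = \sum_(i <- A) f i.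
Proof. by move=> /fin_supp_has_sum/tsum_eq. Qed.

Lemma fin_supp_summable f A : (forall i, i \notin A -> f i = 0) -> summable f.
Proof.
move=> h; exists (\sum_(i <- A) nrm (f i)) => B.
have h0 i : i \notin A -> nrm (f i) = 0 by move=> /h ->; rewrite nrm0.
apply: le_trans (fsum_le (fun i => nrm_ge0 (f i)) (fsubsetUr A B)) _.
rewrite (fsum_split _ (fsubsetUl A B)) [X in _ + X]big1_seq ?addr0 // => i /=.
by rewrite in_fsetD => /andP[/h0 ->].
Qed.

Lemma tsum_ge u i : (forall j, 0 <= u j) -> summable (fun j => (u j)%:C) ->
  u i <= Re (tsum (fun j => (u j)%:C)).
Proof.
move=> u0 /tsumP h; apply/ler_addgt0Pl => e /h[A] /(_ (i |` A)%fset (fsubsetUr _ _)).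
rewrite -rmorph_sum; set T := tsum _; set S := \sum_(_ <- _) _.
move=> /(le_trans (Re_le_nrm _)); rewrite raddfB /= ler_distlC => /andP[h1 h2].
have : u i <= S by rewrite /S (big_fsetD1 i) ?fset1U1 //= lerDl sumr_ge0.
lra.
Qed.

Lemma sum_le_tail u K : (forall i, 0 <= u i) -> sum_le u K ->
  forall e, 0 < e -> exists A, forall B, [disjoint A & B]%fset -> \sum_(i <- B) u i <= e.
Proof.
move=> u0 hu e e0; have [S hS] := real_has_sum u0 hu.
have e2 : 0 < e / 2 by rewrite divr_gt0.
have [A hA] := hS _ e2; exists A => B dAB.
have := hA _ (fsubset_refl _); have := hA _ (fsubsetUl A B).
rewrite (fsum_split _ (fsubsetUl A B)).
rewrite fsetDUl fsetDv fset0U (fsetDidPl _ _ _); last by rewrite fdisjoint_sym.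
rewrite -!rmorph_sum -rmorphD -!rmorphB !nrm_real !ler_distlC.
by move=> /andP[h1 h2] /andP[h3 h4]; lra.
Qed.

(** This is what makes shells finite: the terms will be Gaussian values at lattice points, and large
    values mean small norm. *)
Lemma large_terms_finite u K : (forall i, 0 <= u i) -> sum_le u K ->
  forall e, 0 < e -> exists A, forall i, e <= u i -> i \in A.
Proof.
move=> u0 hu e e0; have e2 : 0 < e / 2 by rewrite divr_gt0.
have [A hA] := sum_le_tail u0 hu e2; exists A => i hi.
apply: contraT => iA; have := hA [fset i]%fset.
rewrite fdisjointX1 iA big_seq_fset1 => /(_ isT); lra.
Qed.

End Basic.

Definition cvgC (u : nat -> C) (l : C) : Prop :=
  forall e : R, 0 < e -> exists N0 : nat, forall N, (N0 <= N)%N -> nrm (u N - l) <= e.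

Lemma cvgC_uniq u l l' : cvgC u l -> cvgC u l' -> l = l'.
Proof.
move=> h h'; apply/eqP; rewrite -subr_eq0; apply/eqP.
apply: (@nrm_small_eq0 _ _ 2) => e e0.
have [N hN] := h e e0; have [N' hN'] := h' e e0.
have := hN (maxn N N') (leq_maxl _ _); have := hN' (maxn N N') (leq_maxr _ _).
set S := u _ => h1 h2.
rewrite (_ : l - l' = (S - l') - (S - l)); last by ring.
by rewrite (le_trans (nrmD _ _)) // nrmN mulr2n mulrDr mulr1; apply: lerD.
Qed.

Lemma cvgC_cst (l : C) : cvgC (fun _ => l) l.
Proof. by move=> e e0; exists 0%N => N _; rewrite subrr nrm0 ltW. Qed.

Lemma cvgCD u v l m : cvgC u l -> cvgC v m -> cvgC (fun N => u N + v N) (l + m).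
Proof.
move=> hu hv e e0; have e2 : 0 < e / 2 by rewrite divr_gt0.
have [A hA] := hu _ e2; have [B hB] := hv _ e2.
exists (maxn A B) => N; rewrite geq_max => /andP[/hA h1 /hB h2].
by rewrite opprD addrACA (le_trans (nrmD _ _)) // (splitr e) lerD.
Qed.

Lemma cvgCZ u l c : cvgC u l -> cvgC (fun N => c * u N) (c * l).
Proof.
move=> hs e e0; have c1 : 0 < nrm c + 1 by rewrite ltr_wpDl ?nrm_ge0.
have [A hA] := hs _ (divr_gt0 e0 c1); exists A => B /hA h.
rewrite -mulrBr nrmM.
apply: (@le_trans _ _ ((nrm c + 1) * (e / (nrm c + 1)))).
  by apply: ler_pM; rewrite ?nrm_ge0 // lerDl.
by rewrite mulrCA divff ?mulr1 // gt_eqF.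
Qed.

Lemma cvgCM u v l m : cvgC u l -> cvgC v m -> cvgC (fun N => u N * v N) (l * m).
Proof.
move=> hu hv.
have h0 : cvgC (fun N => (u N - l) * (v N - m)) 0.
  move=> e e0; pose e' := Num.min e 1.
  have e'0 : 0 < e' by rewrite lt_min e0 ltr01.
  have [A hA] := hu _ e'0; have [B hB] := hv _ e'0.
  exists (maxn A B) => N; rewrite geq_max => /andP[/hA h1 /hB h2].
  rewrite subr0 nrmM (@le_trans _ _ (e' * 1)) //; last by rewrite mulr1 ge_min lexx.
  apply: ler_pM; rewrite ?nrm_ge0 //; apply: le_trans h2 _.
  by rewrite ge_min lexx orbT.
have := cvgCD h0 (cvgCD (cvgCZ l hv) (cvgCD (cvgCZ m hu) (cvgC_cst (- (l * m))))).
rewrite (_ : 0 + _ = l * m); last by ring.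
by congr cvgC; apply: funext => N; ring.
Qed.

(** Dominated convergence for series. A finite set carries all of the majorant but [e / 4]; on it
    the convergence is uniform, and off it both families are bounded by the tail. *)
Lemma tannery (I : choiceType) (f : nat -> I -> C) (g : I -> C) (u : I -> R) K :
  (forall i, cvgC (f^~ i) (g i)) -> (forall N i, nrm (f N i) <= u i) -> sum_le u K ->
  cvgC (fun N => tsum (f N)) (tsum g).
Proof.
move=> fg fu hu.
have u0 i : 0 <= u i by apply: le_trans (nrm_ge0 _) (fu 0%N i).
have gu i : nrm (g i) <= u i.
  apply/ler_addgt0Pl => e e0; have [N /(_ N (leqnn _)) hN] := fg i e e0.
  by rewrite (le_trans (nrm_le_add _ (f N i))) // addrC lerD // nrmB.
have sf N : summable (f N) := summable_dom (fu N) hu.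
have sg : summable g := summable_dom gu hu.
move=> e e0; have e4 : 0 < e / 4 by rewrite divr_gt0.
have [A hA] := sum_le_tail u0 hu e4.
have [N0 hN0] : exists N0, forall N, (N0 <= N)%N ->
    \sum_(i <- A) nrm (f N i - g i) <= e / 4.
  have : 0 < e / 4 by [].
  elim: {hA}(enum_fset A) (e / 4) => [|i s IH] d d0.
    by exists 0%N => N _; rewrite big_nil ltW.
  have d2 : 0 < d / 2 by rewrite divr_gt0.
  have [N1 h1] := IH _ d2; have [N2 h2] := fg i _ d2.
  exists (maxn N1 N2) => N; rewrite geq_max big_cons => /andP[/h1 h3 /h2 h4].
  by rewrite (splitr d) lerD.
exists N0 => N /hN0 hN; rewrite -tsumB //; apply: tsum_nrm_le => B.
rewrite (big_fsetID _ (mem A)) /=.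
have -> : e = e / 4 + (e / 4 + e / 4 + e / 4) by field.
apply: lerD.
  apply: le_trans hN; apply: fsum_le; first by move=> i; apply: nrm_ge0.
  by apply/fsubsetP => i; rewrite !inE /= => /andP[].
have hB := hA [fset x in B | x \notin A]%fset.
apply: (@le_trans _ _ (\sum_(i <- [fset x in B | x \notin A]%fset) (u i + u i))).
  apply: ler_sum => i _; rewrite (le_trans (nrmD _ _)) // nrmN; exact: lerD.
rewrite big_split /=; apply: (@le_trans _ _ (e / 4 + e / 4)); last by rewrite lerDl ltW.
have {}hB : \sum_(i <- [fset x in B | x \notin A]%fset) u i <= e / 4.
  apply: hB; apply/fdisjointP => i iA; rewrite !inE /= iA.
  by rewrite andbF.
exact: lerD.
Qed.

Section Reindex.
Variables (I J : choiceType) (p : I -> J) (q : J -> I).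
Hypothesis pq : cancel p q.

Lemma sum_le_reindex (u : J -> R) K : sum_le u K -> sum_le (u \o p) K.
Proof.
move=> hu A; apply: le_trans (hu [fset p i | i in A]%fset).
by rewrite big_imfset //= => i j _ _; exact: can_inj pq _ _.
Qed.

Lemma summable_reindex (f : J -> C) : summable f -> summable (f \o p).
Proof. by case=> K /sum_le_reindex hK; exists K. Qed.

(** Since [q] is a left inverse of [p], the condition [p (q j) <> j] singles out the indices outside
    the image of [p]. *)
Lemma tsum_inj (f : J -> C) : summable f -> (forall j, p (q j) <> j -> f j = 0) ->
  tsum (f \o p) = tsum f.
Proof.
move=> sf f0; apply: tsum_eq => e e0; have [A hA] := tsumP sf e0.
exists [fset q j | j in A]%fset => B hB.
have := hA ([fset p i | i in B] `|` A)%fset (fsubsetUr _ _).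
rewrite (fsum_split f (fsubsetUl _ A)) [X in _ + X - _]big1_seq ?addr0.
  by rewrite big_imfset //= => i j _ _; exact: can_inj pq _ _.
move=> j /=; rewrite !inE => /andP[h1 /orP[h2|jA]]; first by rewrite h2 in h1.
apply: f0 => h; move/negP: h1; apply; apply/imfsetP; exists (q j) => //=.
by apply: (fsubsetP hB); apply/imfsetP; exists j.
Qed.

Lemma tsum_reindex (f : J -> C) : cancel q p -> summable f -> tsum (f \o p) = tsum f.
Proof. by move=> qp sf; apply: tsum_inj => // j; rewrite qp. Qed.

End Reindex.

Lemma sum_le_nat (u : nat -> R) K : (forall n, 0 <= u n) ->
  (forall N, \sum_(0 <= n < N) u n <= K) -> sum_le u K.
Proof.
move=> u0 h A; pose N := (\max_(n <- A) n).+1.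
apply: le_trans (h N); rewrite /index_iota subn0 -(fsum_seq u (iota_uniq 0 N)).
apply: fsum_le => //; apply/fsubsetP => n nA; have hn : (n <= \max_(n0 <- A) n0)%N by rewrite (big_rem n nA) leq_maxl.
by rewrite !inE mem_iota; case: n hn {nA} => //= n; rewrite add1n ltnS.
Qed.

Lemma sum_le_int (u : int -> R) K L : (forall m, 0 <= u m) ->
  sum_le (fun n => u (Posz n)) K -> sum_le (fun n => u (Negz n)) L -> sum_le u (K + L).
Proof.
move=> u0 hK hL A.
pose pos (m : int) := if m is Posz n then n else 0%N.
pose neg (m : int) := if m is Negz n then n else 0%N.
pose A1 := [fset pos m | m in A]%fset; pose A2 := [fset neg m | m in A]%fset.
apply: le_trans (lerD (hK A1) (hL A2)).
rewrite (big_fsetID _ (fun m : int => 0 <= m)) /=; apply: lerD.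
- apply: (@le_trans _ _ (\sum_(m <- [fset Posz n | n in A1]%fset) u m)).
    apply: fsum_le => //; apply/fsubsetP => -[] n; rewrite !inE //= => /andP[h hn] //.
    by apply/imfsetP; exists n => //; apply/imfsetP; exists (Posz n).
  by rewrite big_imfset //= => i j _ _ [].
- apply: (@le_trans _ _ (\sum_(m <- [fset Negz n | n in A2]%fset) u m)).
    apply: fsum_le => //; apply/fsubsetP => -[] n; rewrite !inE //= => /andP[h hn] //.
    by apply/imfsetP; exists n => //; apply/imfsetP; exists (Negz n).
  by rewrite big_imfset //= => i j _ _ [].
Qed.

Section Fubini.
Variables (I J : choiceType).
Implicit Types (F : I * J -> C) (U : I * J -> R).

Definition fprod (A : {fset I}) (B : {fset J}) : {fset I * J} :=
  [fset x in [seq (i, j) | i <- A, j <- B]]%fset.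

Lemma fsum_prod (V : zmodType) (f : I * J -> V) A B :
  \sum_(x <- fprod A B) f x = \sum_(i <- A) \sum_(j <- B) f (i, j).
Proof.
rewrite fsum_seq ?big_allpairs // allpairs_uniq ?fset_uniq //.
by move=> [? ?] [? ?] _ _ [-> ->].
Qed.

Lemma mem_fprod A B i j : ((i, j) \in fprod A B) = (i \in A) && (j \in B).
Proof.
rewrite !inE /=; apply/allpairsP/andP => [[[a b] /= [ha hb [-> ->]]] //|[ha hb]].
by exists (i, j).
Qed.

Lemma sub_fprod (D : {fset I * J}) :
  (D `<=` fprod [fset x.1 | x in D] [fset x.2 | x in D])%fset.
Proof.
apply/fsubsetP => -[i j] ijD; rewrite mem_fprod.
by apply/andP; split; apply/imfsetP; exists (i, j).
Qed.

Lemma sum_le_prod U (u : I -> R) K : (forall x, 0 <= U x) ->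
  (forall i, sum_le (fun j => U (i, j)) (u i)) -> sum_le u K -> sum_le U K.
Proof.
move=> U0 hU hu D; apply: le_trans (fsum_le U0 (sub_fprod D)) _.
rewrite fsum_prod; apply: le_trans (hu [fset x.1 | x in D]%fset).
by apply: ler_sum => i _; apply: hU.
Qed.

Lemma sum_le_section U K i : (forall x, 0 <= U x) -> sum_le U K ->
  sum_le (fun j => U (i, j)) K.
Proof.
move=> U0 hU B; apply: le_trans (hU (fprod [fset i]%fset B)).
by rewrite fsum_prod big_seq_fset1.
Qed.

Lemma summable_section F i : summable F -> summable (fun j => F (i, j)).
Proof.
by case=> K hK; exists K; apply: (@sum_le_section (fun x => nrm (F x))) => // x; apply: nrm_ge0.
Qed.

(** One finite set of columns approximates finitely many rows at once and may be enlarged at will;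
    both comparisons of double and iterated sums below rest on it. *)
Lemma fsum_approx (f : I -> J -> C) (A : {fset I}) (B0 : {fset J}) (e : R) :
  (forall i, summable (f i)) -> 0 < e ->
  exists2 B, (B0 `<=` B)%fset & forall B', (B `<=` B')%fset ->
    nrm (\sum_(i <- A) \sum_(j <- B') f i j - \sum_(i <- A) tsum (f i)) <= e.
Proof.
move=> sf; elim: {A}(enum_fset A) e B0 => [|i s IH] e B0 e0.
  by exists B0 => // B' _; rewrite !big_nil subrr nrm0 ltW.
have e2 : 0 < e / 2 by rewrite divr_gt0.
have [B1 hB1] := tsumP (sf i) e2.
have [B hB h] := IH _ (B0 `|` B1)%fset e2.
exists B => [|B' hB']; first by apply: fsubset_trans hB; apply: fsubsetUl.
rewrite !big_cons opprD addrACA (le_trans (nrmD _ _)) // (splitr e) lerD ?h //.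
apply: hB1; apply: fsubset_trans hB'; apply: fsubset_trans hB; exact: fsubsetUr.
Qed.

Lemma sum_le_tsum F K : sum_le (fun x => nrm (F x)) K ->
  sum_le (fun i => nrm (tsum (fun j => F (i, j)))) K.
Proof.
move=> hK A; have sF : summable F by exists K.
have sN i : summable (fun j => (nrm (F (i, j)))%:C).
  case: (summable_section i sF) => L hL; exists L => B.
  by under eq_bigr do rewrite nrm_real ger0_norm ?nrm_ge0 //; apply: hL.
apply/ler_addgt0Pl => e e0.
have [B _ /(_ B (fsubset_refl _)) hB] :=
  @fsum_approx (fun i j => (nrm (F (i, j)))%:C) A fset0 e sN e0.
have tr i : nrm (tsum (fun j => F (i, j))) <= Re (tsum (fun j => (nrm (F (i, j)))%:C)).
  apply/ler_addgt0Pl => d d0; have d2 : 0 < d / 2 by rewrite divr_gt0.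
  have [D1 hD1] := tsumP (summable_section i sF) d2.
  have [D2 hD2] := tsumP (sN i) d2.
  have := hD1 _ (fsubsetUl D1 D2); have := hD2 _ (fsubsetUr D1 D2).
  set D := (_ `|` _)%fset; set T := tsum _; set S := tsum _ => h2 h1.
  have h3 := Re_le_nrm (\sum_(i0 <- D) (nrm (F (i, i0)))%:C - T).
  rewrite -rmorph_sum in h2; rewrite -rmorph_sum raddfB /= in h3.
  have h4 : nrm S <= \sum_(j <- D) nrm (F (i, j)) + d / 2.
    rewrite (le_trans (nrm_le_add _ (\sum_(j <- D) F (i, j)))) // lerD //.
      exact: nrm_sum.
    by rewrite nrmB.
  have := le_trans h3 h2; rewrite ler_distlC => /andP[]; lra.
apply: le_trans (ler_sum _ (fun i _ => tr i)) _; rewrite -raddf_sum /=.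
have h1 : \sum_(i <- A) \sum_(j <- B) nrm (F (i, j)) <= K by rewrite -(fsum_prod (fun x => nrm (F x))).
have hS : \sum_(i <- A) \sum_(j <- B) (nrm (F (i, j)))%:C
    = (\sum_(i <- A) \sum_(j <- B) nrm (F (i, j)))%:C.
  by rewrite rmorph_sum; apply: eq_bigr => i _; rewrite rmorph_sum.
have := le_trans (Re_le_nrm _) hB; rewrite hS raddfB /= ler_distlC.
by move=> /andP[]; lra.
Qed.

Lemma summable_tsum F : summable F -> summable (fun i => tsum (fun j => F (i, j))).
Proof. by case=> K /sum_le_tsum hK; exists K. Qed.

Lemma fubini F : summable F -> tsum F = tsum (fun i => tsum (fun j => F (i, j))).
Proof.
move=> sF; symmetry; apply: tsum_eq => e e0; have e2 : 0 < e / 2 by rewrite divr_gt0.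
have [D hD] := tsumP sF e2; exists [fset x.1 | x in D]%fset => A hA.
have [B hB /(_ B (fsubset_refl _)) h] :=
  @fsum_approx (fun i j => F (i, j)) A [fset x.2 | x in D]%fset _
    (fun i => summable_section i sF) e2.
have {}hD : nrm (\sum_(x <- fprod A B) F x - tsum F) <= e / 2.
  apply: hD; apply/fsubsetP => -[i j] ijD; rewrite mem_fprod; apply/andP; split.
    by apply: (fsubsetP hA); apply/imfsetP; exists (i, j).
  by apply: (fsubsetP hB); apply/imfsetP; exists (i, j).
rewrite fsum_prod in hD; move: h hD; set X := \sum_(i <- A) \sum_(j <- B) _.
set Y := \sum_(i <- A) _ => h hD.
rewrite (_ : Y - tsum F = (X - tsum F) - (X - Y)); last by ring.
by rewrite (le_trans (nrmD _ _)) // nrmN (splitr e) lerD.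
Qed.

End Fubini.

Lemma fubini_swap (I J : choiceType) (F : I -> J -> C) :
  summable (fun x : I * J => F x.1 x.2) ->
  tsum (fun i => tsum (F i)) = tsum (fun j => tsum (F^~ j)).
Proof.
move=> sF; rewrite -(fubini sF).
pose p (x : J * I) := (x.2, x.1); pose q (x : I * J) := (x.2, x.1).
have pq : cancel p q by case.
have qp : cancel q p by case.
by rewrite -(tsum_reindex pq qp sF) (fubini (summable_reindex pq sF)).
Qed.

Lemma summable_fibers (I J : choiceType) (p : I -> J) (f : I -> C) : summable f ->
  summable (fun x : I * J => if p x.1 == x.2 then f x.1 else 0).
Proof.
move=> [K hK]; exists K; apply: sum_le_prod hK => [x|i B]; first exact: nrm_ge0.
rewrite /= (eq_bigr (fun j => if p i == j then nrm (f i) else 0)); last first.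
  by move=> j _; case: ifP; rewrite ?nrm0.
case: (boolP (p i \in B)) => [iB|iB].
  rewrite (big_fsetD1 (p i)) //= eqxx big1_seq ?addr0 // => j.
  by rewrite !inE eq_sym => /and3P[_ /negPf ->].
rewrite big1_seq ?nrm_ge0 // => j /andP[_ jB].
by case: eqP => // h; rewrite h jB in iB.
Qed.

(** Fubini for the family supported on the graph of [p], each row of which has a single entry. *)
Lemma tsum_fibers (I J : choiceType) (p : I -> J) (f : I -> C) : summable f ->
  tsum f = tsum (fun j => tsum (fun i => if p i == j then f i else 0)).
Proof.
move=> sf; rewrite -(@fubini_swap _ _ (fun i j => if p i == j then f i else 0)).
  apply: eq_tsum => i; rewrite (@fin_supp_tsum _ _ [fset p i]%fset).
    by rewrite big_seq_fset1 eqxx.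
  by move=> j; rewrite inE eq_sym; case: eqP.
exact: summable_fibers.
Qed.

End Summation.

(** * The complex exponential *)

Section Trig.
Variable R : realType.
Implicit Types x y t : R.

Lemma MVT_sin_pos y : 0 < y -> exists2 c, 0 < c < y & sin y = cos c * y.
Proof.
move=> y0; have [|c] := @MVT R sin cos 0 y y0.
  apply: continuous_subspaceT => x; exact: continuous_sin.
by rewrite in_itv /= sin0 !subr0 => hc ->; exists c.
Qed.

Lemma abs_sin_le y : `|sin y| <= `|y|.
Proof.
wlog y0 : y / 0 < y.
  move=> h; case: (ltgtP y 0) => [y0|/h//|->]; last by rewrite sin0.
  by rewrite -normrN -sinN -(normrN y) h // oppr_gt0.
have [c _ ->] := MVT_sin_pos y0; rewrite normrM ler_piMl //; exact: cos_max.
Qed.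

Lemma one_sub_cosE y : 1 - cos y = 2 * sin (y / 2) ^+ 2.
Proof.
have -> : cos y = cos ((y / 2) *+ 2) by congr cos; rewrite -mulr_natr; field.
by rewrite cos_mulr2n cos2sin2; ring.
Qed.

Lemma one_sub_cos_le y : 0 <= 1 - cos y <= y ^+ 2 / 2.
Proof.
rewrite one_sub_cosE; have h := abs_sin_le (y / 2).
have : `|sin (y / 2)| ^+ 2 <= `|y / 2| ^+ 2 by rewrite lerXn2r ?nnegrE.
rewrite !sqr_normr => h1; have h2 := sqr_ge0 (sin (y / 2)); apply/andP; split; lra.
Qed.

Lemma abs_sin_sub_le y : `|sin y - y| <= `|y| ^+ 3 / 2.
Proof.
wlog y0 : y / 0 < y.
  move=> h; case: (ltgtP y 0) => [y0|/h//|->]; last first.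
    by rewrite sin0 subr0 normr0 expr0n /= mul0r.
  by have := h (- y); rewrite oppr_gt0 sinN -opprD !normrN; apply.
have [c /andP[c0 cy] ->] := MVT_sin_pos y0.
rewrite -{2}(mul1r y) -mulrBl normrM -normrN opprB.
have /andP[h1 h2] := one_sub_cos_le c; rewrite (ger0_norm h1) exprSr.
rewrite (ger0_norm (ltW y0)) mulrAC ler_wpM2r ?(ltW y0) // (le_trans h2) //.
by rewrite ler_pM2r ?invr_gt0 ?ltr0n //; apply: lerXn2r; rewrite ?nnegrE; exact: ltW.
Qed.

Lemma pi_lt4 : pi < 4 :> R.
Proof. have := @pihalf_lt2 R; lra. Qed.

(** Up to 1 this follows from the lower bound for sine at the half angle. Beyond 1 cosine still
    decreases up to [pi], so the right side is at least 1/4 while [y ^+ 2 <= 16]. It will turn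
    second differences into decay in the frequency. *)
Lemma one_sub_cos_ge y : `|y| <= pi -> y ^+ 2 / 64 <= 1 - cos y.
Proof.
have small x : 0 <= x -> x <= 1 -> x ^+ 2 / 4 <= 1 - cos x.
  move=> x0 x1; rewrite one_sub_cosE.
  have := abs_sin_sub_le (x / 2); rewrite (ger0_norm (_ : 0 <= x / 2)); last lra.
  rewrite ler_distlC => /andP[_ h].
  have h2 : 3 / 8 * x <= sin (x / 2).
    by have : (x / 2) ^+ 3 <= x / 8; [nra|lra].
  have h3 : (3 / 8 * x) ^+ 2 <= sin (x / 2) ^+ 2.
    by rewrite lerXn2r ?nnegrE //; lra.
  nra.
rewrite -cos_norm -sqr_normr; set t := `|y|; have t0 : 0 <= t by apply: normr_ge0.
move=> tpi; case: (lerP t 1) => [t1|t1]; first by have := small t t0 t1; nra.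
have h1 : cos t <= cos 1.
  case: (ltgtP 1 t) t1 => // t1 _; apply: ltW; rewrite ltr_cos // in_itv /=.
    by rewrite ler01 ltW // (lt_le_trans t1).
  by rewrite t0.
have := small 1 ler01 (lexx _); have := pi_lt4; rewrite expr1n => h2 h3.
have : t ^+ 2 <= 16 by nra.
lra.
Qed.

(* cos(25/16) > 0 : five angle doublings from cos u >= 1 - u^2/2 at u = 25/512 *)
Lemma pi_gt : 25 / 8 < pi :> R.
Proof.
have dbl (x c : R) : 0 <= c -> c <= cos x -> 2 * c ^+ 2 - 1 <= cos (x *+ 2).
  move=> c0 hc; rewrite cos_mulr2n; have : c ^+ 2 <= cos x ^+ 2.
    by rewrite ler_pXn2r ?nnegrE // (le_trans c0).
  lra.
have step (x c d : R) : 0 <= c -> c <= cos x -> d <= 2 * c ^+ 2 - 1 -> d <= cos (2 * x).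
  move=> c0 hc hd; apply: le_trans hd _; rewrite (mulr_natl x 2); exact: dbl.
have h0 : 1 - (25 / 512) ^+ 2 / 2 <= cos (25 / 512 : R).
  by have /andP[_] := one_sub_cos_le (25 / 512); lra.
have h1 : 208 / 209 <= cos (2 * (25 / 512) : R) by apply: step h0 _; lra.
have h2 : 154 / 157 <= cos (2 * (2 * (25 / 512)) : R) by apply: step h1 _; lra.
have h3 : 61 / 66 <= cos (2 * (2 * (2 * (25 / 512))) : R) by apply: step h2 _; lra.
have h4 : 17 / 24 <= cos (2 * (2 * (2 * (2 * (25 / 512)))) : R) by apply: step h3 _; lra.
have : 1 / 288 <= cos (2 * (2 * (2 * (2 * (2 * (25 / 512))))) : R) by apply: step h4 _; lra.
have -> : 2 * (2 * (2 * (2 * (2 * (25 / 512 : R))))) = 25 / 16 by field.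
move=> h; rewrite ltNge; apply/negP => hpi.
have p2 := @pi_ge2 R.
have : cos (25 / 16 : R) <= cos (pi / 2).
  case: (ltgtP (25 / 16) (pi / 2 : R)) => [|hlt|->]; [lra| |by rewrite lexx].
  by apply: ltW; rewrite ltr_cos // in_itv /=; apply/andP; split; lra.
rewrite cos_pihalf; lra.
Qed.

End Trig.

(** * Taylor remainders of the complex exponential *)

Section Cexp.
Variable R : realType.
Local Notation C := R[i].
Implicit Types (x y t : R) (z w : C).

Definition cexp (w : C) : C := (expR (Re w) * cos (Im w)) +i* (expR (Re w) * sin (Im w)).

Lemma cexp0 : cexp 0 = 1.
Proof. by rewrite /cexp /= expR0 cos0 sin0 !mul1r. Qed.

Lemma cexpD z w : cexp (z + w) = cexp z * cexp w.
Proof.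
case: z => a b; case: w => c d; rewrite /cexp /= expRD cosD sinD; simpc.
by congr (_ +i* _); ring.
Qed.

Lemma nrm_cexp w : nrm (cexp w) = expR (Re w).
Proof.
apply/eqP; rewrite -(eqrXn2 (n := 2)) ?nrm_ge0 ?expR_ge0 // nrm_sqr /=.
by rewrite !exprMn -mulrDr cos2Dsin2 mulr1.
Qed.

Lemma cexp_neq0 w : cexp w != 0.
Proof.
apply/eqP => h; have := nrm_cexp w; rewrite h nrm0 => /esym/eqP.
by rewrite expR_eq0.
Qed.

Lemma cexpN w : cexp (- w) = (cexp w)^-1.
Proof.
apply: (mulfI (cexp_neq0 w)); rewrite -cexpD subrr cexp0 divff //; exact: cexp_neq0.
Qed.

Lemma cexp_natM n w : cexp (n%:R * w) = cexp w ^+ n.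
Proof.
elim: n => [|n IH]; first by rewrite mul0r cexp0.
by rewrite -natr1 mulrDl mul1r cexpD IH exprSr.
Qed.

Lemma cexp_real x : cexp x%:C = (expR x)%:C.
Proof. by rewrite /cexp /= cos0 sin0 mulr1 mulr0. Qed.

Lemma cexp_im y : cexp ('i * y%:C) = cos y +i* sin y.
Proof. by rewrite /cexp; simpc; rewrite /= expR0 !mul1r. Qed.

Definition twopii : C := 2 * 'i * (pi : R)%:C.

Lemma cexp_2pii_int (m : int) : cexp (twopii * m%:~R) = 1.
Proof.
have h : cexp twopii = 1.
  have -> : twopii = 'i * (pi *+ 2)%:C by rewrite /twopii mulr2n rmorphD; ring.
  by rewrite cexp_im cos2pi sin2pi.
case: m => n; first by rewrite -pmulrn mulrC cexp_natM h expr1n.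
by rewrite NegzE mulrNz mulrN cexpN -pmulrn mulrC cexp_natM h expr1n invr1.
Qed.

(** A mean value inequality without derivatives: over [n.+1] equal steps the quadratic errors add up
    to [K / n.+1%:R], which tends to 0. *)
Lemma path_bound (f : R -> C) (e K : R) : 0 <= K ->
  (forall s t, 0 <= s -> s <= t -> t <= 1 ->
    nrm (f t - f s) <= e * (t - s) + K * (t - s) ^+ 2) -> nrm (f 1 - f 0) <= e.
Proof.
move=> K0 h; have hN n : nrm (f 1 - f 0) <= e + K / n.+1%:R.
  have n0 : (0 : R) < n.+1%:R by [].
  pose p k : R := k%:R / n.+1%:R.
  have -> : f 1 - f 0 = \sum_(0 <= k < n.+1) (f (p k.+1) - f (p k)).
    by rewrite telescope_sumr // /p divff ?gt_eqF // mul0r.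
  apply: le_trans (nrm_sum _ _ _) _.
  have -> : e + K / n.+1%:R = \sum_(0 <= k < n.+1) ((e + K / n.+1%:R) / n.+1%:R).
    by rewrite sumr_const_nat subn0 -[RHS]mulr_natr mulfVK // gt_eqF.
  rewrite big_nat [X in _ <= X]big_nat; apply: ler_sum => k /andP[_ kn].
  have dp : p k.+1 - p k = n.+1%:R^-1 by rewrite /p -mulrBl -natrB // subSnn mul1r.
  have := h (p k) (p k.+1); rewrite dp => hk.
  apply: le_trans (hk _ _ _) _.
  - by rewrite /p divr_ge0.
  - by rewrite -subr_ge0 dp invr_ge0 ltW.
  - by rewrite /p ler_pdivrMr // mul1r ler_nat.
  by rewrite mulrDl expr2 mulrA.
apply/ler_addgt0Pr => d d0.
have K1 : 0 <= K / d by rewrite divr_ge0 // ltW.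
have := archi_boundP K1; set n := Num.bound _ => hn.
have n0 : (0 < n)%N by rewrite -(ltr_nat R) (le_lt_trans K1).
apply: le_trans (hN n.-1) _; rewrite prednK // lerD2l ler_pdivrMr ?ltr0n //.
by rewrite mulrC -ler_pdivrMr // ltW.
Qed.

Lemma expR_small x : `|x| <= 1 / 2 -> `|expR x - 1 - x| <= 2 * x ^+ 2.
Proof.
rewrite ler_norml => /andP[h1 h2]; have h3 := expR_ge1Dx x; have h4 := expR_ge1Dx (- x).
have e0 := expR_gt0 x.
have h5 : expR x * (1 - x) <= 1.
  by have := ler_wpM2l (ltW e0) h4; rewrite expRxMexpNx_1.
rewrite ger0_norm; last lra.
have h6 : expR x <= 2 by nra.
nra.
Qed.

Lemma cexp_small w : nrm w <= 1 / 2 -> nrm (cexp w - 1 - w) <= 12 * nrm w ^+ 2.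
Proof.
move=> hw; have hx := Re_le_nrm w; have hy := Im_le_nrm w; have n0 := nrm_ge0 w.
case: w hw hx hy n0 => x y; set r := nrm _ => hw /= hx hy n0.
have x1 : `|x| <= 1 / 2 by apply: le_trans hx hw.
have y1 : `|y| <= 1 / 2 by apply: le_trans hy hw.
have xr : x ^+ 2 <= r ^+ 2 by rewrite -sqr_normr ler_pXn2r ?nnegrE.
have yr : y ^+ 2 <= r ^+ 2 by rewrite -(sqr_normr y) ler_pXn2r ?nnegrE.
have E1 := expR_small x1; have /andP[c1 c2] := one_sub_cos_le y.
have S1 := abs_sin_sub_le y.
have Sy : `|sin y - y| <= r ^+ 2 by apply: le_trans S1 _; rewrite exprS sqr_normr; have := sqr_ge0 y; nra.
have ex : expR x <= 2.
  have := le_trans (ler_norm _) E1; move: x1; rewrite ler_norml => /andP[? ?]; nra.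
have ex1 : `|expR x - 1| <= 2 * r.
  have -> : expR x - 1 = (expR x - 1 - x) + x by ring.
  rewrite (le_trans (ler_normD _ _)) //; nra.
have -> : cexp (x +i* y) - 1 - (x +i* y)
   = (expR x * cos y - 1 - x)%:C + 'i * (expR x * sin y - y)%:C.
  by rewrite /cexp; simpc; congr (_ +i* _); rewrite subr0.
rewrite (le_trans (nrmD _ _)) // nrmM nrm_i mul1r !nrm_real.
have hre : `|expR x * cos y - 1 - x| <= 4 * r ^+ 2.
  have -> : expR x * cos y - 1 - x = (expR x - 1 - x) - expR x * (1 - cos y) by ring.
  rewrite (le_trans (ler_normB _ _)) // normrM (ger0_norm (expR_ge0 x)) (ger0_norm c1).
  have := expR_ge0 x; nra.
have him : `|expR x * sin y - y| <= 4 * r ^+ 2.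
  have -> : expR x * sin y - y = (expR x - 1) * sin y + (sin y - y) by ring.
  rewrite (le_trans (ler_normD _ _)) // normrM.
  have : `|sin y| <= r := le_trans (abs_sin_le y) hy.
  have := normr_ge0 (sin y); have := normr_ge0 (expR x - 1); nra.
nra.
Qed.

Definition ctail (d : nat) (w : C) : C := cexp w - \sum_(e < d) w ^+ e / (e`!)%:R.

Lemma pow_taylor (rho : R) (e : nat) : exists2 K : R, 0 <= K & forall u h : C,
  nrm u <= rho -> nrm h <= rho ->
  nrm ((u + h) ^+ e.+1 - u ^+ e.+1 - h * (e.+1%:R * u ^+ e)) <= K * nrm h ^+ 2.
Proof.
have [r0|r0] := lerP rho 0.
  exists 0 => // u h hu hh; have {hh}h0 : h = 0.
    by apply: nrm_eq0; apply/eqP; rewrite eq_le nrm_ge0 (le_trans hh).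
  by rewrite h0 addr0 subrr mul0r subr0 nrm0 mul0r.
elim: e => [|e [K K0 IH]].
  exists 0 => // u h _ _; rewrite !expr1 expr0 [X in nrm X](_ : _ = 0) ?nrm0 ?mul0r //.
  by ring.
exists (2 * rho * K + e.+1%:R * rho ^+ e) => [|u h hu hh].
  by rewrite addr_ge0 ?mulr_ge0 ?exprn_ge0 // ltW.
have -> : (u + h) ^+ e.+2 - u ^+ e.+2 - h * (e.+2%:R * u ^+ e.+1) =
  (u + h) * ((u + h) ^+ e.+1 - u ^+ e.+1 - h * (e.+1%:R * u ^+ e)) + e.+1%:R * h ^+ 2 * u ^+ e.
  by rewrite !exprS -(natr1 e.+1); ring.
apply: le_trans (nrmD _ _) _; rewrite [X in _ <= X]mulrDl lerD //.
  rewrite nrmM -mulrA ler_pM ?nrm_ge0 ?IH //.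
  by rewrite (le_trans (nrmD _ _)) // mulr2n mulrDl mul1r lerD.
rewrite !nrmM !nrmX.
have -> : nrm (e.+1%:R : C) = e.+1%:R by rewrite -(rmorph_nat (real_complex R)) nrm_real normr_nat.
have -> : e.+1%:R * rho ^+ e * nrm h ^+ 2 = e.+1%:R * (nrm h * nrm h) * rho ^+ e by ring.
rewrite ler_wpM2l ?mulr_ge0 ?nrm_ge0 //.
by rewrite lerXn2r ?nnegrE ?nrm_ge0 // ltW.
Qed.

Lemma cexp_taylor (rho : R) : exists2 K : R, 0 <= K & forall u h : C,
  nrm u <= rho -> nrm h <= rho ->
  nrm (cexp (u + h) - cexp u - h * cexp u) <= K * nrm h ^+ 2.
Proof.
exists (expR rho * (12 + 4 * (expR rho + 1 + `|rho|))) => [|u h hu hh].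
  by rewrite mulr_ge0 ?expR_ge0 // addr_ge0 // mulr_ge0 // !addr_ge0 ?expR_ge0.
have -> : cexp (u + h) - cexp u - h * cexp u = cexp u * (cexp h - 1 - h).
  by rewrite cexpD; ring.
have r0 : 0 <= rho by apply: le_trans (nrm_ge0 _) hh.
rewrite (ger0_norm r0).
have ee z : nrm z <= rho -> expR (Re z) <= expR rho.
  by move=> hz; rewrite ler_expR (le_trans (ler_norm _)) // (le_trans (Re_le_nrm _)).
rewrite nrmM nrm_cexp -mulrA ler_pM ?expR_ge0 ?nrm_ge0 ?ee //.
have E0 := expR_ge0 rho.
have [h1|h1] := lerP (nrm h) (1 / 2).
  apply: le_trans (cexp_small h1) _; rewrite ler_wpM2r ?exprn_ge0 ?nrm_ge0 //.
  by rewrite lerDl mulr_ge0 // !addr_ge0.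
have h2 : nrm (cexp h - 1 - h) <= expR rho + 1 + rho.
  rewrite (le_trans (nrmD _ _)) // nrmN lerD // (le_trans (nrmD _ _)) // nrmN nrm1.
  by rewrite lerD2r nrm_cexp ee.
apply: le_trans h2 _; have : 1 / 4 <= nrm h ^+ 2 by nra.
nra.
Qed.

(** Induction on [d] by [path_bound]: along t w, the derivative of the next remainder is [w] times
    the present one. The constant [M] dominates the exponential on the whole segment from 0 to [w],
    whose extreme real parts are 0 and [Re w]. *)
Lemma ctail_bound d w (M : R) : 1 <= M -> expR (Re w) <= M -> nrm (ctail d w) <= nrm w ^+ d * M.
Proof.
move=> M1; elim: d w => [|d IH] w hM.
  by rewrite /ctail big_ord0 subr0 nrm_cexp expr0 mul1r.
have M0 : 0 <= M by apply: le_trans M1.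
pose f t := ctail d.+1 (t%:C * w).
have f0 : f 0 = 0.
  rewrite /f mul0r /ctail cexp0 big_ord_recl big1 ?expr0 ?fact0 ?divr1 ?addr0 ?subrr //.
  by move=> i _; rewrite expr0n mul0r.
have f1 : f 1 = ctail d.+1 w by rewrite /f mul1r.
rewrite -f1 -[f 1]subr0 -f0.
have [K1 K10 hK1] := cexp_taylor (nrm w).
have /fin_all_exists2[Kp Kp0 hKp] := fun e : 'I_d => pow_taylor (nrm w) e.
pose K := (K1 + \sum_(e < d) Kp e) * nrm w ^+ 2.
have Ks0 : 0 <= \sum_(e < d) Kp e by apply: sumr_ge0.
apply: (@path_bound f _ K) => [|s t s0 st t1].
  by rewrite mulr_ge0 ?exprn_ge0 ?nrm_ge0 // addr_ge0.
pose u := s%:C * w; pose h := (t - s)%:C * w.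
have uh : t%:C * w = u + h by rewrite /u /h rmorphB; ring.
have nh : nrm h = (t - s) * nrm w by rewrite nrmM nrm_real ger0_norm // subr_ge0.
have nu : nrm u = s * nrm w by rewrite nrmM nrm_real ger0_norm.
have w0 := nrm_ge0 w.
have hu : nrm u <= nrm w by rewrite nu ler_piMl // (le_trans st).
have hh : nrm h <= nrm w by rewrite nh ler_piMl //; lra.
have -> : f t - f s = h * ctail d u + ((cexp (u + h) - cexp u - h * cexp u) -
    \sum_(e < d) ((u + h) ^+ e.+1 - u ^+ e.+1 - h * (e.+1%:R * u ^+ e)) / (e.+1`!)%:R).
  rewrite /f uh -/u /ctail !big_ord_recl /= !expr0 mulrBr mulr_sumr.
  under [X in _ = _ - _ + (_ - X)]eq_bigr => e _.
    rewrite !mulrBl (_ : h * (e.+1%:R * u ^+ e) / (e.+1`!)%:R = h * (u ^+ e / (e`!)%:R)).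
      over.
    rewrite factS natrM; field.
    by rewrite nat1r !pnatr_eq0 -lt0n fact_gt0.
  rewrite !sumrB /bump /=; under eq_bigr do rewrite add1n.
  under [X in _ - (cexp u - (_ + X))]eq_bigr do rewrite add1n.
  by ring.
rewrite (le_trans (nrmD _ _)) // lerD //.
  rewrite nrmM nh exprS.
  have -> : nrm w * nrm w ^+ d * M * (t - s) = (t - s) * nrm w * (nrm w ^+ d * M) by ring.
  rewrite ler_wpM2l ?mulr_ge0 ?subr_ge0 //.
  have hMu : expR (Re u) <= M.
    rewrite /u; simpc => /=; have -> : Re (s%:C * w) = s * Re w by case: (w) => a b; simpc.
    have [wr|wr] := lerP (Re w) 0.
      apply: le_trans M1; rewrite expR_le1; nra.
    apply: le_trans hM; rewrite ler_expR; nra.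
  apply: le_trans (IH u hMu) _; rewrite ler_wpM2r //.
  by rewrite lerXn2r ?nnegrE ?nrm_ge0.
rewrite (le_trans (nrmD _ _)) // nrmN /K -mulrA -exprMn [nrm w * _]mulrC -nh mulrDl lerD ?hK1 //.
rewrite (le_trans (nrm_sum _ _ _)) // mulr_suml; apply: ler_sum => e _.
apply: le_trans (hKp e u h hu hh).
rewrite nrmM ler_piMr ?nrm_ge0 // -(rmorph_nat (real_complex R)) nrmV nrm_real normr_nat.
by rewrite invf_le1 ?ltr0n ?fact_gt0 // ler1n fact_gt0.
Qed.

Lemma cexp_sub2 w (M : R) : 1 <= M -> expR (Re w) <= M ->
  nrm (cexp w - 1 - w) <= nrm w ^+ 2 * M.
Proof.
move=> h1 h2; have := ctail_bound 2 h1 h2.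
by rewrite /ctail !big_ord_recl big_ord0 /= expr0 expr1 fact0 !divr1 addr0 opprD addrA.
Qed.

End Cexp.

Local Ltac nneg := by repeat first
  [ assumption | exact: sqr_ge0 | exact: expR_ge0 | exact: nrm_ge0 | exact: normr_ge0
  | (apply: ltW; assumption) | exact: ler0n | exact: ler01
  | apply: exprn_ge0 | apply: mulr_ge0 | apply: addr_ge0 | rewrite invr_ge0 ].

(** * Poisson summation for Gaussians *)

Section Gaussian.
Variable R : realType.
Local Notation C := R[i].
Local Notation P := ((pi : R)%:C : C).
Implicit Types (h u r : R) (al x w z : C).

(** The common majorant for all Gaussian sums. Its polynomial decay makes grid sums telescope, and a
    translation costs only a constant factor. *)
Definition phi (u : R) : R := (1 + `|u|) ^- 2.

Lemma phi_gt0 u : 0 < phi u.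
Proof. by rewrite invr_gt0 exprn_gt0 // ltr_pwDl. Qed.

Lemma phi_shift u r : phi (u + r) <= (1 + `|r|) ^+ 2 * phi u.
Proof.
have h1 : 0 < 1 + `|u| by rewrite ltr_pwDl.
have h2 : 0 < 1 + `|u + r| by rewrite ltr_pwDl.
have h3 : 0 < 1 + `|r| by rewrite ltr_pwDl.
rewrite /phi -ler_pdivrMr ?invr_gt0 ?exprn_gt0 // invrK mulrC ler_pdivrMr ?exprn_gt0 //.
rewrite -exprMn; apply: lerXn2r; rewrite ?nnegrE; [nneg|nneg|].
have : `|u| <= `|u + r| + `|r| by rewrite -{1}(addrK r u) (le_trans (ler_normB _ _)).
have := normr_ge0 (u + r); have := normr_ge0 r; nra.
Qed.

(** Telescoping: [h / (1 + a + h) ^+ 2] is at most [(1 + a)^-1 - (1 + a + h)^-1], so the bound does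
    not depend on the mesh. *)
Lemma phi_sum_nat h N : 0 < h -> h <= 1 ->
  \sum_(0 <= n < N) h * phi (n%:R * h) <= 2.
Proof.
move=> h0 h1; case: N => [|N]; first by rewrite big_geq.
suff : \sum_(0 <= n < N.+1) h * phi (n%:R * h) <= h + 1 - (1 + N%:R * h)^-1.
  have : 0 < (1 + N%:R * h)^-1 by rewrite invr_gt0 ltr_pwDl // mulr_ge0 // ltW.
  lra.
elim: N => [|N IH].
  by rewrite big_nat1 /phi mul0r normr0 addr0 expr1n invr1 mulr1; lra.
rewrite big_nat_recr //= (le_trans (lerD IH (lexx _))) //.
have a0 : 0 <= N%:R * h by rewrite mulr_ge0 // ltW.
rewrite /phi -natr1 mulrDl mul1r ger0_norm; last lra.
set a := N%:R * h in a0 *.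
have p1 : 0 < 1 + a by lra.
have p2 : 0 < 1 + (a + h) by lra.
have -> : h + 1 - (1 + (a + h))^-1 = h + 1 - (1 + a)^-1 + h * ((1 + a)^-1 * (1 + (a + h))^-1).
  by field; rewrite !gt_eqF.
rewrite lerD2l ler_wpM2l ?(ltW h0) // expr2 invfM ler_pM2r ?invr_gt0 //.
by rewrite lef_pV2 ?posrE //; lra.
Qed.

Lemma phi_sum h : 0 < h -> h <= 1 -> sum_le (fun m : int => h * phi (m%:~R * h)) 4.
Proof.
move=> h0 h1; have -> : 4 = 2 + 2 :> R by rewrite -natrD.
apply: sum_le_int => [m||]; first by rewrite mulr_ge0 ?ltW ?phi_gt0.
  apply: sum_le_nat => [n|N]; first by rewrite mulr_ge0 ?ltW ?phi_gt0.
  exact: phi_sum_nat.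
apply: sum_le_nat => [n|N]; first by rewrite mulr_ge0 ?ltW ?phi_gt0.
apply: le_trans (phi_sum_nat N h0 h1); apply: ler_sum => n _.
rewrite ler_wpM2l ?(ltW h0) // /phi NegzE mulrNz mulNr normrN -pmulrn.
rewrite lef_pV2 ?posrE ?exprn_gt0 ?ltr_pwDl // lerXn2r ?nnegrE ?addr_ge0 //.
by rewrite lerD2l !normrM ler_wpM2r // !normr_nat ler_nat.
Qed.

Lemma nrm_le_ReIm z : nrm z <= `|Re z| + `|Im z|.
Proof.
by rewrite {1}(complex_split z) (le_trans (nrmD _ _)) // nrmM nrm_i mul1r !nrm_real.
Qed.

Definition gau (al x : C) : C := cexp (- P * al * x ^+ 2).

(** For complex [al] and [x] the exponent contains a cross term in the real and imaginary parts of
    [x]. Half of the main square absorbs it, and [2 <= pi <= 4] then removes the factor 1/2 and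
    produces the factor 4. *)
Lemma gau_nrm_le (a0 A Y : R) al x : 0 < a0 -> 0 <= A -> 0 <= Y ->
  a0 <= Re al -> nrm al <= A -> `|Im x| <= Y ->
  nrm (gau al x) <= expR (- (a0 * Re x ^+ 2) + 4 * (A + 2 * A ^+ 2 / a0) * Y ^+ 2).
Proof.
move=> a00 A0 Y0 ha hA hY; rewrite /gau nrm_cexp ler_expR.
have hb := le_trans (Im_le_nrm al) hA; have ha' := le_trans (Re_le_nrm al) hA.
case: al x ha hA hY hb ha' => a b [u v] ha _ hY hb ha'.
have -> : Re (- P * (a +i* b) * (u +i* v) ^+ 2) = - pi * (a * (u ^+ 2 - v ^+ 2) - 2 * b * u * v).
  by rewrite expr2; simpc; rewrite /=; ring.
rewrite /= in ha hY hb ha' *.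
have p4 := @pi_lt4 R; have p2 := @pi_ge2 R.
have a1 : 0 < a by apply: lt_le_trans ha.
have v2 : v ^+ 2 <= Y ^+ 2 by rewrite -sqr_normr lerXn2r ?nnegrE.
have b2 : b ^+ 2 <= A ^+ 2 by rewrite -sqr_normr lerXn2r ?nnegrE.
have aA : a <= A by apply: le_trans (ler_norm _) ha'.
have key : a * u ^+ 2 / 2 - (a + 2 * b ^+ 2 / a) * v ^+ 2 <= a * (u ^+ 2 - v ^+ 2) - 2 * b * u * v.
  rewrite -subr_ge0; have -> : a * (u ^+ 2 - v ^+ 2) - 2 * b * u * v -
      (a * u ^+ 2 / 2 - (a + 2 * b ^+ 2 / a) * v ^+ 2) = a / 2 * (u - 2 * b * v / a) ^+ 2.
    by field; rewrite gt_eqF.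
  by rewrite mulr_ge0 ?sqr_ge0 // divr_ge0 // ltW.
have c1 : a + 2 * b ^+ 2 / a <= A + 2 * A ^+ 2 / a0.
  apply: lerD => //; apply: ler_pM; [nneg|by rewrite invr_ge0 ltW| |].
    by rewrite ler_pM2l.
  by rewrite lef_pV2 ?posrE.
have c0 : 0 <= a + 2 * b ^+ 2 / a.
  nneg.
have c2 : (a + 2 * b ^+ 2 / a) * v ^+ 2 <= (A + 2 * A ^+ 2 / a0) * Y ^+ 2.
  by apply: ler_pM; rewrite ?sqr_ge0.
have q0 : 0 <= (A + 2 * A ^+ 2 / a0) * Y ^+ 2.
  by apply: le_trans c2; rewrite mulr_ge0 ?sqr_ge0.
have au : a0 * u ^+ 2 <= a * u ^+ 2 by rewrite ler_wpM2r ?sqr_ge0.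
have au0 : 0 <= a0 * u ^+ 2 by nneg.
set X := a * (_ - _) - _ in key *; set Q := _ * Y ^+ 2 in c2 q0.
have hX : a0 * u ^+ 2 / 2 - Q <= X by lra.
rewrite -mulrA -/Q; nra.
Qed.

Lemma gau_decay (a0 A Y D : R) : 0 < a0 -> 0 <= A -> 0 <= Y ->
  exists2 K : R, 0 <= K & forall al x,
  a0 <= Re al -> nrm al <= A -> `|Im x| <= Y ->
  nrm (gau al x) * expR (D * `|Re x|) <= K * phi (Re x).
Proof.
move=> a00 A0 Y0.
exists (expR (4 * (A + 2 * A ^+ 2 / a0) * Y ^+ 2 + (D + 2) ^+ 2 / (4 * a0))).
  exact: expR_ge0.
move=> al x ha hA hY; set u := Re x; set Q := 4 * _ * _.
have t0 : 0 < 1 + `|u| by rewrite ltr_pwDl.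
rewrite /phi ler_pdivlMr ?exprn_gt0 //.
have h1 := gau_nrm_le a00 A0 Y0 ha hA hY; rewrite -/u -/Q in h1.
have h2 : (1 + `|u|) ^+ 2 <= expR (2 * `|u|).
  by rewrite expRM_natl; apply: lerXn2r; rewrite ?nnegrE; [nneg|nneg|exact: expR_ge1Dx].
have h3 := ler_wpM2r (expR_ge0 (D * `|u|)) h1.
apply: (@le_trans _ _ (expR (- (a0 * u ^+ 2) + Q) * expR (D * `|u|) * expR (2 * `|u|))).
  by apply: ler_pM => //; nneg.
rewrite -!expRD ler_expR -(sqr_normr u); set t := `|u|.
rewrite -subr_ge0.
have -> : Q + (D + 2) ^+ 2 / (4 * a0) - (- (a0 * t ^+ 2) + Q + D * t + 2 * t)
   = a0 * (t - (D + 2) / (2 * a0)) ^+ 2 by field; rewrite gt_eqF.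
by rewrite mulr_ge0 ?sqr_ge0 // ltW.
Qed.

Lemma nrm1D_le x (Y : R) : `|Im x| <= Y -> 1 + nrm x <= (1 + Y) * expR `|Re x|.
Proof.
move=> hY; have Y0 : 0 <= Y by apply: le_trans hY.
have h1 := nrm_le_ReIm x; have h2 := expR_ge1Dx `|Re x|; have := normr_ge0 (Re x).
nra.
Qed.

Lemma gau_poly (a0 A Y : R) (n : nat) : 0 < a0 -> 0 <= A -> 0 <= Y ->
  exists2 K : R, 0 <= K & forall al x,
  a0 <= Re al -> nrm al <= A -> `|Im x| <= Y ->
  nrm (gau al x) * (1 + nrm x) ^+ n <= K * phi (Re x).
Proof.
move=> a00 A0 Y0; have [K K0 hK] := gau_decay n%:R a00 A0 Y0.
exists ((1 + Y) ^+ n * K) => [|al x ha hA hY].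
  by rewrite mulr_ge0 // exprn_ge0 // addr_ge0.
rewrite -mulrA; apply: le_trans (ler_wpM2l _ (hK al x ha hA hY)); last first.
  by rewrite exprn_ge0 // addr_ge0.
rewrite mulrCA ler_wpM2l ?nrm_ge0 // expRM_natl -exprMn.
by rewrite lerXn2r ?nnegrE ?mulr_ge0 ?expR_ge0 ?addr_ge0 ?nrm_ge0 ?nrm1D_le.
Qed.

Lemma gauD al x w : gau al (x + w) = gau al x * cexp (- P * al * (2 * x * w + w ^+ 2)).
Proof. by rewrite /gau -cexpD; congr cexp; ring. Qed.

Lemma nrm_P : nrm P <= 4.
Proof. by rewrite nrm_real ger0_norm ?pi_ge0 // ltW // pi_lt4. Qed.

Lemma nrm_nat (n : nat) : nrm (n%:R : C) = n%:R.
Proof. by rewrite -(rmorph_nat (real_complex R)) nrm_real normr_nat. Qed.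

(** The spare factor [1 + nrm x] is consumed when this expansion is multiplied by the grid point
    itself, in the summation by parts for the heat equation. *)
Lemma gau_taylor (a0 A Y W : R) : 0 < a0 -> 0 <= A -> 0 <= Y -> 0 <= W ->
  exists2 K : R, 0 <= K & forall al x w,
  a0 <= Re al -> nrm al <= A -> `|Im x| <= Y -> nrm w <= W ->
  nrm (gau al (x + w) - gau al x * (1 - 2 * P * al * x * w)) * (1 + nrm x)
    <= K * nrm w ^+ 2 * phi (Re x).
Proof.
move=> a00 A0 Y0 W0; pose c := 4 * A * (2 + W).
have c0 : 0 <= c by rewrite !mulr_ge0 // addr_ge0.
pose E := expR (c * W * (1 + Y)).
have E0 : 0 <= E by apply: expR_ge0.
have [K K0 hK] := gau_decay (3 + c * W) a00 A0 Y0.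
exists ((c ^+ 2 * E + 4 * A) * (1 + Y) ^+ 3 * K) => [|al x w ha hA hY hW].
  by nneg.
pose v : C := - P * al * (2 * x * w + w ^+ 2).
have x0 := nrm_ge0 x; have w0 := nrm_ge0 w; have g0 := nrm_ge0 (gau al x).
have hPA : nrm P * nrm al <= 4 * A by apply: ler_pM; rewrite ?nrm_ge0 ?nrm_P.
have hv : nrm v <= c * (1 + nrm x) * nrm w.
  rewrite /v nrmM nrmM nrmN.
  have h1 : nrm (2 * x * w + w ^+ 2) <= (2 + W) * (1 + nrm x) * nrm w.
    rewrite (le_trans (nrmD _ _)) // nrmX !nrmM nrm_nat.
    have q1 : nrm w * nrm w <= W * nrm w by rewrite ler_wpM2r.
    have q2 : 0 <= W * nrm x * nrm w by nneg.
    lra.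
  have -> : c * (1 + nrm x) * nrm w = (4 * A) * ((2 + W) * (1 + nrm x) * nrm w).
    by rewrite /c; ring.
  by apply: ler_pM => //; nneg.
have hx := nrm1D_le hY; set m := _ * _ in hx; set ee := expR `|Re x| in m hx.
have ee1 : 1 <= ee by rewrite /ee -expR0 ler_expR.
have hvE : expR (nrm v) <= E * expR (c * W * `|Re x|).
  rewrite -expRD ler_expR (le_trans hv) // -mulrDr.
  have h1 : nrm x <= `|Re x| + Y by rewrite (le_trans (nrm_le_ReIm x)) // lerD2l.
  have h2 : (1 + nrm x) * nrm w <= (1 + Y + `|Re x|) * W by apply: ler_pM; rewrite ?addr_ge0 //; lra.
  have -> : c * W * (1 + Y + `|Re x|) = c * ((1 + Y + `|Re x|) * W) by ring.
  by rewrite -mulrA ler_wpM2l.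
have E1 : 1 <= expR (nrm v) by rewrite -[1]expR0 ler_expR nrm_ge0.
have E2 : expR (Re v) <= expR (nrm v) by rewrite ler_expR (le_trans (ler_norm _)) ?Re_le_nrm.
have T := cexp_sub2 E1 E2.
have -> : gau al (x + w) - gau al x * (1 - 2 * P * al * x * w) =
    gau al x * ((cexp v - 1 - v) - P * al * w ^+ 2).
  by rewrite gauD -/v /v; ring.
set q := expR (c * W * `|Re x|) in hvE; have q1 : 1 <= q.
  by rewrite /q -[1]expR0 ler_expR; nneg.
have b1 : nrm ((cexp v - 1 - v) - P * al * w ^+ 2) <= (c ^+ 2 * E + 4 * A) * m ^+ 2 * q * nrm w ^+ 2.
  have m1 : 1 <= m ^+ 2 by rewrite exprn_ege1 // (le_trans _ hx) // lerDl.
  have -> : (c ^+ 2 * E + 4 * A) * m ^+ 2 * q * nrm w ^+ 2 =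
      (c * m * nrm w) ^+ 2 * (E * q) + 4 * A * (m ^+ 2 * q) * nrm w ^+ 2 by ring.
  apply: le_trans (nrmD _ _) _; rewrite nrmN; apply: lerD.
    apply: le_trans T _; apply: ler_pM => //; [nneg|nneg|].
    apply: lerXn2r; rewrite ?nnegrE; [nneg|rewrite /m /ee; nneg|].
    by apply: le_trans hv _; rewrite ler_wpM2r // ler_wpM2l.
  rewrite nrmM nrmX nrmM; apply: ler_wpM2r; first by nneg.
  apply: le_trans hPA _; rewrite ler_peMr ?mulr_ge0 //; nra.
rewrite nrmM; apply: (@le_trans _ _ (nrm (gau al x) * ((c ^+ 2 * E + 4 * A) * m ^+ 2 * q * nrm w ^+ 2) * m)).
  apply: ler_pM => //; rewrite ?mulr_ge0 ?nrm_ge0 ?addr_ge0 //; exact: ler_wpM2l.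
have := hK al x ha hA hY; rewrite mulrDl expRD expRM_natl -/ee -/q => hK'.
have -> : nrm (gau al x) * ((c ^+ 2 * E + 4 * A) * m ^+ 2 * q * nrm w ^+ 2) * m =
  ((c ^+ 2 * E + 4 * A) * (1 + Y) ^+ 3 * nrm w ^+ 2) * (nrm (gau al x) * (ee ^+ 3 * q)).
  by rewrite /m; ring.
have -> : (c ^+ 2 * E + 4 * A) * (1 + Y) ^+ 3 * K * nrm w ^+ 2 * phi (Re x) =
  ((c ^+ 2 * E + 4 * A) * (1 + Y) ^+ 3 * nrm w ^+ 2) * (K * phi (Re x)) by ring.
by rewrite ler_wpM2l //; nneg.
Qed.

Definition gp (h : R) (m : int) : C := (m%:~R * h)%:C.

Lemma Re_gp h m w : Re (gp h m + w) = m%:~R * h + Re w.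
Proof. by case: w. Qed.

Lemma Im_gp h m w : Im (gp h m + w) = Im w.
Proof. by case: w => a b; rewrite /= add0r. Qed.

Lemma grid_sum_le h r K (f : int -> C) : 0 < h -> h <= 1 -> 0 <= K ->
  (forall m, nrm (f m) <= K * phi (m%:~R * h + r)) ->
  sum_le (fun m => nrm (h%:C * f m)) (K * (1 + `|r|) ^+ 2 * 4).
Proof.
move=> h0 h1 K0 hf A.
apply: (@le_trans _ _ (\sum_(m <- A) K * (1 + `|r|) ^+ 2 * (h * phi (m%:~R * h)))).
  apply: ler_sum => m _; rewrite nrmM nrm_real (gtr0_norm h0).
  have := le_trans (hf m) (ler_wpM2l K0 (phi_shift _ _)).
  by move=> /(ler_wpM2l (ltW h0)) /le_trans; apply; rewrite le_eqVlt; apply/orP; left; apply/eqP; ring.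
by rewrite -mulr_sumr ler_wpM2l ?phi_sum // mulr_ge0 ?sqr_ge0.
Qed.

Lemma grid_summable h r K (f : int -> C) : 0 < h -> h <= 1 -> 0 <= K ->
  (forall m, nrm (f m) <= K * phi (m%:~R * h + r)) -> summable f.
Proof.
move=> h0 h1 K0 /(grid_sum_le h0 h1 K0) hf.
have /(summableZ (h%:C)^-1) : summable (fun m => h%:C * f m) by exists (K * (1 + `|r|) ^+ 2 * 4).
apply: eq_summable => m; rewrite mulrA mulVf ?mul1r //.
by rewrite (_ : 0 = 0%:C) // (inj_eq (@complexI _)) gt_eqF.
Qed.

Lemma grid_tsum h r K (f : int -> C) : 0 < h -> h <= 1 -> 0 <= K ->
  (forall m, nrm (f m) <= K * phi (m%:~R * h + r)) ->
  nrm (h%:C * tsum f) <= K * (1 + `|r|) ^+ 2 * 4.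
Proof.
move=> h0 h1 K0 hf; rewrite -tsumZ; last exact: grid_summable hf.
by apply: tsum_nrm_le; apply: grid_sum_le.
Qed.

(* Riemann sum, of mesh [h], of a shifted Gaussian. *)
Definition Jsum (h : R) (al w : C) : C := h%:C * tsum (fun m => gau al (gp h m + w)).

Lemma gau_summable h al w (n : nat) : 0 < h -> h <= 1 -> 0 < Re al ->
  exists2 K, 0 <= K & forall m,
  nrm (gau al (gp h m + w)) * (1 + nrm (gp h m + w)) ^+ n <= K * phi (m%:~R * h + Re w).
Proof.
move=> h0 h1 a0; have [K K0 hK] := gau_poly n a0 (nrm_ge0 al) (normr_ge0 (Im w)).
by exists K => // m; have := hK al (gp h m + w); rewrite Re_gp Im_gp; apply.
Qed.

Lemma gau_summable0 h al w : 0 < h -> h <= 1 -> 0 < Re al ->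
  summable (fun m => gau al (gp h m + w)).
Proof.
move=> h0 h1 a0; have [K K0 hK] := gau_summable w 0 h0 h1 a0.
by apply: (grid_summable h0 h1 K0 (r := Re w)) => m; have := hK m; rewrite expr0 mulr1.
Qed.

Lemma gpS h m w : gp h (m + 1) + w = gp h m + (w + h%:C).
Proof. by rewrite /gp intrD mulrDl mul1r rmorphD; ring. Qed.

Lemma tsum_shift (f : int -> C) (c : int) : summable f -> tsum (fun m => f (m + c)) = tsum f.
Proof.
by move=> sf; apply: (@tsum_reindex _ _ _ (fun m : int => m + c) (fun m : int => m - c)) => // m;
  rewrite ?addrK ?subrK.
Qed.

Lemma summable_shift (f : int -> C) (c : int) : summable f -> summable (fun m => f (m + c)).
Proof.
move=> sf; apply: (@summable_reindex _ _ _ (fun m : int => m + c) (fun m => m - c)) => // m.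
by rewrite addrK.
Qed.

Lemma Jsum_periodic h al w : 0 < h -> h <= 1 -> 0 < Re al ->
  Jsum h al (w + h%:C) = Jsum h al w.
Proof.
move=> h0 h1 a0; rewrite /Jsum -(tsum_shift 1 (gau_summable0 w h0 h1 a0)).
by congr (_ * _); apply: eq_tsum => m; rewrite gpS.
Qed.

(* Being h-periodic, J_h has a derivative of size O(h), also in imaginary directions. *)
Lemma Jsum_const al (W : R) : 0 < Re al -> 0 <= W ->
  exists2 K, 0 <= K & forall h w, 0 < h -> h <= 1 -> nrm w <= W ->
  nrm (Jsum h al w - Jsum h al 0) <= K * h.
Proof.
move=> a0 W0; have W1 : 0 <= W + 1 by rewrite addr_ge0.
have [K1 K10 hK1] := gau_taylor a0 (nrm_ge0 al) W0 W1.
pose K := K1 * (1 + W) ^+ 2 * 4.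
have K0 : 0 <= K by rewrite /K; nneg.
exists (W * K) => [|h w h0 h1 hw]; first exact: mulr_ge0.
pose dJ (x : C) := h%:C * tsum (fun m => gau al (gp h m + x) * (- 2 * P * al * (gp h m + x))).
have T (x v : C) : nrm x <= W -> nrm v <= W + 1 ->
    nrm (Jsum h al (x + v) - Jsum h al x - v * dJ x) <= K * nrm v ^+ 2.
  move=> hx hv; have ix := le_trans (Im_le_nrm x) hx.
  have [K2 K20 hK2] := gau_summable x 1 h0 h1 a0.
  have sd : summable (fun m => gau al (gp h m + x) * (- 2 * P * al * (gp h m + x))).
    apply: (@grid_summable h (Re x) (K2 * nrm (- 2 * P * al))) => // [|m].
      by rewrite mulr_ge0 ?nrm_ge0.
    set q : C := - 2 * P * al; rewrite nrmM (nrmM q) mulrCA.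
    have -> : K2 * nrm q * phi (m%:~R * h + Re x) = nrm q * (K2 * phi (m%:~R * h + Re x)) by ring.
    rewrite ler_wpM2l ?nrm_ge0 //; apply: le_trans (hK2 m); rewrite expr1.
    by rewrite ler_wpM2l ?nrm_ge0 // lerDr.
  have s1 := gau_summable0 (x + v) h0 h1 a0; have s2 := gau_summable0 x h0 h1 a0.
  have -> : Jsum h al (x + v) - Jsum h al x - v * dJ x = h%:C * tsum (fun m =>
      gau al (gp h m + (x + v)) - gau al (gp h m + x) -
      v * (gau al (gp h m + x) * (- 2 * P * al * (gp h m + x)))).
    rewrite /Jsum /dJ (tsumB (summableB s1 s2) (summableZ v sd)) (tsumB s1 s2) (tsumZ v sd).
    by ring.
  have -> : K * nrm v ^+ 2 = K1 * nrm v ^+ 2 * (1 + W) ^+ 2 * 4 by rewrite /K; ring.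
  apply: (@le_trans _ _ (K1 * nrm v ^+ 2 * (1 + `|Re x|) ^+ 2 * 4)); last first.
    apply: ler_wpM2r => //; apply: ler_wpM2l; first by nneg.
    apply: lerXn2r; rewrite ?nnegrE; [nneg|nneg|].
    by rewrite lerD2l (le_trans (Re_le_nrm x)).
  apply: grid_tsum => // [|m]; first by rewrite mulr_ge0 ?sqr_ge0.
  have := hK1 al (gp h m + x) v (lexx _) (lexx _); rewrite Re_gp Im_gp => /(_ ix hv).
  apply: le_trans; rewrite addrA.
  have -> : gau al (gp h m + x + v) - gau al (gp h m + x) -
     v * (gau al (gp h m + x) * (-2 * P * al * (gp h m + x))) =
     gau al (gp h m + x + v) - gau al (gp h m + x) * (1 - 2 * P * al * (gp h m + x) * v) by ring.
  by rewrite ler_peMr ?nrm_ge0 // lerDl nrm_ge0.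
(* By periodicity the step [h] changes nothing, so the linear term [h%:C * dJ x] equals the
   remainder, which is quadratic in [h]. *)
have dsmall (x : C) : nrm x <= W -> nrm (dJ x) <= K * h.
  move=> hx; have nh : nrm (h%:C : C) = h by rewrite nrm_real gtr0_norm.
  have := T x h%:C hx; rewrite nh => /(_ _); rewrite Jsum_periodic // subrr sub0r nrmN nrmM nh.
  have hW1 : h <= W + 1 by lra.
  by move=> /(_ hW1); rewrite expr2 mulrA [h * nrm _]mulrC ler_pM2r.
have -> : Jsum h al w - Jsum h al 0 = Jsum h al (1%:C * w) - Jsum h al (0%:C * w).
  by rewrite mul1r mul0r.
apply: (@path_bound _ (fun t : R => Jsum h al (t%:C * w)) _ (K * W ^+ 2)) => [|s t s0 st t1].
  by rewrite mulr_ge0 ?sqr_ge0.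
have ts0 : 0 <= t - s by rewrite subr_ge0.
have nv : nrm ((t - s)%:C * w) = (t - s) * nrm w by rewrite nrmM nrm_real ger0_norm.
have w0 := nrm_ge0 w.
have hsw : nrm (s%:C * w) <= W.
  by rewrite nrmM nrm_real ger0_norm //; nra.
have hv : nrm ((t - s)%:C * w) <= W + 1 by rewrite nv; nra.
have := T _ _ hsw hv; have := dsmall _ hsw.
have -> : s%:C * w + (t - s)%:C * w = t%:C * w by rewrite rmorphB; ring.
set d := dJ _ => hd hT.
rewrite (le_trans (nrm_le_add _ ((t - s)%:C * w * d))) //.
apply: lerD.
  rewrite nrmM nv; have := nrm_ge0 d => d0.
  have -> : W * K * h * (t - s) = (t - s) * W * (K * h) by ring.
  by apply: ler_pM => //; rewrite ?mulr_ge0 // ler_wpM2l.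
apply: le_trans hT _; rewrite nv exprMn -mulrA [W ^+ 2 * _]mulrC ler_wpM2l //.
by rewrite ler_wpM2l ?sqr_ge0 // lerXn2r ?nnegrE.
Qed.

End Gaussian.

(** * The dependence of Gaussian Riemann sums on al *)

Section Poisson1.
Variable R : realType.
Local Notation C := R[i].
Local Notation P := ((pi : R)%:C : C).
Implicit Types (h u r : R) (al x w z : C).

Lemma ImJ0 h m : Im (gp h m) = 0. Proof. by []. Qed.
Lemma ReJ0 h m : Re (gp h m) = m%:~R * h. Proof. by []. Qed.

(* The heat equation gives d(al J^2)/d al = O(h); integrate from 1 to al. *)
Lemma Jsum_alpha al : 0 < Re al -> exists2 K, 0 <= K & forall h, 0 < h -> h <= 1 ->
  nrm (al * Jsum h al 0 ^+ 2 - Jsum h 1 0 ^+ 2) <= K * h.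
Proof.
move=> al0; pose a0 := Num.min 1 (Re al); pose D := nrm (al - 1); pose A := 1 + D.
have a00 : 0 < a0 by rewrite lt_min ltr01.
have D0 : 0 <= D by apply: nrm_ge0.
have A0 : 0 <= A by rewrite addr_ge0.
have [K4 K40 hK4] := gau_poly 4 a00 A0 (lexx 0).
have [KT KT0 hKT] := gau_taylor a00 A0 (lexx 0) (@ler01 R).
pose S2 h (a : C) := h%:C * tsum (fun m => gau a (gp h m) * gp h m ^+ 2).
have JE h (a : C) : Jsum h a 0 = h%:C * tsum (fun m => gau a (gp h m)).
  by congr (_ * _); apply: eq_tsum => m; rewrite addr0.
pose reg (a : C) := a0 <= Re a /\ nrm a <= A.
have g4 h m (a : C) : reg a -> nrm (gau a (gp h m)) * (1 + nrm (gp h m)) ^+ 4 <= K4 * phi (m%:~R * h).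
  by case=> h1 h2; have := hK4 a (gp h m) h1 h2; rewrite ImJ0 ReJ0 normr0; apply.
have gj h m (a : C) (j : nat) : reg a -> (j <= 4)%N ->
    nrm (gau a (gp h m)) * nrm (gp h m) ^+ j <= K4 * phi (m%:~R * h + 0).
  move=> ra j4; rewrite addr0; apply: le_trans (g4 h m a ra).
  rewrite ler_wpM2l ?nrm_ge0 //.
  apply: (@le_trans _ _ ((1 + nrm (gp h m)) ^+ j)).
    by rewrite lerXn2r ?nnegrE ?addr_ge0 ?nrm_ge0 // lerDr.
  by rewrite ler_weXn2l // lerDl nrm_ge0.
have sj h (a : C) (j : nat) : reg a -> (j <= 4)%N -> 0 < h -> h <= 1 ->
    summable (fun m => gau a (gp h m) * gp h m ^+ j).
  by move=> ra j4 h0 h1; apply: (grid_summable h0 h1 K40 (r := 0)) => m;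
    rewrite nrmM nrmX; apply: gj.
have s0 h (a : C) : reg a -> 0 < h -> h <= 1 -> summable (fun m => gau a (gp h m)).
  by move=> ra h0 h1; apply: eq_summable (sj h a 0%N ra isT h0 h1) => m; rewrite expr0 mulr1.
pose B := K4 * 4.
have B0 : 0 <= B by rewrite mulr_ge0.
have bj h (a : C) (j : nat) : reg a -> (j <= 4)%N -> 0 < h -> h <= 1 ->
    nrm (h%:C * tsum (fun m => gau a (gp h m) * gp h m ^+ j)) <= B.
  move=> ra j4 h0 h1; have -> : B = K4 * (1 + `|0 : R|) ^+ 2 * 4.
    by rewrite normr0 addr0 expr1n mulr1.
  by apply: grid_tsum => // m; rewrite nrmM nrmX; apply: gj.
have bJ h (a : C) : reg a -> 0 < h -> h <= 1 -> nrm (Jsum h a 0) <= B.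
  move=> ra h0 h1; rewrite JE; apply: le_trans (bj h a 0%N ra isT h0 h1).
  by under [X in _ <= nrm (_ * tsum X)]eq_fun do rewrite expr0 mulr1.
have bS h (a : C) : reg a -> 0 < h -> h <= 1 -> nrm (S2 h a) <= B.
  by move=> ra h0 h1; apply: (bj h a 2%N).
pose K2 := (KT + 8 * A * K4) * 4.
have K20 : 0 <= K2 by rewrite /K2; nneg.
(* Summation by parts: [k] samples x gau(x), with derivative (1 - 2 pi a x^2) gau(x), and the
   increments of [k] over the grid sum to 0. *)
have E2 h (a : C) : reg a -> 0 < h -> h <= 1 ->
    nrm (Jsum h a 0 - 2 * P * a * S2 h a) <= K2 * h.
  move=> ra h0 h1; have hC : nrm (h%:C : C) = h by rewrite nrm_real gtr0_norm.
  pose k m := gau a (gp h m) * gp h m ^+ 1.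
  have sk : summable k by apply: sj.
  have sk1 : summable (fun m => k (m + 1)) := summable_shift 1 sk.
  have t0 := s0 h a ra h0 h1; have t2 := sj h a 2%N ra isT h0 h1.
  have tz := summableZ (2 * P * a) t2; have tq := summableB t0 tz.
  have e1 : h%:C * (Jsum h a 0 - 2 * P * a * S2 h a) =
    - (h%:C * tsum (fun m => k (m + 1) - k m -
      h%:C * (gau a (gp h m) - 2 * P * a * (gau a (gp h m) * gp h m ^+ 2)))).
    rewrite (tsumB (summableB sk1 sk) (summableZ h%:C tq)) (tsumB sk1 sk) (tsum_shift 1 sk).
    by rewrite (tsumZ _ tq) (tsumB t0 tz) (tsumZ _ t2) JE /S2; ring.
  rewrite -(ler_pM2l h0) -{1}hC -nrmM e1 nrmN.
  have -> : h * (K2 * h) = (KT + 8 * A * K4) * h ^+ 2 * (1 + `|0 : R|) ^+ 2 * 4.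
    by rewrite normr0 addr0 expr1n /K2; ring.
  apply: grid_tsum => // [|m].
    by nneg.
  set y := gp h m; set g := gau a y.
  have ky : k (m + 1) = gau a (y + h%:C) * (y + h%:C).
    by rewrite /k expr1 -[gp h (m + 1)]addr0 gpS add0r.
  have -> : k (m + 1) - k m - h%:C * (g - 2 * P * a * (g * y ^+ 2)) =
     (y + h%:C) * (gau a (y + h%:C) - g * (1 - 2 * P * a * y * h%:C))
      - 2 * P * a * h%:C ^+ 2 * (g * y ^+ 1).
    by rewrite ky /k -/y -/g; ring.
  have -> : (KT + 8 * A * K4) * h ^+ 2 * phi (m%:~R * h + 0) =
     KT * h ^+ 2 * phi (m%:~R * h + 0) + 8 * A * K4 * h ^+ 2 * phi (m%:~R * h + 0) by ring.
  apply: le_trans (nrmD _ _) _; rewrite nrmN; apply: lerD.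
    case: (ra) => r1 r2.
    have := hKT a y h%:C r1 r2; rewrite /y ImJ0 ReJ0 normr0 hC -/y => /(_ (lexx _) h1) h3.
    rewrite addr0 nrmM mulrC; apply: le_trans h3; rewrite ler_wpM2l ?nrm_ge0 //.
    by rewrite (le_trans (nrmD _ _)) // hC addrC lerD2r.
  have hh := gj h m a 1%N ra isT; rewrite -/y -/g in hh.
  have h8 : nrm (2 * P * a * h%:C ^+ 2) <= 8 * A * h ^+ 2.
    rewrite !nrmM hC nrm_nat -!expr2 ler_wpM2r ?sqr_ge0 //.
    have -> : 8 * A = 2 * 4 * A by congr (_ * _); rewrite -natrM.
    by case: ra => _ r2; rewrite ler_pM ?mulr_ge0 ?nrm_ge0 // ler_wpM2l // nrm_P.
  rewrite nrmM [nrm (g * _)]nrmM nrmX.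
  have -> : 8 * A * K4 * h ^+ 2 * phi (m%:~R * h + 0) = 8 * A * h ^+ 2 * (K4 * phi (m%:~R * h + 0)) by ring.
  by apply: ler_pM => //; rewrite ?mulr_ge0 ?exprn_ge0 ?nrm_ge0.
pose K1 := 16 * (K4 + K4) * 4.
have K10 : 0 <= K1 by rewrite /K1; nneg.
(* The derivative of the Riemann sum in [al] is [- P * S2]; the second-order remainder needs fourth
   moments. *)
have E1 h (a b : C) : reg a -> reg (a + b) -> 0 < h -> h <= 1 ->
    nrm (Jsum h (a + b) 0 - Jsum h a 0 + P * b * S2 h a) <= K1 * nrm b ^+ 2.
  move=> ra rb h0 h1.
  have -> : Jsum h (a + b) 0 - Jsum h a 0 + P * b * S2 h a = h%:C * tsum (fun m =>
     (gau (a + b) (gp h m) - gau a (gp h m)) + P * b * (gau a (gp h m) * gp h m ^+ 2)).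
    have ta := s0 h a ra h0 h1; have tb := s0 h (a + b) rb h0 h1.
    have t2 := sj h a 2%N ra isT h0 h1.
    by rewrite (tsumD (summableB tb ta) (summableZ _ t2)) (tsumB tb ta) (tsumZ _ t2) !JE /S2; ring.
  have -> : K1 * nrm b ^+ 2 = 16 * nrm b ^+ 2 * (K4 + K4) * (1 + `|0 : R|) ^+ 2 * 4.
    by rewrite normr0 addr0 expr1n /K1; ring.
  apply: grid_tsum => // [|m]; first by nneg.
  set y := gp h m; pose v : C := - P * b * y ^+ 2.
  have gab : gau (a + b) y = gau a y * cexp v by rewrite /gau /v -cexpD; congr cexp; ring.
  have -> : gau (a + b) y - gau a y + P * b * (gau a y * y ^+ 2) = gau a y * (cexp v - 1 - v).
    by rewrite gab /v; ring.
  pose Mx := 1 + expR (Re v).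
  have M1 : 1 <= Mx by rewrite lerDl expR_ge0.
  have M2 : expR (Re v) <= Mx by rewrite lerDr.
  have T := cexp_sub2 M1 M2.
  have nv : nrm v ^+ 2 <= 16 * nrm b ^+ 2 * nrm y ^+ 4.
    rewrite /v nrmM nrmX nrmM nrmN.
    have -> : 16 * nrm b ^+ 2 * nrm y ^+ 4 = (4 * nrm b * nrm y ^+ 2) ^+ 2 by ring.
    rewrite lerXn2r ?nnegrE ?mulr_ge0 ?exprn_ge0 ?nrm_ge0 //.
    by rewrite ler_wpM2r ?exprn_ge0 ?nrm_ge0 // ler_wpM2r ?nrm_ge0 // nrm_P.
  have hgM : nrm (gau a y) * Mx = nrm (gau a y) + nrm (gau (a + b) y).
    by rewrite /Mx mulrDr mulr1 gab nrmM nrm_cexp.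
  rewrite nrmM; apply: (@le_trans _ _ (nrm (gau a y) * (16 * nrm b ^+ 2 * nrm y ^+ 4 * Mx))).
    rewrite ler_wpM2l ?nrm_ge0 //; apply: le_trans T _.
    by rewrite ler_wpM2r // (le_trans _ M1).
  have -> : nrm (gau a y) * (16 * nrm b ^+ 2 * nrm y ^+ 4 * Mx) =
    16 * nrm b ^+ 2 * ((nrm (gau a y) + nrm (gau (a + b) y)) * nrm y ^+ 4).
    by rewrite -hgM; ring.
  rewrite -[X in _ <= X]mulrA; apply: ler_wpM2l; first by nneg.
  by rewrite [X in X <= _]mulrDl [X in _ <= X]mulrDl; apply: lerD; apply: gj.
pose KD := 4 * B + K1 * D.
have KD0 : 0 <= KD by rewrite /KD; nneg.
pose KK := 2 * A * B * K1 + 2 * B * KD + A * KD ^+ 2.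
have KK0 : 0 <= KK by rewrite /KK; nneg.
exists (D * (B * K2)) => [|h h0 h1]; first by nneg.
pose at_ (t : R) : C := 1 + t%:C * (al - 1).
have rt t : 0 <= t -> t <= 1 -> reg (at_ t).
  move=> t0 t1; split.
    have -> : Re (at_ t) = 1 + t * (Re al - 1) by rewrite /at_; case: (al) => p q; simpc.
    have : a0 <= 1 by rewrite ge_min lexx.
    have : a0 <= Re al by rewrite ge_min lexx orbT.
    nra.
  rewrite (le_trans (nrmD _ _)) // nrm1 lerD2l nrmM nrm_real ger0_norm //.
  by rewrite ler_piMl.
pose f t := at_ t * Jsum h (at_ t) 0 ^+ 2.
have -> : al * Jsum h al 0 ^+ 2 - Jsum h 1 0 ^+ 2 = f 1 - f 0.
  have -> : f 1 = al * Jsum h al 0 ^+ 2.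
    by rewrite /f (_ : at_ 1 = al) // /at_ mul1r addrC subrK.
  by rewrite /f (_ : at_ 0 = 1) ?mul1r // /at_ mul0r addr0.
apply: (@path_bound _ f _ (KK * D ^+ 2)) => [|s t t0 st t1].
  by rewrite mulr_ge0 ?sqr_ge0.
pose a := at_ s; pose b : C := (t - s)%:C * (al - 1).
have ab : at_ t = a + b by rewrite /a /b /at_ rmorphB; ring.
have ra : reg a by apply: rt => //; apply: le_trans st t1.
have rb : reg (a + b) by rewrite -ab; apply: rt => //; apply: le_trans st.
have ts : 0 <= t - s by rewrite subr_ge0.
have nb : nrm b = (t - s) * D by rewrite nrmM nrm_real ger0_norm.
clearbody b; have nb0 := nrm_ge0 b.
have nbD : nrm b <= D by rewrite nb ler_piMl //; lra.
set J := Jsum h a 0; set S := S2 h a.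
pose e1 := Jsum h (a + b) 0 - J + P * b * S; pose e2 := J - 2 * P * a * S.
have he1 : nrm e1 <= K1 * nrm b ^+ 2 by apply: E1.
have he2 : nrm e2 <= K2 * h by apply: E2.
have hJ : nrm J <= B by apply: bJ.
have hS : nrm S <= B by apply: bS.
have [_ nA] := ra; have [_ nAb] := rb.
pose d := - (P * b * S) + e1.
have hd : nrm d <= KD * nrm b.
  apply: le_trans (nrmD _ _) _; rewrite nrmN /KD [X in _ <= X]mulrDl; apply: lerD.
    rewrite nrmM (nrmM P) [X in _ <= X]mulrAC; apply: ler_pM => //; [nneg|nneg|].
    by rewrite ler_wpM2r // nrm_P.
  apply: le_trans he1 _; rewrite expr2 mulrA ler_wpM2r // ler_wpM2l //.
(* With J' = - pi S the derivative of a J^2 is J (J - 2 pi a S), that is [J * e2], which is O(h) by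
   [E2]. Everything in the last bracket is quadratic in [b]. *)
have -> : f t - f s = b * J * e2 + (2 * a * J * e1 + 2 * b * J * d + (a + b) * d ^+ 2).
  rewrite /f ab -/a -/J (_ : Jsum h (a + b) 0 = J + d); last by rewrite /d /e1; ring.
  by rewrite /d /e2; ring.
clearbody d e1 e2 J S a.
apply: le_trans (nrmD _ _) _; apply: lerD.
  rewrite !nrmM nb.
  have -> : D * (B * K2) * h * (t - s) = (t - s) * D * B * (K2 * h) by ring.
  by rewrite ler_pM ?mulr_ge0 ?nrm_ge0 // ler_wpM2l // mulr_ge0.
have -> : KK * D ^+ 2 * (t - s) ^+ 2 = 2 * A * B * (K1 * nrm b ^+ 2) +
    2 * nrm b * B * (KD * nrm b) + A * (KD * nrm b) ^+ 2 by rewrite /KK nb; ring.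
apply: le_trans (nrmD _ _) _; apply: lerD; first (apply: le_trans (nrmD _ _) _; apply: lerD).
- rewrite !nrmM nrm_nat ler_pM ?mulr_ge0 ?nrm_ge0 //.
  by rewrite ler_pM ?mulr_ge0 ?nrm_ge0 // ler_wpM2l.
- rewrite !nrmM nrm_nat ler_pM ?mulr_ge0 ?nrm_ge0 //.
  by rewrite ler_wpM2l // mulr_ge0.
- by rewrite nrmM nrmX ler_pM ?exprn_ge0 ?nrm_ge0 // lerXn2r ?nnegrE ?mulr_ge0 ?nrm_ge0.
Qed.

End Poisson1.

(** * Discrete Fourier inversion and the limit of the mesh *)

Section Poisson1b.
Variable R : realType.
Local Notation C := R[i].
Local Notation P := ((pi : R)%:C : C).
Implicit Types (h u r : R) (al x w z : C).

(** With an odd number of subdivisions the frequencies from [- M] to [M] form a full symmetric set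
    of residues, and the integers are grid points. *)
Definition hM (M : nat) : R := (M.*2.+1)%:R^-1.

Lemma hM_gt0 M : 0 < hM M. Proof. by rewrite invr_gt0 ltr0n. Qed.
Lemma hM_le1 M : hM M <= 1. Proof. by rewrite invf_le1 ?ltr0n // ler1n. Qed.

Lemma hM_small (e : R) : 0 < e -> exists M0, forall M, (M0 <= M)%N -> hM M <= e.
Proof.
move=> e0; have e1 : 0 <= e^-1 by rewrite invr_ge0 ltW.
have hb := archi_boundP e1; exists (Num.bound e^-1) => M hM0.
rewrite /hM -(invrK e) lef_pV2 ?posrE ?invr_gt0 // ltW // (lt_le_trans hb) //.
by rewrite ler_nat (leq_trans hM0) // -addnn; lia.
Qed.

(** A Riemann sum for the term of frequency [k] in the Fourier series, at [z], of the periodised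
    Gaussian. *)
Definition Isum (M : nat) (al z : C) (k : int) : C := (hM M)%:C *
  tsum (fun m => gau al (gp (hM M) m + z) * cexp (- twopii R * k%:~R * gp (hM M) m)).

Definition Vterm (al z : C) (k : int) : C := cexp (twopii R * k%:~R * z) * gau al^-1 k%:~R.

(** Completing the square trades the character for a translation by a complex amount, which is why
    Riemann sums are compared at complex shifts. *)
Lemma gau_exchange al x z (k : C) : al != 0 ->
  gau al (x + z) * cexp (- twopii R * k * x) =
  cexp (twopii R * k * z) * gau al^-1 k * gau al (x + (z + 'i * k / al)).
Proof.
move=> al0; rewrite /gau -!cexpD; congr cexp; rewrite /twopii.
have -> : 2 * 'i * P * k * z + - P * al^-1 * k ^+ 2 + - P * al * (x + (z + 'i * k / al)) ^+ 2 =
  - P * al * (x + z) ^+ 2 + - (2 * 'i * P) * k * x - P * k ^+ 2 / al * (1 + 'i ^+ 2).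
  by field.
by rewrite sqr_i subrr mulr0 subr0.
Qed.

Lemma IsumE M al z k : 0 < Re al ->
  Isum M al z k = Vterm al z k * Jsum (hM M) al (z + 'i * k%:~R / al).
Proof.
move=> a0; have al0 : al != 0 by apply: contraTneq a0 => ->; rewrite ltxx.
rewrite /Isum /Jsum mulrCA; congr (_ * _).
rewrite -tsumZ; last by apply: gau_summable0 => //; [apply: hM_gt0|apply: hM_le1].
by apply: eq_tsum => m; rewrite gau_exchange.
Qed.

Lemma Re_inv_gt0 al : 0 < Re al -> 0 < Re al^-1.
Proof.
case: al => a b /= a0; rewrite divr_gt0 // ltr_pwDl ?exprn_gt0 ?sqr_ge0 //.
Qed.

Lemma nrm_cexp_im (x : R) : nrm (cexp ('i * x%:C)) = 1.
Proof. by rewrite nrm_cexp -[RHS]expR0; congr expR; simpc. Qed.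

Lemma nrm_chi (k : int) h m : nrm (cexp (- twopii R * k%:~R * gp h m)) = 1.
Proof.
have -> : - twopii R * k%:~R * gp h m = 'i * (- (2 * pi * k%:~R * (m%:~R * h)))%:C.
  by rewrite /twopii /gp !(rmorphN, rmorphM) /= rmorph_nat !rmorph_int; ring.
exact: nrm_cexp_im.
Qed.

Lemma Vterm_bound al z : 0 < Re al -> exists2 K, 0 <= K & forall k, nrm (Vterm al z k) <= K * phi k%:~R.
Proof.
move=> a0; have b0 := Re_inv_gt0 a0.
have [K K0 hK] := gau_decay (8 * `|Im z|) b0 (nrm_ge0 al^-1) (lexx 0).
exists K => // k; have := hK al^-1 k%:~R (lexx _) (lexx _).
have -> : Re (k%:~R : C) = k%:~R by rewrite -(rmorph_int (real_complex R)).
have -> : Im (k%:~R : C) = 0 by rewrite -(rmorph_int (real_complex R)).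
rewrite normr0 => /(_ (lexx _)); apply: le_trans.
rewrite nrmM mulrC ler_wpM2l ?nrm_ge0 // nrm_cexp ler_expR.
have -> : Re (twopii R * k%:~R * z) = - (2 * pi) * k%:~R * Im z.
  rewrite /twopii -(rmorph_int (real_complex R)) -(rmorph_nat (real_complex R)).
  by case: (z) => p q; simpc; rewrite /=; ring.
apply: le_trans (ler_norm _) _; rewrite !normrM normrN normrM normr_nat (ger0_norm (pi_ge0 _)).
have := @pi_lt4 R; have := normr_ge0 (Im z); have k0 := normr_ge0 (k%:~R : R) => z0 p4.
rewrite [X in _ <= X]mulrAC ler_wpM2r // ler_wpM2r //; lra.
Qed.

Lemma phi_sum1 : sum_le (fun m : int => phi (m%:~R : R)) 4.
Proof.
move=> A; have := phi_sum (@ltr01 R) (lexx 1) A.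
by under eq_bigr do rewrite mul1r mulr1.
Qed.

Lemma phi_dom_summable (f : int -> C) K : 0 <= K -> (forall k, nrm (f k) <= K * phi k%:~R) -> summable f.
Proof.
move=> K0 hf; apply: (@summable_dom _ _ _ (fun k => K * phi k%:~R) (K * 4)) => // A.
by rewrite -mulr_sumr ler_wpM2l // phi_sum1.
Qed.

Lemma Vterm_summable al z : 0 < Re al -> summable (Vterm al z).
Proof. by move=> /(Vterm_bound z)[K K0 hK]; apply: phi_dom_summable hK. Qed.

(** Two summations by parts: multiplication by [om + om^-1 - 2] replaces the Gaussian by its second
    difference, of order [h ^+ 2]. For [|k| <= M] the angle [th] stays in [-pi, pi], where that
    factor is at least [k%:~R ^+ 2 * h ^+ 2 / 2]. The quotient is a decay in 1/k^2 uniform in the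
    mesh, as dominated convergence requires. *)
Lemma Isum_bound al z : 0 < Re al -> exists2 K, 0 <= K & forall M (k : int),
  (`|k| <= M)%N -> nrm (Isum M al z k) <= K * phi k%:~R.
Proof.
move=> a0; have [K1 K10 hK1] := gau_taylor a0 (nrm_ge0 al) (normr_ge0 (Im z)) (@ler01 R).
have [K2 K20 hK2] := gau_poly 0 a0 (nrm_ge0 al) (normr_ge0 (Im z)).
pose Z := (1 + `|Re z|) ^+ 2; have Z0 : 0 <= Z by rewrite /Z; nneg.
exists (64 * K1 * Z + K2 * Z * 4) => [|M k kM]; first by nneg.
have h0 := hM_gt0 M; have h1 := hM_le1 M; set h := hM M in h0 h1 *.
pose f m := gau al (gp h m + z); pose e m := cexp (- twopii R * k%:~R * gp h m).
have sf : summable (fun m => f m * e m).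
  apply: (grid_summable h0 h1 K20 (r := Re z)) => m; rewrite nrmM [X in _ * X]nrm_chi mulr1.
  by have := hK2 al (gp h m + z); rewrite Re_gp Im_gp expr0 mulr1; apply.
have hI0 : nrm (Isum M al z k) <= K2 * Z * 4.
  apply: grid_tsum => // m; rewrite nrmM [X in _ * X]nrm_chi mulr1.
  by have := hK2 al (gp h m + z); rewrite Re_gp Im_gp expr0 mulr1; apply.
have p0 := phi_gt0 (k%:~R : R).
have [k0|k0] := eqVneq k 0.
  apply: le_trans hI0 _; rewrite k0 /phi normr0 addr0 expr1n invr1 mulr1 lerDr; nneg.
set I := Isum M al z k.
pose th : R := 2 * pi * k%:~R * h; pose om := cexp (- twopii R * k%:~R * h%:C).
have omE : om = cos th +i* - sin th.
  rewrite /om (_ : - twopii R * k%:~R * h%:C = 'i * (- th)%:C).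
    by rewrite cexp_im cosN sinN.
  by rewrite /twopii /th !(rmorphN, rmorphM) /= rmorph_nat rmorph_int; ring.
have om0 : om != 0 by apply: cexp_neq0.
have eS m : e (m + 1) = e m * om.
  by rewrite /e /om -cexpD /gp intrD mulrDl mul1r rmorphD; congr cexp; ring.
have eP m : e (m - 1) = e m * om^-1.
  have := eS (m - 1); rewrite subrK => ->; by rewrite mulfK.
have sfp : summable (fun m => f (m + 1) * e m).
  apply: eq_summable (summableZ om^-1 (summable_shift 1 sf)) => m.
  by rewrite eS mulrC -!mulrA mulfV // mulr1.
have sfm : summable (fun m => f (m - 1) * e m).
  apply: eq_summable (summableZ om (summable_shift (-1) sf)) => m.
  by rewrite eP mulrC -!mulrA mulVf // mulr1.
have key : (om + om^-1 - 2) * I = h%:C * tsum (fun m => (f (m + 1) + f (m - 1) - 2 * f m) * e m).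
  have -> : tsum (fun m => (f (m + 1) + f (m - 1) - 2 * f m) * e m) =
     tsum (fun m => f (m + 1) * e m) + tsum (fun m => f (m - 1) * e m) - 2 * tsum (fun m => f m * e m).
    rewrite -(tsumZ 2 sf) -(tsumD sfp sfm) -(tsumB (summableD sfp sfm) (summableZ 2 sf)).
    by apply: eq_tsum => m; ring.
  have -> : tsum (fun m => f (m + 1) * e m) = om^-1 * tsum (fun m => f m * e m).
    rewrite -(tsum_shift 1 sf) -(tsumZ _ (summable_shift 1 sf)).
    by apply: eq_tsum => m; rewrite eS [RHS]mulrC -!mulrA mulfV // mulr1.
  have -> : tsum (fun m => f (m - 1) * e m) = om * tsum (fun m => f m * e m).
    rewrite -(tsum_shift (-1) sf) -(tsumZ _ (summable_shift (-1) sf)).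
    by apply: eq_tsum => m; rewrite eP [RHS]mulrC -!mulrA mulVf // mulr1.
  by rewrite /I /Isum -/h -/f; set T := tsum _; ring.
have b1 : nrm ((om + om^-1 - 2) * I) <= 2 * K1 * h ^+ 2 * Z * 4.
  rewrite key; apply: grid_tsum => // [|m]; first by nneg.
  rewrite nrmM [X in _ * X]nrm_chi mulr1.
  have T w : nrm w <= 1 -> nrm (gau al (gp h m + z + w) -
      gau al (gp h m + z) * (1 - 2 * P * al * (gp h m + z) * w)) <= K1 * nrm w ^+ 2 * phi (m%:~R * h + Re z).
    move=> hw; have := hK1 al (gp h m + z) w (lexx _) (lexx _); rewrite Re_gp Im_gp => /(_ (lexx _) hw).
    by apply: le_trans; rewrite ler_peMr ?nrm_ge0 // lerDl nrm_ge0.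
  have nh : nrm (h%:C : C) = h by rewrite nrm_real gtr0_norm.
  have T1 := T h%:C; rewrite nh in T1; have {}T1 := T1 h1.
  have T2 := T (- h%:C); rewrite nrmN nh in T2; have {}T2 := T2 h1.
  have fS : f (m + 1) = gau al (gp h m + z + h%:C) by rewrite /f gpS addrA.
  have fP : f (m - 1) = gau al (gp h m + z - h%:C).
    by rewrite /f; congr gau; rewrite /gp intrB mulrBl mul1r rmorphB; ring.
  rewrite fS fP /f; set y := gp h m + z in T1 T2 *.
  have -> : gau al (y + h%:C) + gau al (y - h%:C) - 2 * gau al y =
    (gau al (y + h%:C) - gau al y * (1 - 2 * P * al * y * h%:C)) +
    (gau al (y - h%:C) - gau al y * (1 - 2 * P * al * y * - h%:C)) by ring.
  rewrite (le_trans (nrmD _ _)) // (le_trans (lerD T1 T2)) //.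
  by rewrite le_eqVlt; apply/orP; left; apply/eqP; ring.
have omV : om + om^-1 - 2 = (2 * (cos th - 1))%:C.
  have -> : om^-1 = cos th +i* sin th.
    apply: (mulfI om0); rewrite mulfV // omE; simpc.
    by rewrite [sin th * cos th]mulrC subrr -!expr2 cos2Dsin2.
  have -> : (2 : C) = (2 : R) +i* 0 by rewrite -(rmorph_nat (real_complex R)).
  by rewrite omE; simpc; congr (_ +i* _); ring.
have thpi : `|th| <= pi.
  rewrite /th !normrM normr_nat (ger0_norm (pi_ge0 _)) (gtr0_norm h0).
  have kb : `|k%:~R : R| <= M%:R by rewrite -intr_norm -abszE -pmulrn ler_nat.
  have : `|k%:~R : R| * h <= 1 / 2.
    rewrite /h /hM ler_pdivrMr ?ltr0n // (le_trans kb) //.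
    have -> : (M.*2.+1)%:R = 2 * M%:R + 1 :> R by rewrite -natr1 -muln2 natrM mulrC.
    lra.
  by have := @pi_gt0 R; nra.
have b2 : k%:~R ^+ 2 * h ^+ 2 / 2 <= nrm (om + om^-1 - 2).
  rewrite omV nrm_real normrM normr_nat -normrN opprB ger0_norm; last by have /andP[] := one_sub_cos_le th.
  have hc := one_sub_cos_ge thpi; have p2 := @pi_ge2 R; pose q := k%:~R * h.
  have thE : th = 2 * (pi * q) by rewrite /th /q; ring.
  have -> : k%:~R ^+ 2 * h ^+ 2 / 2 = q ^+ 2 / 2 by rewrite /q; ring.
  have h4 : 4 * q ^+ 2 <= (pi * q) ^+ 2.
    have pp : 4 <= pi ^+ 2 :> R by nra.
    have := ler_wpM2r (sqr_ge0 q) pp.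
    by have -> : pi ^+ 2 * q ^+ 2 = (pi * q) ^+ 2 by ring.
  have h5 : th ^+ 2 = 4 * (pi * q) ^+ 2 by rewrite thE; ring.
  rewrite h5 in hc; lra.
have kk : 1 <= (k%:~R : R) ^+ 2.
  by rewrite -rmorphXn -[1](rmorph1 (intmul 1)) ler_int; move: k0; clear; lia.
have b3 : nrm I * k%:~R ^+ 2 <= 16 * K1 * Z.
  have h20 : 0 < h ^+ 2 / 2 by rewrite divr_gt0 // exprn_gt0.
  rewrite -(ler_pM2r h20).
  have -> : nrm I * k%:~R ^+ 2 * (h ^+ 2 / 2) = k%:~R ^+ 2 * h ^+ 2 / 2 * nrm I by ring.
  have -> : 16 * K1 * Z * (h ^+ 2 / 2) = 2 * K1 * h ^+ 2 * Z * 4 by field.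
  by apply: le_trans b1; rewrite nrmM ler_wpM2r ?nrm_ge0.
have b4 : (1 + `|k%:~R : R|) ^+ 2 <= 4 * k%:~R ^+ 2.
  rewrite -(sqr_normr (k%:~R)); have : 1 <= `|k%:~R : R|.
    by move: kk; rewrite -(sqr_normr (k%:~R)); have := normr_ge0 (k%:~R : R); nra.
  nra.
rewrite mulrDl; apply: (@le_trans _ _ (64 * K1 * Z * phi k%:~R)); last by rewrite lerDl; nneg.
rewrite /phi ler_pdivlMr ?exprn_gt0 ?ltr_pwDl //.
apply: (@le_trans _ _ (nrm I * (4 * k%:~R ^+ 2))); first by rewrite ler_wpM2l ?nrm_ge0.
by have := b3; lra.
Qed.

Lemma roots_sum M (m : int) :
  \sum_(j < M.*2.+1) cexp (- twopii R * (Posz j - Posz M)%:~R * gp (hM M) m) =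
  if ((M.*2.+1)%:Z %| m)%Z then (M.*2.+1)%:R else 0.
Proof.
set N := M.*2.+1; have N0 : (N%:R : R) != 0 by rewrite pnatr_eq0.
have gpN q : gp (hM M) (q * N%:Z) = q%:~R.
  by rewrite /gp intrM /hM -/N -pmulrn -mulrA mulfV // mulr1 rmorph_int.
case: ifPn => [/dvdzP[q ->]|ndiv].
  rewrite gpN (eq_bigr (fun _ => 1)) ?sumr_const ?card_ord // => j _.
  rewrite -[RHS](cexp_2pii_int R (- ((Posz j - Posz M) * q))); congr cexp.
  by rewrite mulrNz intrM; ring.
pose zt := cexp (- twopii R * gp (hM M) m).
have -> : \sum_(j < N) cexp (- twopii R * (Posz j - Posz M)%:~R * gp (hM M) m) =
   cexp (twopii R * M%:R * gp (hM M) m) * \sum_(j < N) zt ^+ j.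
  rewrite mulr_sumr; apply: eq_bigr => j _; rewrite /zt -cexp_natM -cexpD; congr cexp.
  by rewrite intrB -!pmulrn; ring.
have ztN : zt ^+ N = 1.
  rewrite /zt -cexp_natM -[RHS](cexp_2pii_int R (- m)); congr cexp.
  have -> : gp (hM M) m = m%:~R / N%:R.
    by rewrite /gp /hM rmorphM rmorph_int fmorphV rmorph_nat.
  rewrite mulrNz; field; by rewrite pnatr_eq0.
(* Otherwise sin(pi r / N) = 0, where [r] is the nonzero residue of [m] modulo [N]. *)
have zt1 : zt != 1.
  apply: contra ndiv => /eqP zt1; apply/dvdz_mod0P; apply/eqP.
  pose r := (m %% N%:Z)%Z; pose q := (m %/ N%:Z)%Z.
  have mE : m = q * N%:Z + r by apply: divz_eq.
  have r0 : 0 <= r by apply: modz_ge0.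
  have rN : r < N%:Z by apply: ltz_pmod.
  rewrite -/r; apply: contraT => rn0; exfalso.
  have rpos : 0 < r by rewrite lt_neqAle eq_sym rn0.
  pose t : R := pi * (r%:~R * hM M).
  have : zt = cexp ('i * (- (2 * t))%:C).
    rewrite /zt mE /gp intrD mulrDl rmorphD /= -/(gp (hM M) (q * N%:Z)) gpN mulrDr cexpD.
    have -> : - twopii R * q%:~R = twopii R * (- q)%:~R by rewrite mulrNz; ring.
    rewrite cexp_2pii_int mul1r; congr cexp.
    by rewrite /twopii /t rmorphN !rmorphM /= rmorph_nat; ring.
  rewrite zt1 cexp_im cosN => /(congr1 (@complex.Re R)) /= h.
  have := one_sub_cosE (2 * t); rewrite -h subrr (_ : 2 * t / 2 = t); last by field.
  move=> /esym/eqP; rewrite mulf_eq0 pnatr_eq0 /= sqrf_eq0; apply/negP.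
  rewrite gt_eqF // sin_gt0_pi //; apply/andP; split.
    by rewrite mulr_gt0 ?pi_gt0 // mulr_gt0 ?hM_gt0 // ltr0z.
  rewrite gtr_pMr ?pi_gt0 // /hM ltr_pdivrMr ?ltr0n // mul1r -/N.
  by rewrite (_ : N%:R = (N%:Z)%:~R) // ltr_int.
have := subrX1 zt N; rewrite ztN subrr => /esym/eqP; rewrite mulf_eq0 subr_eq0 (negPf zt1) /=.
by move=> /eqP ->; rewrite mulr0.
Qed.

(** Exact at every mesh: by orthogonality of the characters only the indices divisible by [2 M + 1]
    survive, and these grid points are the integers. *)
Lemma Isum_DFT M al z : 0 < Re al ->
  \sum_(j < M.*2.+1) Isum M al z (Posz j - Posz M) = tsum (fun m : int => gau al (m%:~R + z)).
Proof.
move=> a0; set N := M.*2.+1; set h := hM M.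
have h0 := hM_gt0 M; have h1 := hM_le1 M; rewrite -/h in h0 h1.
have hN : (h%:C : C) * N%:R = 1.
  by rewrite /h /hM fmorphV rmorph_nat mulVf // pnatr_eq0.
have sg : summable (fun m => gau al (gp h m + z)) by apply: gau_summable0.
have sc k : summable (fun m => gau al (gp h m + z) * cexp (- twopii R * k%:~R * gp h m)).
  case: sg => K hK; exists K => A; apply: le_trans (hK A); apply: ler_sum => m _.
  by rewrite nrmM [X in _ * X]nrm_chi mulr1.
rewrite /Isum -/h -mulr_sumr -tsum_sum; last by move=> j; apply: sc.
pose f m : C := if (N%:Z %| m)%Z then gau al (gp h m + z) else 0.
have -> : h%:C * tsum (fun m => \sum_(j < N) (gau al (gp h m + z) *
    cexp (- twopii R * (Posz j - Posz M)%:~R * gp h m))) = tsum f.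
  rewrite -tsumZ; last by apply: summable_sum => j; apply: sc.
  apply: eq_tsum => m; rewrite -mulr_sumr roots_sum /f -/N.
  by case: ifP => _; rewrite ?mulr0 // mulrCA hN mulr1.
have sf : summable f.
  case: sg => K hK; exists K => A; apply: le_trans (hK A); apply: ler_sum => m _.
  by rewrite /f; case: ifP => _ //; rewrite nrm0 nrm_ge0.
rewrite -(@tsum_inj _ _ _ (fun m => m * N%:Z) (fun m => (m %/ N%:Z)%Z)) //.
- apply: eq_tsum => m /=; rewrite /f dvdz_mull ?dvdzz //; congr gau; congr (_ + _).
  by rewrite /gp intrM /h /hM -/N -mulrA -pmulrn mulfV ?mulr1 ?rmorph_int // pnatr_eq0.
- by move=> m; rewrite mulzK.
- by move=> m /eqP; rewrite /f; case: ifP => // /divzK ->; rewrite eqxx.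
Qed.

Lemma tsum_window (f : int -> C) M :
  tsum (fun k => if (`|k| <= M)%N then f k else 0) = \sum_(j < M.*2.+1) f (Posz j - Posz M).
Proof.
pose s := [seq Posz j - Posz M | j <- iota 0 M.*2.+1].
have us : uniq s by rewrite map_inj_uniq ?iota_uniq // => i j /addIr [].
rewrite (@fin_supp_tsum _ _ _ [fset k in s]%fset).
  rewrite (fsum_seq _ us) big_map -(big_mkord xpredT (fun j => f (Posz j - Posz M))).
  rewrite /index_iota subn0; apply: eq_big_seq => j; rewrite mem_iota => /andP[_ hj].
  by case: ifP => // /negP[]; move: hj; rewrite add0n -addnn; lia.
move=> k; case: ifP => // hk /negP[]; rewrite in_fset /=; apply/mapP.
exists (absz (k + Posz M)); last by move: hk; lia.
by rewrite mem_iota; move: hk; rewrite -addnn; lia.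
Qed.

Definition Fsum (al z : C) : C := tsum (fun m : int => gau al (m%:~R + z)).
Definition Vsum (al z : C) : C := tsum (Vterm al z).

(** Each [Isum] is a [Vterm] times a shifted [Jsum], and removing the shift costs O(h). The limit
    passes under the sum over frequencies although [Jsum] itself is not yet known to converge. *)
Lemma cvgC_Isum al z : 0 < Re al ->
  cvgC (fun M => Fsum al z - Jsum (hM M) al 0 * Vsum al z) 0.
Proof.
move=> a0; have [K1 K10 hK1] := Isum_bound z a0; have [K2 K20 hK2] := Vterm_bound z a0.
have [K3 K30 hK3] := gau_poly 0 a0 (nrm_ge0 al) (lexx 0).
have hJ M : nrm (Jsum (hM M) al 0) <= K3 * 4.
  have -> : K3 * 4 = K3 * (1 + `|0 : R|) ^+ 2 * 4 by rewrite normr0 addr0 expr1n mulr1.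
  apply: grid_tsum => // [||m]; [exact: hM_gt0|exact: hM_le1|].
  have := hK3 al (gp (hM M) m + 0); rewrite Re_gp Im_gp expr0 mulr1 normr0; apply => //.
pose F M k := (if (`|k| <= M)%N then Isum M al z k else 0) - Jsum (hM M) al 0 * Vterm al z k.
have sV := Vterm_summable z a0.
have FE M : tsum (F M) = Fsum al z - Jsum (hM M) al 0 * Vsum al z.
  rewrite /F tsumB; first by rewrite tsum_window Isum_DFT // tsumZ.
    apply: (phi_dom_summable K10) => k; case: ifP => hk; first exact: hK1.
    by rewrite nrm0 mulr_ge0 // ltW // phi_gt0.
  exact: summableZ.
have -> : (fun M => Fsum al z - Jsum (hM M) al 0 * Vsum al z) = (fun M => tsum (F M)).
  by apply: funext => M; rewrite FE.
rewrite -(tsum0 R int); apply: (@tannery _ _ _ _ (fun k => (K1 + K3 * 4 * K2) * phi k%:~R) ((K1 + K3 * 4 * K2) * 4)).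
- move=> k; have W0 := nrm_ge0 (z + 'i * k%:~R / al).
  have [K4 K40 hK4] := Jsum_const a0 W0 => e e0.
  have V0 := nrm_ge0 (Vterm al z k).
  pose d := e / (nrm (Vterm al z k) * K4 + 1).
  have q0 : 0 < nrm (Vterm al z k) * K4 + 1 by rewrite ltr_wpDl ?mulr_ge0.
  have [M0 hM0] := hM_small (divr_gt0 e0 q0).
  exists (maxn M0 `|k|%N) => M; rewrite geq_max => /andP[/hM0 hh hk].
  rewrite subr0 /F hk IsumE // [Vterm _ _ _ * _]mulrC -mulrBl nrmM.
  have := hK4 (hM M) _ (hM_gt0 M) (hM_le1 M) (lexx _) => hJc.
  apply: le_trans (ler_wpM2r V0 hJc) _.
  apply: (@le_trans _ _ ((nrm (Vterm al z k) * K4 + 1) * (e / (nrm (Vterm al z k) * K4 + 1)))).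
    apply: (@le_trans _ _ ((nrm (Vterm al z k) * K4 + 1) * hM M)); last by rewrite ler_wpM2l // ltW.
    rewrite mulrDl mul1r; have := hM_gt0 M; have -> : K4 * hM M * nrm (Vterm al z k) = nrm (Vterm al z k) * K4 * hM M by ring.
    lra.
  by rewrite mulrC mulfVK // gt_eqF.
- move=> M k; apply: le_trans (nrmD _ _) _; rewrite nrmN nrmM mulrDl; apply: lerD.
    by case: ifP => hk; [exact: hK1|rewrite nrm0 mulr_ge0 // ltW // phi_gt0].
  have -> : K3 * 4 * K2 * phi k%:~R = (K3 * 4) * (K2 * phi k%:~R) by ring.
  by apply: ler_pM => //; exact: nrm_ge0.
- by move=> A; rewrite -mulr_sumr ler_wpM2l ?phi_sum1 //; nneg.
Qed.

Lemma gau_real (a x : R) : gau a%:C x%:C = (expR (- (pi * a * x ^+ 2)))%:C.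
Proof. by rewrite /gau -cexp_real -rmorphXn -rmorphN -!rmorphM; congr (cexp _%:C); ring. Qed.

(** The Gaussian integral is not computed: at [al = 1] and [z = 0] both sides of Poisson summation
    are the same positive series, which forces the factor to tend to 1. *)
Lemma Jsum1_cvg : cvgC (fun M => Jsum (hM M) 1 0) 1.
Proof.
have R1 : 0 < Re (1 : C) by rewrite ltr01.
have h := cvgC_Isum 0 R1.
pose S := Fsum 1 0.
have gE (m : int) : gau 1 (m%:~R + 0) = (expR (- (pi * 1 * m%:~R ^+ 2)))%:C.
  rewrite /gau addr0 -cexp_real; congr cexp.
  by rewrite rmorphN !rmorphM rmorph1 rmorph_int; ring.
have SV : Vsum 1 0 = S.
  by apply: eq_tsum => k; rewrite /Vterm mulr0 cexp0 mul1r invr1 addr0.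
have S0 : S != 0.
  have sS : summable (fun m : int => (expR (- (pi * 1 * m%:~R ^+ 2)))%:C : C).
    apply: eq_summable (Vterm_summable 0 R1) => k.
    by rewrite /Vterm mulr0 cexp0 mul1r invr1 -gE addr0.
  have := tsum_ge 0 (fun m : int => expR_ge0 (- (pi * 1 * (m%:~R : R) ^+ 2))) sS.
  rewrite (_ : tsum _ = S); last by apply: eq_tsum => m; rewrite gE.
  by apply: contraTneq => ->; rewrite -ltNge expR_gt0.
have := cvgCD (cvgCZ (- S^-1) h) (cvgC_cst 1); rewrite mulr0 add0r; congr cvgC.
by apply: funext => M; rewrite SV -/S; field.
Qed.

(** The estimate in [al] controls only the square of [Jsum]. Its convergence, to a definite square
    root of [al^-1], follows from one [z] where the dual series is nonzero. If that series vanishes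
    for all [z], so does the other side and either root serves. *)
Theorem poisson1 al : 0 < Re al -> exists2 c, c ^+ 2 = al^-1 & forall z, Fsum al z = c * Vsum al z.
Proof.
move=> a0; have al0 : al != 0 by apply: contraTneq a0 => ->; rewrite ltxx.
have hJ : cvgC (fun M => al * Jsum (hM M) al 0 ^+ 2) 1.
  have [K K0 hK] := Jsum_alpha a0.
  have h0 : cvgC (fun M => al * Jsum (hM M) al 0 ^+ 2 - Jsum (hM M) 1 0 ^+ 2) 0.
    move=> e e0; have q0 : 0 < K + 1 by rewrite ltr_wpDl.
    have [M0 h] := hM_small (divr_gt0 e0 q0); exists M0 => M /h hh; rewrite subr0.
    apply: le_trans (hK _ (hM_gt0 M) (hM_le1 M)) _.
    apply: (@le_trans _ _ ((K + 1) * (e / (K + 1)))); last by rewrite mulrC mulfVK // gt_eqF.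
    by apply: ler_pM => //; rewrite ?lerDl // ltW // hM_gt0.
  have := cvgCD h0 (cvgCM Jsum1_cvg Jsum1_cvg); rewrite add0r mulr1; congr cvgC.
  by apply: funext => M; rewrite expr2 subrK.
have [[z0 V0]|nV] := pselect (exists z, Vsum al z != 0).
  pose c := Fsum al z0 / Vsum al z0.
  have hc : cvgC (fun M => Jsum (hM M) al 0) c.
    have := cvgCD (cvgCZ (- (Vsum al z0)^-1) (cvgC_Isum z0 a0)) (cvgC_cst c).
    rewrite mulr0 add0r; congr cvgC; apply: funext => M; rewrite /c; by field.
  exists c => [|z].
    have := cvgC_uniq hJ (cvgCZ al (cvgCM hc hc)) => /esym h.
    by apply: (mulfI al0); rewrite expr2 h mulfV.
  have := cvgCD (cvgC_cst (Fsum al z)) (cvgCZ (- Vsum al z) hc).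
  have -> : (fun M => Fsum al z + - Vsum al z * Jsum (hM M) al 0) =
    (fun M => Fsum al z - Jsum (hM M) al 0 * Vsum al z) by apply: funext => M; ring.
  move=> /(cvgC_uniq (cvgC_Isum z a0)) /esym/eqP; rewrite mulNr subr_eq0 => /eqP ->.
  by rewrite mulrC.
exists (sqrtC al^-1) => [|z]; first by rewrite sqrtCK.
have Vz : Vsum al z = 0 by apply: contra_notP nV => /eqP h; exists z.
have := cvgC_Isum z a0; rewrite Vz mulr0.
have -> : (fun M => Fsum al z - Jsum (hM M) al 0 * 0) = (fun M => Fsum al z).
  by apply: funext => M; rewrite mulr0 subr0.
by move=> h; apply: cvgC_uniq (cvgC_cst _) h.
Qed.

(** The character is absorbed into a complex shift of [z]. The induction on the dimension needs such
    twists. *)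
Lemma poisson1_twist al c z (b : C) : 0 < Re al -> (forall z, Fsum al z = c * Vsum al z) ->
  tsum (fun m : int => gau al (m%:~R + z) * cexp (twopii R * b * (m%:~R + z))) =
  c * tsum (fun k : int => gau al^-1 (k%:~R - b) * cexp (twopii R * k%:~R * z)).
Proof.
move=> a0 hc; have al0 : al != 0 by apply: contraTneq a0 => ->; rewrite ltxx.
pose w := z - 'i * b / al.
have e1 (m : int) : gau al (m%:~R + z) * cexp (twopii R * b * (m%:~R + z)) =
    gau al^-1 b * gau al (m%:~R + w).
  rewrite /gau -!cexpD; congr cexp; rewrite /w /twopii; apply/eqP; rewrite -subr_eq0; apply/eqP.
  rewrite (_ : _ - _ = P * b ^+ 2 / al * (1 + 'i ^+ 2)); last by field.
  by rewrite sqr_i subrr mulr0.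
have e2 (k : int) : gau al^-1 b * Vterm al w k = gau al^-1 (k%:~R - b) * cexp (twopii R * k%:~R * z).
  rewrite /Vterm /gau -!cexpD; congr cexp; rewrite /w /twopii; apply/eqP; rewrite -subr_eq0; apply/eqP.
  rewrite (_ : _ - _ = - (2 * P * k%:~R * b / al) * (1 + 'i ^+ 2)); last by field.
  by rewrite sqr_i subrr mulr0.
have sF : summable (fun m : int => gau al (m%:~R + w)).
  apply: eq_summable (gau_summable0 w (@ltr01 R) (lexx 1) a0) => m.
  by rewrite /gp mulr1 rmorph_int.
rewrite (eq_tsum e1) tsumZ // -/(Fsum al w) hc mulrCA; congr (_ * _).
by rewrite /Vsum -(tsumZ _ (Vterm_summable w a0)); apply: eq_tsum => k; rewrite e2.
Qed.

End Poisson1b.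

(** * Poisson summation for positive definite forms *)

Section PoissonN.
Variable R : realType.
Local Notation C := R[i].
Local Notation P := ((pi : R)%:C : C).

Definition dp (n : nat) (u v : 'rV[R]_n) : R := (u *m v^T) 0 0.
Definition qf (n : nat) (A : 'M[R]_n) (x : 'rV[R]_n) : R := (x *m A *m x^T) 0 0.
Definition posdef (n : nat) (A : 'M[R]_n) : Prop := A^T = A /\ forall x, x != 0 -> 0 < qf A x.
Definition zv (n : nat) (m : 'rV[int]_n) : 'rV[R]_n := map_mx (fun k : int => k%:~R) m.
Definition gN (al : C) (q : R) : C := cexp (- P * al * q%:C).
Definition chiR (x : R) : C := cexp (twopii R * x%:C).

Lemma gND al p q : gN al (p + q) = gN al p * gN al q.
Proof. by rewrite /gN -cexpD; congr cexp; rewrite rmorphD /=; ring. Qed.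

Lemma chiRD x y : chiR (x + y) = chiR x * chiR y.
Proof. by rewrite /chiR -cexpD; congr cexp; rewrite rmorphD /=; ring. Qed.

Lemma nrm_chiR x : nrm (chiR x) = 1.
Proof.
rewrite /chiR (_ : twopii R * x%:C = 'i * (2 * pi * x)%:C) ?nrm_cexp_im //.
by rewrite /twopii !rmorphM rmorph_nat; ring.
Qed.

Lemma nrm_gN al q : nrm (gN al q) = expR (- (pi * Re al * q)).
Proof.
rewrite /gN nrm_cexp; congr expR; case: al => a b; simpc; rewrite /=; ring.
Qed.

Lemma dpC n (u v : 'rV[R]_n) : dp u v = dp v u.
Proof. by rewrite /dp !mxE; apply: eq_bigr => i _; rewrite !mxE mulrC. Qed.

Lemma dpDl n (u u' v : 'rV[R]_n) : dp (u + u') v = dp u v + dp u' v.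
Proof. by rewrite /dp mulmxDl mxE. Qed.

Lemma dpZl n c (u v : 'rV[R]_n) : dp (c *: u) v = c * dp u v.
Proof. by rewrite /dp -scalemxAl mxE. Qed.

Lemma dpDr n (u v v' : 'rV[R]_n) : dp u (v + v') = dp u v + dp u v'.
Proof. by rewrite !(dpC u) dpDl. Qed.

Lemma dp_row n (x0 y0 : R) (x1 y1 : 'rV[R]_n) :
  dp (row_mx x0%:M x1 : 'rV_(1 + n)) (row_mx y0%:M y1) = x0 * y0 + dp x1 y1.
Proof. by rewrite /dp tr_row_mx mul_row_col mxE tr_scalar_mx -scalar_mxM mxE eqxx. Qed.

Lemma row_split n (x : 'rV[R]_(1 + n)) : x = row_mx (x 0 0)%:M (rsubmx x).
Proof.
rewrite -[LHS]hsubmxK; congr row_mx; rewrite [LHS]mx11_scalar mxE; congr (x _ _)%:M.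
exact: val_inj.
Qed.

Definition schur n (a : R) (w : 'rV[R]_n) (S : 'M[R]_n) : 'M[R]_(1 + n) :=
  block_mx a%:M (a *: w) (a *: w^T) (S + a *: (w^T *m w)).

Lemma schur_mul n a (w : 'rV[R]_n) S x0 x1 :
  (row_mx x0%:M x1 : 'rV_(1 + n)) *m schur a w S =
  row_mx (a * (x0 + dp x1 w))%:M ((a * (x0 + dp x1 w)) *: w + x1 *m S).
Proof.
have e : x1 *m w^T = (dp x1 w)%:M by rewrite [LHS]mx11_scalar.
rewrite /schur mul_row_block; congr row_mx.
  rewrite -scalar_mxM -scalemxAr e scale_scalar_mx -raddfD /=.
  by congr (_%:M); ring.
rewrite mul_scalar_mx mulmxDr -scalemxAr mulmxA e mul_scalar_mx !scalerA addrC -addrA -scalerDl.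
by rewrite addrC; congr (_ *: _ + _); ring.
Qed.

Lemma qf_schur n a (w : 'rV[R]_n) S x0 x1 :
  qf (schur a w S) (row_mx x0%:M x1 : 'rV_(1 + n)) = a * (x0 + dp x1 w) ^+ 2 + qf S x1.
Proof.
rewrite /qf schur_mul -/(dp _ (row_mx x0%:M x1)) dp_row dpDl dpZl (dpC w) -/(dp (x1 *m S) x1).
by ring.
Qed.

Lemma posdef_schur n (A : 'M[R]_(1 + n)) : posdef A ->
  exists a w S, [/\ 0 < a, posdef S & A = schur a w S].
Proof.
move=> [sA pA]; pose a := A 0 0; pose w := a^-1 *: ursubmx A.
pose S := drsubmx A - a *: (w^T *m w).
have a0 : 0 < a.
  have : (row_mx 1%:M 0 : 'rV[R]_(1 + n)) != 0.
    apply/eqP => /(congr1 lsubmx); rewrite row_mxKl linear0 => /matrixP /(_ 0 0).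
    by rewrite !mxE /= => /eqP; rewrite oner_eq0.
  move=> /pA; rewrite /qf -[A]submxK mul_row_block !mul0mx !addr0 !mul1mx tr_row_mx.
  rewrite trmx0 tr_scalar_mx mul_row_col mulmx0 addr0 mulmx1 !mxE.
  by rewrite (_ : A _ _ = a) //; congr (A _ _); apply: val_inj.
have AE : A = schur a w S.
  rewrite /schur subrK -[LHS]submxK; congr block_mx.
  - by rewrite [LHS]mx11_scalar !mxE; congr (_%:M); congr (A _ _); apply: val_inj.
  - by rewrite scalerA mulfV ?scale1r // gt_eqF.
  - by rewrite linearZ /= scalerA mulfV ?scale1r ?gt_eqF // trmx_ursub sA.
exists a, w, S; split => //; split.
  rewrite /S linearB linearZ /= trmx_mul trmxK; congr (_ - _).
  by rewrite trmx_drsub sA.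
move=> x1 x10; have : (row_mx (- dp x1 w)%:M x1 : 'rV[R]_(1 + n)) != 0.
  by apply: contra x10 => /eqP /(congr1 rsubmx); rewrite row_mxKr linear0 => ->.
by move=> /pA; rewrite AE qf_schur addNr expr0n mulr0 add0r.
Qed.

(* Reduce the translation modulo 1. *)
Lemma gauss_sum1 (t : R) : 0 < t -> exists K, forall z : R,
  sum_le (fun m : int => expR (- (t * (m%:~R + z) ^+ 2))) K.
Proof.
move=> t0; pose a := t / pi; have a0 : 0 < a by rewrite divr_gt0 ?pi_gt0.
have ar : 0 < Re (a%:C : C) by [].
have [K K0 hK] := gau_poly 0 ar (nrm_ge0 (a%:C : C)) (lexx 0).
exists (K * 4 * 4) => z.
pose k := Num.floor z; pose r := z - k%:~R.
have r1 : `|r| <= 1.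
  have h1 := floor_le_tmp z; have h2 := floorD1_gt z.
  rewrite ger0_norm /r; last by rewrite subr_ge0.
  by move: h2; rewrite intrD -/k; lra.
have h : sum_le (fun m : int => expR (- (t * (m%:~R + r) ^+ 2))) (K * 4 * 4).
  have h1 : sum_le (fun m : int => nrm ((1 : R)%:C * (expR (- (t * (m%:~R + r) ^+ 2)))%:C : C))
      (K * (1 + `|r|) ^+ 2 * 4).
    apply: grid_sum_le => // m.
    have := hK a%:C (m%:~R + r)%:C; rewrite gau_real expr0 !mulr1 /= normr0.
    rewrite (_ : pi * a = t); last by rewrite /a mulrC mulfVK // gt_eqF // pi_gt0.
    by move=> h1; apply: h1.
  move=> A; have := h1 A; under eq_bigr do rewrite mul1r nrm_real ger0_norm ?expR_ge0 //.
  move=> /le_trans; apply; rewrite ler_wpM2r // ler_wpM2l //.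
  have : (1 + `|r|) ^+ 2 <= 2 ^+ 2 by apply: lerXn2r; rewrite ?nnegrE; [nneg|nneg|lra].
  by rewrite -natrX.
have pq : cancel (fun m : int => m + k) (fun m => m - k) by move=> m; rewrite addrK.
have := sum_le_reindex pq h.
by congr sum_le; apply: funext => m /=; rewrite /r intrD; congr (expR (- (t * _ ^+ 2))); ring.
Qed.

Definition Tm n (A : 'M[R]_n) (al : C) (z b : 'rV[R]_n) (m : 'rV[int]_n) : C :=
  gN al (qf A (zv m + z)) * chiR (dp b (zv m + z)).

Definition Ty n (Q : 'rV[R]_n -> R) (al : C) (z b : 'rV[R]_n) (y : 'rV[int]_n) : C :=
  gN al^-1 (Q (zv y - b)) * chiR (dp (zv y) z).

(** The bound is uniform in [z] because, after a square is completed, the shift of one variable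
    depends on the others. *)
Definition gauss_summable n (Q : 'rV[R]_n -> R) : Prop := forall t : R, 0 < t ->
  exists K, forall z, sum_le (fun m : 'rV[int]_n => expR (- (t * Q (zv m + z)))) K.

Lemma zv_row n (m0 : int) (m1 : 'rV[int]_n) :
  zv (row_mx m0%:M m1 : 'rV_(1 + n)) = row_mx (m0%:~R)%:M (zv m1).
Proof. by rewrite /zv map_row_mx map_scalar_mx. Qed.

Lemma row_mx00 (V : nmodType) n (a : V) (x : 'rV[V]_n) : (row_mx a%:M x : 'rV_(1 + n)) 0 0 = a.
Proof. by rewrite mxE; case: splitP => [j _|j //]; rewrite (ord1 j) mxE eqxx. Qed.

Lemma eq_sum_le (I : choiceType) (u v : I -> R) K : u =1 v -> sum_le u K -> sum_le v K.
Proof. by move=> /funext ->. Qed.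

Definition splitr n (m : 'rV[int]_(1 + n)) : 'rV[int]_n * int := (rsubmx m, m 0 0).
Definition joinr n (x : 'rV[int]_n * int) : 'rV[int]_(1 + n) := row_mx x.2%:M x.1.

Lemma splitrK n : cancel (@splitr n) (@joinr n).
Proof.
move=> m; rewrite /splitr /joinr /= -[RHS]hsubmxK; congr row_mx.
rewrite [RHS]mx11_scalar mxE; congr (m _ _)%:M; exact: val_inj.
Qed.

Lemma joinrK n : cancel (@joinr n) (@splitr n).
Proof.
move=> [m1 m0]; rewrite /splitr /joinr /= row_mxKr; congr (_, _).
exact: row_mx00.
Qed.

Definition splitl n (m : 'rV[int]_(1 + n)) : int * 'rV[int]_n := (m 0 0, rsubmx m).
Definition joinl n (x : int * 'rV[int]_n) : 'rV[int]_(1 + n) := row_mx x.1%:M x.2.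

Lemma splitlK n : cancel (@splitl n) (@joinl n).
Proof. move=> m; exact: (splitrK m). Qed.

Lemma joinlK n : cancel (@joinl n) (@splitl n).
Proof. by move=> [m0 m1]; have := joinrK (m1, m0); rewrite /splitr => -[h1 h2]; rewrite /splitl h1 h2. Qed.

Lemma sum_leZ (I : choiceType) (u : I -> R) K c : 0 <= c -> sum_le u K -> sum_le (fun i => c * u i) (c * K).
Proof. by move=> c0 hu A; rewrite -mulr_sumr ler_wpM2l. Qed.

Lemma gauss_summable_schur n a (w : 'rV[R]_n) S : 0 < a -> gauss_summable (qf S) ->
  gauss_summable (qf (schur a w S)).
Proof.
move=> a0 hS t t0; have [K2 hK2] := hS t t0.
have [K1 hK1] := gauss_sum1 (mulr_gt0 t0 a0).
have K10 : 0 <= K1 by apply: le_trans (hK1 0 fset0); rewrite big_seq_fset0.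
exists (K1 * K2) => z; rewrite (row_split z); set z0 := z 0 0; set z1 := rsubmx z.
pose U (x : 'rV[int]_n * int) := expR (- (t * qf (schur a w S) (zv (joinr x) + row_mx z0%:M z1))).
have hU : sum_le U (K1 * K2).
  apply: (@sum_le_prod _ _ _ U (fun m1 => K1 * expR (- (t * qf S (zv m1 + z1))))).
  - by move=> x; apply: expR_ge0.
  - move=> m1; have := sum_leZ (expR_ge0 (- (t * qf S (zv m1 + z1)))) (hK1 (z0 + dp (zv m1 + z1) w)).
    rewrite [K1 * _]mulrC; apply: eq_sum_le => m0.
    rewrite /U /joinr /= zv_row add_row_mx -raddfD qf_schur -expRD; congr expR.
    by ring.
  - exact: sum_leZ.
by apply: eq_sum_le (sum_le_reindex (@splitrK n) hU) => m; rewrite /comp /U splitrK.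
Qed.

(** If [Q] is the form of the inverse of [S], this is the form of the inverse of [schur a w S].
    Being kept as a function, it requires no matrix inversion. *)
Definition qdual n (a : R) (w : 'rV[R]_n) (Q : 'rV[R]_n -> R) (y : 'rV[R]_(1 + n)) : R :=
  y 0 0 ^+ 2 / a + Q (rsubmx y - y 0 0 *: w).

Lemma qdual_row n a (w : 'rV[R]_n) Q y0 y1 :
  qdual a w Q (row_mx y0%:M y1 : 'rV_(1 + n)) = y0 ^+ 2 / a + Q (y1 - y0 *: w).
Proof.
by rewrite /qdual row_mxKr row_mx00.
Qed.

Lemma gauss_summable_dual n a (w : 'rV[R]_n) Q : 0 < a -> gauss_summable Q ->
  gauss_summable (qdual a w Q).
Proof.
move=> a0 hQ t t0; have [K2 hK2] := hQ t t0.
have [K1 hK1] := gauss_sum1 (divr_gt0 t0 a0).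
have K20 : 0 <= K2 by apply: le_trans (hK2 0 fset0); rewrite big_seq_fset0.
exists (K2 * K1) => z; rewrite (row_split z); set z0 := z 0 0; set z1 := rsubmx z.
pose U (x : int * 'rV[int]_n) := expR (- (t * qdual a w Q (zv (joinl x) + row_mx z0%:M z1))).
have hU : sum_le U (K2 * K1).
  apply: (@sum_le_prod _ _ _ U (fun y0 => K2 * expR (- (t / a * (y0%:~R + z0) ^+ 2)))).
  - by move=> x; apply: expR_ge0.
  - move=> y0; have := sum_leZ (expR_ge0 (- (t / a * (y0%:~R + z0) ^+ 2)))
      (hK2 (z1 - (y0%:~R + z0) *: w)).
    rewrite [K2 * _]mulrC; apply: eq_sum_le => y1.
    rewrite /U /joinl /= zv_row add_row_mx -raddfD qdual_row -expRD addrA; congr expR.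
    by ring.
  - exact: sum_leZ.
by apply: eq_sum_le (sum_le_reindex (@splitlK n) hU) => m; rewrite /comp /U splitlK.
Qed.

Lemma nrm_Tm n (A : 'M[R]_n) al z b m :
  nrm (Tm A al z b m) = expR (- (pi * Re al * qf A (zv m + z))).
Proof. by rewrite nrmM [X in _ * X]nrm_chiR mulr1 nrm_gN. Qed.

Lemma nrm_Ty n (Q : 'rV[R]_n -> R) al z b m :
  nrm (Ty Q al z b m) = expR (- (pi * Re al^-1 * Q (zv m - b))).
Proof. by rewrite nrmM [X in _ * X]nrm_chiR mulr1 nrm_gN. Qed.

Lemma Tm_summable n (A : 'M[R]_n) al z b : gauss_summable (qf A) -> 0 < Re al ->
  summable (Tm A al z b).
Proof.
move=> hA a0; have [K hK] := hA _ (mulr_gt0 (pi_gt0 R) a0); exists K => B.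
by apply: le_trans (hK z B); apply: ler_sum => m _; rewrite nrm_Tm.
Qed.

Lemma Ty_summable n (Q : 'rV[R]_n -> R) al z b : gauss_summable Q -> 0 < Re al ->
  summable (Ty Q al z b).
Proof.
move=> hQ a0; have [K hK] := hQ _ (mulr_gt0 (pi_gt0 R) (Re_inv_gt0 a0)); exists K => B.
by apply: le_trans (hK (- b) B); apply: ler_sum => m _; rewrite nrm_Ty.
Qed.

Lemma gN_gau al (a : R) (x : R) : gN al (a * x ^+ 2) = gau (al * a%:C) x%:C.
Proof. by rewrite /gN /gau !rmorphM /=; congr cexp; ring. Qed.

Lemma nrm_gau_real al (x : R) : nrm (gau al x%:C) = expR (- (pi * Re al * x ^+ 2)).
Proof. by rewrite -nrm_gN /gN rmorphXn. Qed.

Lemma Ty_row n a (w : 'rV[R]_n) Q al z0 z1 b0 b1 (y0 : int) (y1 : 'rV[int]_n) :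
  Ty (qdual a w Q) al (row_mx z0%:M z1) (row_mx b0%:M b1) (joinl (y0, y1)) =
  gN al^-1 ((y0%:~R - b0) ^+ 2 / a) * gN al^-1 (Q (zv y1 - b1 - (y0%:~R - b0) *: w)) *
  (chiR (y0%:~R * z0) * chiR (dp (zv y1) z1)).
Proof.
rewrite /Ty /joinl zv_row opp_row_mx add_row_mx -raddfB qdual_row gND dp_row chiRD.
by [].
Qed.

(** Induction on the dimension, one coordinate being split off by completing a square. The relation
    [Q (x *m A) = qf A x] identifies [Q] as the inverse form, and [kap] is built up as the inverse
    of the determinant. The twist [b] is part of the statement because transforming the first
    coordinate creates one in the others. *)
Theorem poissonN n (A : 'M[R]_n) : posdef A ->
  [/\ gauss_summable (qf A) & exists Q (kap : R),
  [/\ gauss_summable Q, forall x, Q (x *m A) = qf A x, 0 < kap &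
    forall al, 0 < Re al -> exists2 K : C, K ^+ 2 = kap%:C * al ^- n &
      forall z b, tsum (Tm A al z b) = K * tsum (Ty Q al z b)]].
Proof.
elim: n A => [|n IH] A pA.
  have one (f : 'rV[int]_0 -> C) : tsum f = f 0.
    rewrite (@fin_supp_tsum _ _ _ [fset 0]%fset) ?big_seq_fset1 // => m.
    by rewrite inE (thinmx0 m) eqxx.
  have q0 x : qf A x = 0 by rewrite /qf (thinmx0 x) !mul0mx mxE.
  have gs (Q : 'rV[R]_0 -> R) : (forall x, Q x = 0) -> gauss_summable Q.
    move=> hQ t t0; exists 1 => z B; apply: (@le_trans _ _ (\sum_(m <- [fset 0 : 'rV[int]_0]%fset) expR (- (t * Q (zv m + z))))).
      apply: fsum_le => [m|]; first exact: expR_ge0.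
      by apply/fsubsetP => m _; rewrite inE (thinmx0 m).
    by rewrite big_seq_fset1 hQ mulr0 oppr0 expR0.
  split; first exact: gs.
  exists (fun _ => 0), 1; split => // [|al a0]; first exact: gs.
  exists 1 => [|z b]; first by rewrite expr0 invr1 mulr1 expr1n.
  rewrite !one /Tm /Ty q0 mul1r; congr (_ * _).
    by rewrite /gN !mulr0.
  by rewrite /dp (thinmx0 b) (thinmx0 (zv 0)) !mul0mx.
have [a [w [S [a0 pS ->]]]] := posdef_schur pA.
have [gS [Q [kap [gQ QS kap0 hP]]]] := IH S pS.
split; first exact: gauss_summable_schur.
exists (qdual a w Q), (kap / a); split.
- exact: gauss_summable_dual.
- move=> x; rewrite (row_split x) schur_mul qdual_row addrAC subrr add0r QS qf_schur.
  by congr (_ + _); field; rewrite gt_eqF.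
- exact: divr_gt0.
move=> al al0; have [K' K'2 hK'] := hP al al0.
have aC : (a%:C : C) != 0 by rewrite (_ : 0 = 0%:C) // (inj_eq (@complexI _)) gt_eqF.
have aln0 : al != 0 by apply: contraTneq al0 => ->; rewrite ltxx.
have ala : 0 < Re (al * a%:C).
  by case: (al) al0 => p q /= p0; rewrite mulr0 subr0 mulr_gt0.
have [c c2 hc] := poisson1 ala.
exists (c * K') => [|z b].
  rewrite exprMn c2 K'2 exprS rmorphM fmorphV /=; field.
  by rewrite aC aln0 expf_neq0.
have := Tm_summable z b (gauss_summable_schur w a0 gS) al0.
have := Ty_summable z b (gauss_summable_dual w a0 gQ) al0.
rewrite (row_split z) (row_split b).
set z0 := z 0 0; set z1 := @rsubmx R 1 1 n z; set b0 := b 0 0; set b1 := @rsubmx R 1 1 n b => sR sL.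
pose Gy (y0 : int) : C := gau (al * a%:C)^-1 (y0%:~R - b0%:C) * chiR (y0%:~R * z0).
(* The twist of the remaining coordinates once the first is replaced by its dual variable [y0]: the
   linear term in [w] comes from the completed square. *)
pose bb (y0 : int) : 'rV[R]_n := b1 + (y0%:~R - b0) *: w.
pose X (m1 : 'rV[int]_n) (y0 : int) : C := Gy y0 * Tm S al z1 (bb y0) m1.
have TmE m1 m0 : Tm (schur a w S) al (row_mx z0%:M z1) (row_mx b0%:M b1) (joinr (m1, m0)) =
    Tm S al z1 (b1 - b0 *: w) m1 * (gau (al * a%:C) (m0%:~R + (z0 + dp (zv m1 + z1) w)%:C) *
      cexp (twopii R * b0%:C * (m0%:~R + (z0 + dp (zv m1 + z1) w)%:C))).
  rewrite /Tm /joinr /= zv_row add_row_mx -raddfD qf_schur dp_row gND gN_gau.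
  set s := dp (zv m1 + z1) w.
  have -> : b0 * (m0%:~R + z0) + dp b1 (zv m1 + z1) =
     dp (b1 - b0 *: w) (zv m1 + z1) + b0 * (m0%:~R + (z0 + s)).
    by rewrite dpDl -scaleNr dpZl (dpC w) -/s; ring.
  rewrite chiRD.
  have -> : (m0%:~R + z0 + s)%:C = m0%:~R + (z0 + s)%:C :> C.
    by rewrite !rmorphD rmorph_int addrA.
  have -> : chiR (b0 * (m0%:~R + (z0 + s))) = cexp (twopii R * b0%:C * (m0%:~R + (z0 + s)%:C)).
    by rewrite /chiR; congr cexp; rewrite rmorphM !rmorphD rmorph_int mulrA.
  by ring.
have XE m1 y0 : X m1 y0 = Tm S al z1 (b1 - b0 *: w) m1 *
    (gau (al * a%:C)^-1 (y0%:~R - b0%:C) *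
      cexp (twopii R * y0%:~R * (z0 + dp (zv m1 + z1) w)%:C)).
  rewrite /X /Gy /Tm /bb; set s := dp (zv m1 + z1) w.
  have -> : dp (b1 + (y0%:~R - b0) *: w) (zv m1 + z1) = dp (b1 - b0 *: w) (zv m1 + z1) + y0%:~R * s.
    by rewrite !dpDl -scaleNr !dpZl (dpC w) -/s; ring.
  have -> : cexp (twopii R * y0%:~R * (z0 + s)%:C) = chiR (y0%:~R * z0) * chiR (y0%:~R * s).
    by rewrite -chiRD /chiR -mulrDr rmorphM rmorph_int mulrA.
  by rewrite chiRD; ring.
have inner m1 : tsum (fun m0 => Tm (schur a w S) al (row_mx z0%:M z1) (row_mx b0%:M b1) (joinr (m1, m0))) =
    c * tsum (X m1).
  under [LHS]eq_tsum do rewrite TmE.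
  rewrite tsumZ; last first.
    have := summable_section m1 (summable_reindex (@joinrK n) sL).
    move=> /(summableZ (Tm S al z1 (b1 - b0 *: w) m1)^-1); apply: eq_summable => m0 /=.
    rewrite TmE mulrA mulVf ?mul1r // /Tm mulf_neq0 ?cexp_neq0 //.
  rewrite (poisson1_twist _ _ ala hc) mulrCA; congr (_ * _); rewrite -tsumZ.
    by apply: eq_tsum => y0; rewrite XE.
  have := Vterm_summable ((z0 + dp (zv m1 + z1) w)%:C - 'i * b0%:C / (al * a%:C)) ala.
  move=> /(summableZ (gau (al * a%:C)^-1 b0%:C)); apply: eq_summable => k.
  have nz : al * a%:C != 0 by rewrite mulf_neq0.
  rewrite /Vterm /gau -!cexpD; congr cexp; rewrite /twopii; apply/eqP; rewrite -subr_eq0; apply/eqP.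
  rewrite (_ : _ - _ = - (2 * P * k%:~R * b0%:C / (al * a%:C)) * (1 + 'i ^+ 2)); last first.
    by field; rewrite aC aln0.
  by rewrite sqr_i subrr mulr0.
have sX : summable (fun x : 'rV[int]_n * int => X x.1 x.2).
  have [K1 hK1] := gauss_sum1 (mulr_gt0 (pi_gt0 R) (Re_inv_gt0 ala)).
  have [K2 hK2] := gS _ (mulr_gt0 (pi_gt0 R) al0).
  have K10 : 0 <= K1 by apply: le_trans (hK1 0 fset0); rewrite big_seq_fset0.
  exists (K1 * K2); apply: (@sum_le_prod _ _ _ (fun x => nrm (X x.1 x.2))
      (fun m1 => K1 * expR (- (pi * Re al * qf S (zv m1 + z1))))).
  - by move=> x; apply: nrm_ge0.
  - move=> m1; have := sum_leZ (expR_ge0 (- (pi * Re al * qf S (zv m1 + z1)))) (hK1 (- b0)).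
    rewrite [K1 * _]mulrC; apply: eq_sum_le => y0 /=.
    rewrite /X nrmM [X in _ = _ * X]nrm_Tm mulrC; congr (_ * _).
    rewrite /Gy nrmM [X in _ = _ * X]nrm_chiR mulr1.
    have -> : y0%:~R - b0%:C = (y0%:~R - b0)%:C :> C by rewrite rmorphB rmorph_int.
    by rewrite nrm_gau_real.
  - exact: sum_leZ.
rewrite -(tsum_reindex (@joinrK n) (@splitrK n) sL).
rewrite (fubini (summable_reindex (@joinrK n) sL)) /=.
under [LHS]eq_tsum do rewrite inner.
have sX1 : summable (fun m1 => tsum (X m1)) := summable_tsum sX.
(* With the dual variable [y0] now outermost, the induction hypothesis applies for each [y0]
   separately, with twist [bb y0]. *)
rewrite tsumZ // (fubini_swap sX) -mulrA; congr (_ * _).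
rewrite -(tsum_reindex (@joinlK n) (@splitlK n) sR).
rewrite (fubini (summable_reindex (@joinlK n) sR)) /= -tsumZ; last first.
  exact: (summable_tsum (summable_reindex (@joinlK n) sR)).
apply: eq_tsum => y0; rewrite /X (tsumZ (Gy y0) (Tm_summable z1 (bb y0) gS al0)) hK' mulrCA.
congr (_ * _); rewrite -(tsumZ (Gy y0) (Ty_summable z1 (bb y0) gQ al0)); apply: eq_tsum => y1.
rewrite Ty_row /Ty /Gy.
have -> : gN al^-1 ((y0%:~R - b0) ^+ 2 / a) = gau (al * a%:C)^-1 (y0%:~R - b0%:C).
  rewrite mulrC gN_gau invfM fmorphV; congr gau; by rewrite rmorphB rmorph_int.
have -> : zv y1 - bb y0 = zv y1 - b1 - (y0%:~R - b0) *: w by rewrite /bb opprD addrA.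
by ring.
Qed.

End PoissonN.

(** * One-sided Taylor polynomials and their uniqueness *)

Section Jets.
Variable R : realType.
Local Notation C := R[i].

(** A Taylor expansion stated by its remainder, so that no derivative of an infinite sum is taken.
    The coefficients up to degree [d] are determined by [F], while the higher ones are arbitrary, so
    products need no truncation. *)
Definition jet (d : nat) (F : R -> C) (p : {poly C}) : Prop :=
  exists2 K : R, 0 <= K & forall s : R, 0 <= s -> s <= 1 ->
    nrm (F s - p.[s%:C]) <= K * s ^+ d.+1.

Lemma horner_bound (p : {poly C}) : exists2 K : R, 0 <= K & forall s : R, 0 <= s -> s <= 1 ->
  nrm p.[s%:C] <= K.
Proof.
exists (\sum_(i < size p) nrm p`_i) => [|s s0 s1]; first by apply: sumr_ge0 => i _; exact: nrm_ge0.
rewrite horner_coef; apply: le_trans (nrm_sum _ _ _) _; apply: ler_sum => i _.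
by rewrite nrmM nrmX nrm_real ger0_norm // ler_piMr ?nrm_ge0 // exprn_ile1.
Qed.

Lemma jetD d F G p q : jet d F p -> jet d G q -> jet d (fun s => F s + G s) (p + q).
Proof.
move=> [K K0 hK] [L L0 hL]; exists (K + L) => [|s s0 s1]; first exact: addr_ge0.
rewrite hornerD opprD addrACA mulrDl; apply: le_trans (nrmD _ _) _.
by apply: lerD; [apply: hK|apply: hL].
Qed.

Lemma jetM d F G p q : jet d F p -> jet d G q -> jet d (fun s => F s * G s) (p * q).
Proof.
move=> [K K0 hK] [L L0 hL]; have [Bp Bp0 hp] := horner_bound p; have [Bq Bq0 hq] := horner_bound q.
exists (K * (Bq + L) + Bp * L) => [|s s0 s1]; first by nneg.
rewrite hornerM; set x := p.[_]; set y := q.[_].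
have h1 := hK s s0 s1; have h2 := hL s s0 s1; have h3 := hp s s0 s1; have h4 := hq s s0 s1.
rewrite -/x in h1 h3; rewrite -/y in h2 h4.
have -> : F s * G s - x * y = (F s - x) * G s + x * (G s - y) by ring.
have sd0 : 0 <= s ^+ d.+1 by apply: exprn_ge0.
have sd1 : s ^+ d.+1 <= 1 by apply: exprn_ile1.
have h5 : nrm (G s) <= Bq + L.
  apply: le_trans (nrm_le_add _ y) _; apply: lerD => //; apply: le_trans h2 _.
  by rewrite ler_piMr.
apply: le_trans (nrmD _ _) _; rewrite !nrmM mulrDl; apply: lerD.
  by rewrite mulrAC; apply: ler_pM => //; exact: nrm_ge0.
by rewrite -mulrA; apply: ler_pM => //; exact: nrm_ge0.
Qed.

Lemma jetC d (c : C) : jet d (fun _ => c) c%:P.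
Proof. by exists 0 => // s _ _; rewrite hornerC subrr nrm0 mul0r. Qed.

Lemma jet_sum d (T : Type) (r : seq T) (F : T -> R -> C) (p : T -> {poly C}) :
  (forall t, jet d (F t) (p t)) -> jet d (fun s => \sum_(t <- r) F t s) (\sum_(t <- r) p t).
Proof.
move=> h; elim: r => [|t r IH].
  rewrite big_nil; exists 0 => // s _ _; by rewrite big_nil horner0 subrr nrm0 mul0r.
by have := jetD (h t) IH; rewrite big_cons; congr jet; apply: funext => s; rewrite big_cons.
Qed.

Lemma jet_zero d p : jet d (fun _ => 0) p -> forall i, (i <= d)%N -> p`_i = 0.
Proof.
move=> [K K0 hK]; elim/ltn_ind => i IH id.
apply: (@nrm_small_eq0 _ _ (K + \sum_(j < size p) nrm p`_j)) => e e0.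
pose s := Num.min e 1; have s0 : 0 < s by rewrite lt_min e0 ltr01.
have s1 : s <= 1 by rewrite ge_min lexx orbT.
have se : s <= e by rewrite ge_min lexx.
have [ip|ip] := leqP (size p) i.
  rewrite nth_default // nrm0 mulr_ge0 ?(ltW e0) // addr_ge0 //.
  by apply: sumr_ge0 => j _; exact: nrm_ge0.
have si0 : 0 < s ^+ i by apply: exprn_gt0.
rewrite -(ler_pM2r si0).
have := hK s (ltW s0) s1; rewrite sub0r nrmN horner_coef.
rewrite (bigD1 (Ordinal ip)) //=; set X := \sum_(j < _ | _) _ => hh.
have hX : nrm X <= s ^+ i.+1 * \sum_(j < size p) nrm p`_j.
  apply: le_trans (nrm_sum _ _ _) _; rewrite mulr_sumr [X in _ <= X](bigID (fun j => j != Ordinal ip)) /=.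
  rewrite -[X in X <= _]addr0; apply: lerD; last first.
    by apply: sumr_ge0 => j _; rewrite mulr_ge0 ?nrm_ge0 // exprn_ge0 // ltW.
  apply: ler_sum => j ji; rewrite nrmM nrmX nrm_real (gtr0_norm s0) mulrC.
  have [jl|jl] := ltnP j i.
    by rewrite IH ?nrm0 ?mulr0 // (leq_trans (ltnW jl)).
  rewrite ler_wpM2r ?nrm_ge0 // ler_wiXn2l ?(ltW s0) // ltn_neqAle jl andbT eq_sym.
  by apply: contra ji => /eqP h; apply/eqP; apply: val_inj.
have h3 : nrm (p`_i * s%:C ^+ i) <= K * s ^+ d.+1 + s ^+ i.+1 * \sum_(j < size p) nrm p`_j.
  have -> : p`_i * s%:C ^+ i = (p`_i * s%:C ^+ i + X) - X by ring.
  by apply: le_trans (nrmD _ _) _; rewrite nrmN; apply: lerD.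
rewrite nrmM nrmX nrm_real (gtr0_norm s0) in h3; apply: le_trans h3 _.
have -> : e * (K + \sum_(j < size p) nrm p`_j) * s ^+ i =
  K * (e * s ^+ i) + (e * s ^+ i) * \sum_(j < size p) nrm p`_j by ring.
have hs : s ^+ i.+1 <= e * s ^+ i by rewrite exprS ler_wpM2r // ltW.
apply: lerD; last by rewrite ler_wpM2r //; apply: sumr_ge0 => j _; exact: nrm_ge0.
rewrite ler_wpM2l //; apply: le_trans hs; rewrite ler_wiXn2l ?(ltW s0) //.
Qed.

Lemma jet_uniq d F p q : jet d F p -> jet d F q -> forall i, (i <= d)%N -> p`_i = q`_i.
Proof.
move=> hp [K K0 hK] i id.
have hq' : jet d (fun s => - F s) (- q).
  by exists K => // s s0 s1; rewrite hornerN -opprD nrmN; apply: hK.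
have := jetD hp hq'; rewrite (_ : (fun s => F s - F s) = (fun _ => 0)).
  by move=> /jet_zero/(_ i id)/eqP; rewrite coefB subr_eq0 => /eqP.
by apply: funext => s; rewrite subrr.
Qed.

Lemma eq_jet d F G p : (forall s, 0 <= s -> s <= 1 -> F s = G s) -> jet d F p -> jet d G p.
Proof. by move=> FG [K K0 hK]; exists K => // s s0 s1; rewrite -FG //; apply: hK. Qed.

Definition texp (d : nat) (u : C) : {poly C} := \poly_(e < d.+1) (u ^+ e / (e`!)%:R).

Lemma horner_texp d u (x : C) : (texp d u).[x] = \sum_(e < d.+1) (x * u) ^+ e / (e`!)%:R.
Proof.
by rewrite horner_poly; apply: eq_bigr => e _; rewrite exprMn; ring.
Qed.

Lemma jet_cexp d u : jet d (fun s => cexp (s%:C * u)) (texp d u).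
Proof.
exists (nrm u ^+ d.+1 * expR (nrm u)) => [|s s0 s1]; first by nneg.
rewrite horner_texp -/(ctail d.+1 (s%:C * u)).
have E1 : 1 <= expR (nrm u) by rewrite -[1]expR0 ler_expR nrm_ge0.
have E2 : expR (Re (s%:C * u)) <= expR (nrm u).
  rewrite ler_expR; apply: le_trans (ler_norm _) _; apply: le_trans (Re_le_nrm _) _.
  by rewrite nrmM nrm_real ger0_norm // ler_piMl ?nrm_ge0.
apply: le_trans (ctail_bound d.+1 E1 E2) _.
rewrite nrmM nrm_real ger0_norm // exprMn.
by rewrite le_eqVlt; apply/orP; left; apply/eqP; ring.
Qed.

Lemma jet_cexp2 d u : jet d (fun s => cexp (s%:C ^+ 2 * u)) (texp d u \Po 'X^2).
Proof.
have [K K0 hK] := jet_cexp d u; exists K => // s s0 s1.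
have := hK (s ^+ 2) (exprn_ge0 2 s0) (exprn_ile1 2 s0 s1).
rewrite horner_comp hornerXn rmorphXn => /le_trans; apply; rewrite ler_wpM2l // -exprM.
by rewrite ler_wiXn2l // mul2n -addnn leq_addr.
Qed.

Lemma coef_texp d u e : (e <= d)%N -> (texp d u)`_e = u ^+ e / (e`!)%:R.
Proof. by move=> ed; rewrite coef_poly ltnS ed. Qed.

Lemma coef_comp_X2 (p : {poly C}) i :
  (p \Po 'X^2)`_i = if odd i then 0 else p`_(i./2).
Proof.
rewrite coef_comp_poly_Xn // dvdn2; case: (odd i) => //=.
by rewrite divn2.
Qed.

(** Termwise expansion: the hypothesis dominates at once the remainder of every exponential on
    [0, 1] and every moment that occurs as a coefficient. *)
Lemma jet_tsum (I : choiceType) d (w u : I -> C) (v : I -> R) K :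
  (forall i, nrm (w i) * (1 + nrm (u i)) ^+ d.+1 * expR (nrm (u i)) <= v i) -> sum_le v K ->
  jet d (fun s => tsum (fun i => w i * cexp (s%:C * u i)))
        (\poly_(e < d.+1) (tsum (fun i => w i * u i ^+ e) / (e`!)%:R)).
Proof.
move=> hv sK.
have E1 i : 1 <= expR (nrm (u i)) by rewrite -[1]expR0 ler_expR nrm_ge0.
have p1 i e : (e <= d.+1)%N -> nrm (w i) * nrm (u i) ^+ e <= v i.
  move=> ed; apply: le_trans (hv i); rewrite -mulrA ler_wpM2l ?nrm_ge0 //.
  apply: (@le_trans _ _ ((1 + nrm (u i)) ^+ d.+1 * 1)); last first.
    by apply: ler_wpM2l => //; apply: exprn_ge0; rewrite addr_ge0 ?nrm_ge0.
  rewrite mulr1; apply: (@le_trans _ _ ((1 + nrm (u i)) ^+ e)).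
    by apply: lerXn2r; rewrite ?nnegrE ?addr_ge0 ?nrm_ge0 // lerDr.
  by apply: ler_weXn2l => //; rewrite lerDl nrm_ge0.
have E2 s i : 0 <= s -> s <= 1 -> expR (Re (s%:C * u i)) <= expR (nrm (u i)).
  move=> s0 s1; rewrite ler_expR; apply: le_trans (ler_norm _) _; apply: le_trans (Re_le_nrm _) _.
  by rewrite nrmM nrm_real ger0_norm // ler_piMl ?nrm_ge0.
have se e : (e <= d.+1)%N -> summable (fun i => w i * u i ^+ e).
  by move=> ed; apply: (summable_dom (u := v) (K := K)) => // i; rewrite nrmM nrmX; apply: p1.
have sc s : 0 <= s -> s <= 1 -> summable (fun i => w i * cexp (s%:C * u i)).
  move=> s0 s1; apply: (summable_dom (u := v) (K := K)) => // i.
  rewrite nrmM nrm_cexp; apply: le_trans (hv i); apply: ler_pM; [nneg|nneg| |exact: E2].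
  by rewrite ler_peMr ?nrm_ge0 // exprn_ege1 // lerDl nrm_ge0.
have K0 : 0 <= K by apply: le_trans (sK fset0); rewrite big_seq_fset0.
exists K => // s s0 s1.
rewrite horner_poly.
have -> : \sum_(e < d.+1) tsum (fun i => w i * u i ^+ e) / (e`!)%:R * s%:C ^+ e =
   tsum (fun i => \sum_(e < d.+1) (s%:C ^+ e / (e`!)%:R * (w i * u i ^+ e))).
  rewrite tsum_sum; last by move=> e; apply: summableZ; apply: se; apply: ltnW; apply: ltn_ord.
  apply: eq_bigr => e _; rewrite tsumZ; first by ring.
  by apply: se; apply: ltnW; apply: ltn_ord.
have sS : summable (fun i => \sum_(e < d.+1) (s%:C ^+ e / (e`!)%:R * (w i * u i ^+ e))).
  by apply: summable_sum => e; apply: summableZ; apply: se; apply: ltnW; apply: ltn_ord.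
rewrite -(tsumB (sc s s0 s1) sS).
have -> : K * s ^+ d.+1 = s ^+ d.+1 * K by ring.
apply: (tsum_dom (u := fun i => s ^+ d.+1 * v i)); last by apply: sum_leZ => //; apply: exprn_ge0.
move=> i.
have -> : w i * cexp (s%:C * u i) - \sum_(e < d.+1) s%:C ^+ e / (e`!)%:R * (w i * u i ^+ e) =
   w i * ctail d.+1 (s%:C * u i).
  rewrite /ctail mulrBr mulr_sumr; congr (_ - _); apply: eq_bigr => e _.
  by rewrite exprMn; ring.
rewrite nrmM; apply: le_trans (ler_wpM2l (nrm_ge0 _) (ctail_bound d.+1 (E1 i) (E2 s i s0 s1))) _.
rewrite nrmM nrm_real ger0_norm // exprMn.
have -> : nrm (w i) * (s ^+ d.+1 * nrm (u i) ^+ d.+1 * expR (nrm (u i))) =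
  s ^+ d.+1 * (nrm (w i) * nrm (u i) ^+ d.+1 * expR (nrm (u i))) by ring.
apply: ler_wpM2l; first exact: exprn_ge0.
apply: le_trans (hv i); apply: ler_wpM2r; first exact: expR_ge0.
apply: ler_wpM2l; first exact: nrm_ge0.
by apply: lerXn2r; rewrite ?nnegrE ?addr_ge0 ?nrm_ge0 // lerDr.
Qed.

End Jets.

(** * Harmonic forms *)

Section Harmonic.
Variables (R : realType) (n : nat).
Local Notation MP := {mpoly R[n]}.
Implicit Types (P Q G H : MP) (m : 'X_{1..n}).

Definition mfac m : nat := (\prod_(i < n) (m i)`!)%N.

Lemma mfacU m i : mfac (m + U_(i))%MM = ((m i).+1 * mfac m)%N.
Proof.
rewrite /mfac (bigD1 i) //= [in RHS](bigD1 i) //= mnmDE mnm1E eqxx addn1 factS mulnA.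
congr (_ * _)%N; apply: eq_bigr => j ji; rewrite mnmDE mnm1E eq_sym (negPf ji) addn0 //.
Qed.

(* The pairing P(d/dX) G at 0, on polynomials of size at most k. *)
Definition pairing (k : nat) P G : R :=
  \sum_(m : 'X_{1..n < k}) P@_m * (mfac m)%:R * G@_m.

Lemma pairing_suml k (I : Type) (r : seq I) (F : I -> MP) G :
  pairing k (\sum_(i <- r) F i) G = \sum_(i <- r) pairing k (F i) G.
Proof.
rewrite /pairing exchange_big; apply: eq_bigr => m _.
by rewrite linear_sum /= !mulr_suml.
Qed.

Lemma pairing_sumr k (I : Type) (r : seq I) P (c : I -> R) (F : I -> MP) :
  pairing k P (\sum_(i <- r) c i *: F i) = \sum_(i <- r) c i * pairing k P (F i).
Proof.
rewrite /pairing; under [RHS]eq_bigr do rewrite mulr_sumr.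
rewrite exchange_big; apply: eq_bigr => m _.
by rewrite linear_sum /= mulr_sumr; apply: eq_bigr => i _; rewrite mcoeffZ; ring.
Qed.

Lemma pairing0l k G : pairing k 0 G = 0.
Proof. by rewrite /pairing big1 // => m _; rewrite mcoeff0 !mul0r. Qed.

Lemma pairingX k P m : (mdeg m < k)%N -> pairing k P 'X_[m] = P@_m * (mfac m)%:R.
Proof.
move=> mk; rewrite /pairing (bigD1 (BMultinom mk)) //= mcoeffX eqxx mulr1 big1 ?addr0 // => j jm.
rewrite mcoeffX (_ : (m == j) = false) ?mulr0 //; apply/eqP => h.
by case/eqP: jm; apply: val_inj.
Qed.

(** Multiplication by a variable is adjoint to differentiation because raising one exponent
    multiplies the factorial of the monomial by the new exponent. *)
Lemma pairing_adj k P G i : (msize G < k)%N ->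
  pairing k P ('X_i * G) = pairing k P^`M(i) G.
Proof.
move=> Gk; rewrite {1}[G]mpolyE mulr_sumr [in RHS](mpolyE G).
under eq_bigr => m _ do rewrite -scalerAr -mpolyXD.
rewrite !pairing_sumr; apply: eq_big_seq => m /msize_mdeg_lt mG.
have mk : (mdeg m < k)%N by apply: ltn_trans Gk.
have mk1 : (mdeg (U_(i) + m)%MM < k)%N.
  by rewrite mdegD mdeg1 add1n (leq_ltn_trans mG).
rewrite !pairingX // mcoeff_deriv addmC mfacU natrM -mulr_natr; ring.
Qed.

Definition lform (x : 'rV[R]_n) : MP := \sum_(i < n) x 0 i *: 'X_i.
Definition r2form : MP := \sum_(i < n) 'X_i * 'X_i.

Lemma homog_X i : ('X_i : MP) \is 1.-homog.
Proof. by rewrite dhomogX; apply/eqP; apply: mdeg1. Qed.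

Lemma homog_lform x : lform x \is 1.-homog.
Proof. by apply: rpred_sum => i _; apply: dhomogZ; apply: homog_X. Qed.

Lemma homog_r2form : r2form \is 2.-homog.
Proof. by apply: rpred_sum => i _; apply: (dhomogM (homog_X i) (homog_X i)). Qed.

Lemma homog_exp P d e : P \is d.-homog -> P ^+ e \is (d * e).-homog.
Proof. exact: dhomogMn. Qed.

Lemma msize_homog P d : P \is d.-homog -> (msize P <= d.+1)%N.
Proof.
move=> /dhomogP hP; rewrite msizeE; apply/bigmax_leqP_seq => m mP _.
by rewrite ltnS (hP m mP).
Qed.

Lemma homog_deriv P d i : P \is d.+1.-homog -> P^`M(i) \is d.-homog.
Proof.
move=> /dhomogP hP; apply/dhomogP => m; rewrite mcoeff_msupp mcoeff_deriv => hm.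
have : (m + U_(i))%MM \in msupp P.
  by rewrite mcoeff_msupp; apply: contra hm => /eqP ->; rewrite mul0rn.
move=> /hP h; have : mdeg (m + U_(i))%MM = d.+1 := h.
by rewrite mdegD mdeg1 addn1 => -[].
Qed.

Lemma euler P d (x : 'I_n -> R) : P \is d.-homog ->
  \sum_(i < n) x i * (P^`M(i)).@[x] = d%:R * P.@[x].
Proof.
move=> /dhomogP hP; rewrite /mderiv.
have e i : x i * (\sum_(m <- msupp P) ((m i)%:R * P@_m) *: 'X_[m - U_(i)]).@[x] =
    \sum_(m <- msupp P) (m i)%:R * (P@_m * \prod_(j < n) x j ^+ m j).
  rewrite raddf_sum mulr_sumr /=; apply: eq_bigr => m _; rewrite mevalZ mevalX.
  have [mi|mi] := posnP (m i); first by rewrite mi !mul0r mulr0.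
  rewrite mulrCA -!mulrA; congr (_ * (_ * _)); rewrite (bigD1 i) //= [in RHS](bigD1 i) //=.
  rewrite mulrA mnmBE mnm1E eqxx -exprS subn1 prednK //; congr (_ * _).
  by apply: eq_bigr => j ji; rewrite mnmBE mnm1E eq_sym (negPf ji) subn0.
under eq_bigr do rewrite e; rewrite exchange_big /= mevalE mulr_sumr; apply: eq_big_seq => m mP.
by rewrite -mulr_suml -natr_sum -mdegE (hP m mP).
Qed.

(** Differentiating the power of a linear form evaluates [P]: adjointness peels off one linear
    factor, and Euler's identity reassembles the partial derivatives. *)
Lemma pairing_lform k d P x : P \is d.-homog -> (d < k)%N ->
  pairing k P (lform x ^+ d) = (d`!)%:R * P.@[fun i => x 0 i].
Proof.
elim: d P => [|d IH] P hP dk.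
  rewrite expr0 fact0 mul1r -mpolyX0 pairingX ?mdeg0 //.
  rewrite /mfac big1 ?mulr1 => [|i _]; last by rewrite mnm0E.
  have PE : P = (P@_0)%:MP.
    apply/mpolyP => m; rewrite mcoeffC; have [<-|m0] := eqVneq 0%MM m; first by rewrite mulr1.
    rewrite mulr0; apply: (dhomog_nemf_coeff hP); rewrite mdeg_eq0 eq_sym //.
  by rewrite {2}PE mevalC.
rewrite exprS {1}/lform mulr_suml.
under eq_bigr do rewrite -scalerAl.
rewrite pairing_sumr.
have hs : (msize (lform x ^+ d) < k)%N.
  have := homog_exp d (homog_lform x); rewrite mul1n => /msize_homog h.
  exact: leq_ltn_trans h dk.
under eq_bigr => i _ do rewrite pairing_adj // (IH _ (homog_deriv i hP) (ltnW dk)) mulrCA.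
rewrite -mulr_sumr (euler (fun i => x 0 i) hP) factS natrM; ring.
Qed.

Lemma pairing_r2 k e P G : G \is e.-homog -> (e.+2 < k)%N -> Defs.harmonic P -> pairing k P (r2form * G) = 0.
Proof.
move=> hG Gk hP; rewrite /r2form mulr_suml.
have := pairing_sumr k (index_enum 'I_n) P (fun _ => 1) (fun i => 'X_i * 'X_i * G).
under eq_bigr do rewrite scale1r; move=> ->.
under eq_bigr => i _.
  rewrite mul1r -mulrA pairing_adj; last first.
    by apply: leq_ltn_trans Gk; have := msize_homog (dhomogM (homog_X i) hG); rewrite add1n.
  rewrite pairing_adj; last first.
    by apply: ltn_trans Gk; rewrite ltnS; apply: msize_homog.
  over.
by rewrite /= -pairing_suml hP pairing0l.
Qed.

Definition vmx (d : nat) : 'M[R]_d.+1 := Vandermonde d.+1 (\row_j (j : nat)%:R).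

Lemma vmx_unit d : vmx d \in unitmx.
Proof.
rewrite unitmxE det_Vandermonde unitfE prodf_seq_neq0; apply/allP => i _ /=.
rewrite prodf_seq_neq0; apply/allP => j _; apply/implyP => ij; rewrite !mxE subr_eq0 eqr_nat.
by rewrite gtn_eqF.
Qed.

(** Weights at the nodes 0, ..., d that extract the coefficient of degree [a] from a polynomial of
    degree at most [d]. *)
Definition lam1 (d a : nat) (i : 'I_d.+1) : R := invmx (vmx d) i (inord a).

Lemma lam1P d (a b : nat) : (a <= d)%N -> (b <= d)%N ->
  \sum_(i < d.+1) @lam1 d a i * (i : nat)%:R ^+ b = (a == b)%:R.
Proof.
move=> ad bd; have := congr1 (fun M : 'M_d.+1 => M (inord b) (inord a)) (mulmxV (vmx_unit d)).
rewrite !mxE -val_eqE /= !inordK ?ltnS // eq_sym => <-; apply: eq_bigr => i _.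
by rewrite !mxE inordK ?ltnS // mulrC.
Qed.

Definition gpt d (g : {ffun 'I_n -> 'I_d.+1}) : 'rV[R]_n := \row_i (g i : nat)%:R.

(** Tensor product of the one-variable extraction rules. *)
Lemma grid_coef d m G : (mdeg m <= d)%N -> (msize G <= d.+1)%N ->
  \sum_(g : {ffun 'I_n -> 'I_d.+1}) (\prod_(i < n) lam1 (m i) (g i)) * G.@[fun i => gpt g 0 i] = G@_m.
Proof.
have le_deg (b : 'X_{1..n}) i : (mdeg b <= d)%N -> (b i <= d)%N.
  by move=> bd; apply: leq_trans bd; rewrite mdegE (bigD1 i) //= leq_addr.
move=> md Gd; rewrite [in LHS](mpolywE Gd) [in RHS](mpolywE Gd).
under eq_bigr => g _ do rewrite raddf_sum mulr_sumr /=.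
rewrite exchange_big /= raddf_sum; apply: eq_bigr => b _ /=; rewrite mcoeffZ mcoeffX.
under eq_bigr => g _ do rewrite mevalZ mevalX mulrCA -big_split /=.
rewrite -mulr_sumr; congr (_ * _).
have bd : (mdeg b <= d)%N by have := valP b; rewrite ltnS.
under eq_bigr => g _ do under eq_bigr => i _ do rewrite mxE.
rewrite -(bigA_distr_bigA (fun i (k : 'I_d.+1) => lam1 (m i) k * (k : nat)%:R ^+ b i)).
under eq_bigr => i _ do rewrite lam1P ?le_deg //.
have [<-|bm] := eqVneq (b : 'X_{1..n}) m; first by rewrite big1 // => i _; rewrite eqxx.
have [i hi] : exists i, m i != b i.
  apply/existsP; apply: contraNT bm; rewrite negb_exists => /forallP h.
  by apply/eqP/mnmP => i; have := h i; rewrite negbK => /eqP.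
by rewrite (bigD1 i) //= (negPf hi) mul0r.
Qed.

Lemma dp_lform x (v : 'rV[R]_n) : (lform x).@[fun i => v 0 i] = dp x v.
Proof.
rewrite raddf_sum /dp mxE /=; apply: eq_bigr => i _.
by rewrite mevalZ mevalXU mxE.
Qed.

Lemma dp_r2form (v : 'rV[R]_n) : r2form.@[fun i => v 0 i] = dp v v.
Proof.
rewrite raddf_sum /dp mxE /=; apply: eq_bigr => i _.
by rewrite mevalM mevalXU mxE.
Qed.

(* The second clause is apolarity to the multiples of the squared norm. *)
Lemma harmonic_repr d P : P \is d.-homog -> Defs.harmonic P ->
  exists (T : finType) (lam : T -> R) (zt : T -> 'rV[R]_n),
  (forall x, \sum_t lam t * dp x (zt t) ^+ d = (d`!)%:R * P.@[fun i => x 0 i]) /\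
  (forall x j, (0 < j)%N -> (j.*2 <= d)%N ->
    \sum_t lam t * (dp (zt t) (zt t) ^+ j * dp x (zt t) ^+ (d - j.*2)) = 0).
Proof.
move=> hP harmP; exists {ffun 'I_n -> 'I_d.+1}.
exists (fun g : {ffun 'I_n -> 'I_d.+1} => \sum_(m : 'X_{1..n < d.+1}) P@_m * (mfac m)%:R * \prod_(i < n) lam1 (m i) (g i)), (@gpt d).
(* The weights combine the pairing with the extraction of coefficients from values on a grid.
   Pairing with [P] thus becomes a finite combination of evaluations, and a power of [lform x]
   evaluated at a node is a power of the linear form of that node at [x]. *)
have key G : (msize G <= d.+1)%N ->
  \sum_(g : {ffun 'I_n -> 'I_d.+1}) (\sum_(m : 'X_{1..n < d.+1}) P@_m * (mfac m)%:R * \prod_(i < n) lam1 (m i) (g i))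
    * G.@[fun i => gpt g 0 i] = pairing d.+1 P G.
  move=> Gd; under eq_bigr => g _ do rewrite mulr_suml.
  rewrite exchange_big /=; apply: eq_bigr => m _.
  under eq_bigr => g _ do rewrite -mulrA.
  rewrite -mulr_sumr grid_coef //; by have := valP m; rewrite ltnS.
split=> [x|x j j0 jd].
  rewrite -(pairing_lform _ hP (ltnSn d)) -key; last first.
    by apply: msize_homog; have := homog_exp d (homog_lform x); rewrite mul1n.
  by apply: eq_bigr => g _; rewrite rmorphXn /= dp_lform.
pose H := r2form ^+ j.-1 * lform x ^+ (d - j.*2).
have hH : H \is (2 * j.-1 + (d - j.*2)).-homog.
  apply: dhomogM; first exact: homog_exp homog_r2form.
  by have := homog_exp (d - j.*2) (homog_lform x); rewrite mul1n.
have sH : ((2 * j.-1 + (d - j.*2)).+2 < d.+1)%N.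
  move: j0 jd; rewrite -!addnn; case: (j) => //= j'; lia.
have hG : (r2form ^+ j * lform x ^+ (d - j.*2)) = r2form * H.
  by rewrite /H mulrA -exprS prednK.
rewrite -[RHS](pairing_r2 hH sH harmP) -key; last first.
  have := msize_homog (dhomogM homog_r2form hH); move: j0 jd; rewrite -!addnn; case: (j) => //= j'; lia.
by apply: eq_bigr => g _; rewrite -hG mevalM !rmorphXn /= dp_lform dp_r2form.
Qed.

End Harmonic.

(** * Theta series with harmonic coefficients *)

Section Theta.
Variables (R : realType) (n : nat) (B : 'M[R]_n) (Az Wz : 'M[int]_n).
Local Notation C := R[i].
Local Notation P := ((pi : R)%:C : C).
Hypotheses (uB : B \in unitmx) (AzE : map_mx (fun k : int => k%:~R) Az = B *m B^T)
  (AWz : Az *m Wz = 1%:M) (WAz : Wz *m Az = 1%:M).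

Definition lpt (m : 'rV[int]_n) : 'rV[R]_n := zv R m *m B.
Definition lnq (m : 'rV[int]_n) : R := dp (lpt m) (lpt m).

Lemma dp_ge0 (u : 'rV[R]_n) : 0 <= dp u u.
Proof. by rewrite /dp mxE sumr_ge0 // => i _; rewrite mxE -expr2 sqr_ge0. Qed.

Lemma dp_gt0 (u : 'rV[R]_n) : u != 0 -> 0 < dp u u.
Proof.
move=> u0; rewrite lt_neqAle dp_ge0 andbT eq_sym; apply: contra u0 => /eqP.
rewrite /dp mxE => /eqP; rewrite psumr_eq0; last by move=> i _; rewrite mxE -expr2 sqr_ge0.
move=> /allP h; apply/eqP/rowP => i; have := h i (mem_index_enum i).
by rewrite /= mxE mulf_eq0 orbb => /eqP ->; rewrite mxE.
Qed.

Lemma qf_gram v : qf (B *m B^T) v = dp (v *m B) (v *m B).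
Proof. by rewrite /qf /dp trmx_mul !mulmxA. Qed.

Lemma posdef_gram : posdef (B *m B^T).
Proof.
split=> [|v v0]; first by rewrite trmx_mul trmxK.
rewrite qf_gram dp_gt0 //; apply: contra v0 => /eqP h.
by apply/eqP; rewrite -(mulmxK uB v) h mul0mx.
Qed.

Lemma lnq_sum (t : R) : 0 < t -> exists K, sum_le (fun m => expR (- (t * lnq m))) K.
Proof.
move=> t0; have [gs _] := poissonN posdef_gram; have [K hK] := gs t t0; exists K.
by have := hK 0; apply: eq_sum_le => m; rewrite addr0 qf_gram.
Qed.

Lemma chiR0 : chiR (0 : R) = 1.
Proof. by rewrite /chiR mulr0 cexp0. Qed.

(** Since the Gram matrix and its inverse are integral, [m *m Az] runs through all integer vectors,
    and there the dual form becomes the norm form again: the dual lattice is the lattice itself. *)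
Lemma poissonL : exists kap : R, forall al, 0 < Re al -> exists2 K : C, K ^+ 2 = kap%:C * al ^- n &
  forall zt : 'rV[R]_n, tsum (fun m => gN al (dp (lpt m + zt) (lpt m + zt))) =
    K * tsum (fun m => gN al^-1 (lnq m) * chiR (dp (lpt m) zt)).
Proof.
have [gs [Q [kap [gQ QA kap0 hP]]]] := poissonN posdef_gram.
exists kap => al al0; have [K K2 hK] := hP al al0; exists K => // zt.
pose z := zt *m invmx B; have zB : z *m B = zt by rewrite /z mulmxKV.
clearbody z.
have := hK z 0.
have -> : tsum (Tm (B *m B^T) al z 0) = tsum (fun m => gN al (dp (lpt m + zt) (lpt m + zt))).
  apply: eq_tsum => m; rewrite /Tm qf_gram mulmxDl zB -/(lpt m).
  have -> : dp 0 (zv R m + z) = 0 by rewrite /dp mul0mx mxE.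
  by rewrite chiR0 mulr1.
move=> ->; congr (_ * _).
have sT := Ty_summable z 0 gQ al0.
have pq : cancel (fun m : 'rV[int]_n => m *m Az) (fun m => m *m Wz) by move=> m /=; rewrite -mulmxA AWz mulmx1.
have qp : cancel (fun m : 'rV[int]_n => m *m Wz) (fun m => m *m Az) by move=> m /=; rewrite -mulmxA WAz mulmx1.
rewrite -(tsum_reindex pq qp sT); apply: eq_tsum => m; rewrite /comp /Ty subr0.
have -> : zv R (m *m Az) = zv R m *m (B *m B^T) by rewrite /zv map_mxM AzE.
rewrite QA qf_gram -/(lpt m); congr (_ * chiR _).
by rewrite /dp -zB trmx_mul /lpt !mulmxA.
Qed.

Lemma gN_summable al : 0 < Re al -> summable (fun m => gN al (lnq m)).
Proof.
move=> al0; have [K hK] := lnq_sum (mulr_gt0 (pi_gt0 R) al0); exists K => A.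
by apply: le_trans (hK A); apply: ler_sum => m _; rewrite nrm_gN.
Qed.

Lemma lnq_ge0 m : 0 <= lnq m. Proof. exact: dp_ge0. Qed.

(** The covolume is not computed: at [al = 1] without shift both sides are one and the same positive
    series, so [K = 1] there and hence [kap = 1]. *)
Lemma poissonL_unit al : 0 < Re al -> exists K : C, [/\ K ^+ 2 = al ^- n, al = 1 -> K = 1 &
  forall zt : 'rV[R]_n, tsum (fun m => gN al (dp (lpt m + zt) (lpt m + zt))) =
    K * tsum (fun m => gN al^-1 (lnq m) * chiR (dp (lpt m) zt))].
Proof.
have [kap hk] := poissonL.
have R1 : 0 < Re (1 : C) by rewrite ltr01.
pose S := tsum (fun m => gN 1 (lnq m)).
have gE m : gN 1 (lnq m) = (expR (- (pi * lnq m)))%:C.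
  by rewrite /gN -cexp_real rmorphN rmorphM; congr cexp; ring.
have S0 : S != 0.
  have sS := gN_summable R1; have := sS; rewrite (funext gE) => sS'.
  have := tsum_ge 0 (fun m => expR_ge0 (- (pi * lnq m))) sS'.
  rewrite (_ : tsum _ = S); last by apply: eq_tsum => m; rewrite gE.
  by apply: contraTneq => ->; rewrite -ltNge expR_gt0.
have KS (K : C) : (forall zt : 'rV[R]_n, tsum (fun m => gN 1 (dp (lpt m + zt) (lpt m + zt))) =
    K * tsum (fun m => gN 1^-1 (lnq m) * chiR (dp (lpt m) zt))) -> K = 1.
  move=> /(_ 0) h; apply: (mulIf S0); rewrite mul1r.
  have e1 : tsum (fun m => gN 1 (dp (lpt m + 0) (lpt m + 0))) = S.
    by apply: eq_tsum => m; rewrite addr0.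
  have e2 : tsum (fun m => gN 1^-1 (lnq m) * chiR (dp (lpt m) 0)) = S.
    by apply: eq_tsum => m; rewrite invr1 /dp trmx0 mulmx0 mxE chiR0 mulr1.
  by rewrite e1 e2 in h.
have kap1 : (kap%:C : C) = 1.
  have [K K2 hK] := hk 1 R1; have K1 := KS K hK.
  by move: K2; rewrite K1 !expr1n invr1 mulr1 => <-.
move=> al0; have [K K2 hK] := hk al al0; exists K; split => //.
  by rewrite K2 kap1 mul1r.
by move=> al1; rewrite al1 in hK; apply: KS.
Qed.

Lemma dp_bound (eps : R) (u v : 'rV[R]_n) : 0 < eps ->
  `|dp u v| <= eps * dp u u + dp v v / (4 * eps).
Proof.
move=> e0; have e4 : 4 * eps != 0 by rewrite mulf_neq0 // gt_eqF.
have key (c : R) : 0 <= eps * dp u u + 2 * eps * c * dp u v + eps * c ^+ 2 * dp v v.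
  have := mulr_ge0 (ltW e0) (dp_ge0 (u + c *: v)).
  rewrite !dpDl !dpDr !dpZl !(dpC _ (c *: v)) !dpZl (dpC v u); congr (0 <= _); ring.
have h1 := key (1 / (2 * eps)); have h2 := key (- (1 / (2 * eps))).
have n0 : eps != 0 by rewrite gt_eqF.
have E1 : 2 * eps * (1 / (2 * eps)) = 1 by field.
have E2 : eps * (1 / (2 * eps)) ^+ 2 = 1 / (4 * eps) by field.
rewrite E1 mul1r E2 in h1; rewrite mulrN E1 mulN1r sqrrN E2 in h2.
rewrite ler_norml; apply/andP; split.
  by rewrite lerNl -subr_ge0; move: h1; congr (0 <= _); ring.
by rewrite -subr_ge0; move: h2; congr (0 <= _); ring.
Qed.

(** The power and the exponential together are at most exp((d + 2) y), and [dp_bound], with [eps]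
    chosen accordingly, pays for this with half of the Gaussian decay and a constant. *)
Lemma theta_dom al (c : C) (zt : 'rV[R]_n) (d : nat) : 0 < Re al ->
  exists v K, sum_le v K /\ forall m,
  nrm (gN al (lnq m)) * (1 + nrm (c * (dp (lpt m) zt)%:C)) ^+ d.+1 *
    expR (nrm (c * (dp (lpt m) zt)%:C)) <= v m.
Proof.
move=> al0; pose a := pi * Re al; have a0 : 0 < a by rewrite mulr_gt0 ?pi_gt0.
pose D := d.+2%:R * nrm c + 1; have D0 : 0 < D by rewrite ltr_wpDl ?mulr_ge0 ?nrm_ge0.
pose eps := a / 2 / D; have e0 : 0 < eps by rewrite !divr_gt0.
pose K0 := D * (dp zt zt / (4 * eps)).
have [K hK] := lnq_sum (divr_gt0 a0 (@ltr0n R 2)).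
exists (fun m => expR K0 * expR (- (a / 2 * lnq m))), (expR K0 * K); split.
  by apply: sum_leZ => //; apply: expR_ge0.
move=> m; set y := nrm (c * _); have y0 : 0 <= y by apply: nrm_ge0.
have yE : y = nrm c * `|dp (lpt m) zt| by rewrite /y nrmM nrm_real.
have h1 : (1 + y) ^+ d.+1 <= expR (d.+1%:R * y).
  by rewrite expRM_natl; apply: lerXn2r; rewrite ?nnegrE ?expR_ge0 ?addr_ge0 ?expR_ge1Dx.
rewrite nrm_gN -/a.
apply: (@le_trans _ _ (expR (- (a * lnq m)) * expR (d.+1%:R * y) * expR y)).
  by apply: ler_wpM2r; [exact: expR_ge0|]; apply: ler_wpM2l => //; exact: expR_ge0.
rewrite -!expRD ler_expR.
have h2 : d.+1%:R * y + y <= D * `|dp (lpt m) zt|.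
  have -> : d.+1%:R * y + y = d.+2%:R * nrm c * `|dp (lpt m) zt|.
    by rewrite yE -(natr1 d.+1); ring.
  by rewrite ler_wpM2r // lerDl.
have h3 := ler_wpM2l (ltW D0) (dp_bound (lpt m) zt e0).
have h4 : D * (eps * dp (lpt m) (lpt m) + dp zt zt / (4 * eps)) = a / 2 * lnq m + K0.
  by rewrite /K0 /lnq mulrDr mulrA (_ : D * eps = a / 2) // /eps mulrC mulfVK // gt_eqF.
rewrite h4 in h3; lra.
Qed.

Lemma cexp_split al (s : R) (x zt : 'rV[R]_n) :
  gN al (dp (x + s *: zt) (x + s *: zt)) =
  cexp (- (s%:C ^+ 2 * (P * al * (dp zt zt)%:C))) *
  (gN al (dp x x) * cexp (s%:C * (- (2 * P * al) * (dp x zt)%:C))).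
Proof.
have -> : dp (x + s *: zt) (x + s *: zt) = dp x x + 2 * s * dp x zt + s ^+ 2 * dp zt zt.
  by rewrite !dpDl !dpDr !dpZl !(dpC _ (s *: zt)) !dpZl (dpC zt x); ring.
rewrite /gN -!cexpD; congr cexp; rewrite !rmorphD !rmorphM rmorph_nat /=; ring.
Qed.

Variables (T : finType) (lam : T -> R) (zt : T -> 'rV[R]_n) (d : nat).
Hypothesis harm : forall x j, (0 < j)%N -> (j.*2 <= d)%N ->
    \sum_t lam t * (dp (zt t) (zt t) ^+ j * dp x (zt t) ^+ (d - j.*2)) = 0.

Definition pol (x : 'rV[R]_n) : R := \sum_t lam t * dp x (zt t) ^+ d.

Definition theta (al : C) : C := tsum (fun m => (pol (lpt m))%:C * gN al (lnq m)).

Lemma pow_summable al (z : 'rV[R]_n) e : 0 < Re al ->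
  summable (fun m => gN al (lnq m) * (dp (lpt m) z)%:C ^+ e).
Proof.
move=> al0; have [v [K [hK hv]]] := theta_dom 1 z e al0.
apply: summable_dom hK => m; apply: le_trans (hv m); rewrite mul1r nrmM nrmX.
set y := nrm _%:C; have y0 : 0 <= y by apply: nrm_ge0.
rewrite -mulrA; apply: ler_wpM2l; first exact: nrm_ge0.
apply: (@le_trans _ _ ((1 + y) ^+ e.+1 * 1)); last first.
  by apply: ler_wpM2l; [nneg|rewrite -[X in X <= _]expR0 ler_expR].
rewrite mulr1; apply: (@le_trans _ _ ((1 + y) ^+ e)).
  by apply: lerXn2r; rewrite ?nnegrE ?addr_ge0 // lerDr.
by apply: ler_weXn2l => //; rewrite lerDl.
Qed.

Lemma pol_tsum al : 0 < Re al ->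
  theta al = \sum_t (lam t)%:C * tsum (fun m => gN al (lnq m) * (dp (lpt m) (zt t))%:C ^+ d).
Proof.
move=> al0; rewrite /theta.
under [RHS]eq_bigr => t _ do rewrite -(tsumZ _ (pow_summable (zt t) d al0)).
rewrite -tsum_sum; last by move=> t; apply: summableZ; apply: pow_summable.
apply: eq_tsum => m; rewrite /pol rmorph_sum mulr_suml; apply: eq_bigr => t _.
by rewrite rmorphM rmorphXn /=; ring.
Qed.

Lemma theta_summable al : 0 < Re al -> summable (fun m => (pol (lpt m))%:C * gN al (lnq m)).
Proof.
move=> al0.
have := @summable_sum R _ T (index_enum T)
  (fun t m => (lam t)%:C * (gN al (lnq m) * (dp (lpt m) (zt t))%:C ^+ d)).
move=> /(_ (fun t => summableZ _ (pow_summable (zt t) d al0))); apply: eq_summable => m.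
rewrite /pol rmorph_sum mulr_suml; apply: eq_bigr => t _.
by rewrite rmorphM rmorphXn /=; ring.
Qed.

(** Poisson summation is applied to the translates by [s *: zt t], the results are summed with
    weights [lam t], and coefficients of s^d are compared. On the left the top coefficient already
    is the theta series, the square term of the translation having been moved to the right. *)
Lemma theta_S al : 0 < Re al -> exists K : C, [/\ K ^+ 2 = al ^- n, al = 1 -> K = 1 &
  (- al) ^+ d * theta al = K * 'i ^+ d * theta al^-1].
Proof.
move=> al0; have [K [K2 K1 hK]] := poissonL_unit al0; exists K; split => //.
have be0 := Re_inv_gt0 al0.
pose uL t m : C := - (2 * P * al) * (dp (lpt m) (zt t))%:C.
pose uR t m : C := twopii R * (dp (lpt m) (zt t))%:C.
pose vv t : C := P * al * (dp (zt t) (zt t))%:C.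
pose FL t s := tsum (fun m => gN al (lnq m) * cexp (s%:C * uL t m)).
pose FR t s := tsum (fun m => gN al^-1 (lnq m) * cexp (s%:C * uR t m)).
have FE t s : FL t s = K * (cexp (s%:C ^+ 2 * vv t) * FR t s).
  have := hK (s *: zt t).
  have -> : tsum (fun m => gN al (dp (lpt m + s *: zt t) (lpt m + s *: zt t))) =
      cexp (- (s%:C ^+ 2 * vv t)) * FL t s.
    rewrite /FL -tsumZ; first by apply: eq_tsum => m; rewrite cexp_split.
    have [v [K' [hK' hv]]] := theta_dom (- (2 * P * al) * s%:C) (zt t) 0 al0.
    apply: summable_dom hK' => m; apply: le_trans (hv m).
    have -> : s%:C * uL t m = - (2 * P * al) * s%:C * (dp (lpt m) (zt t))%:C by rewrite /uL; ring.
    set y := _ * _%:C; rewrite nrmM nrm_cexp; apply: ler_pM; [nneg|nneg| |].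
      by rewrite ler_peMr ?nrm_ge0 // expr1 lerDl nrm_ge0.
    by rewrite ler_expR; apply: le_trans (ler_norm _) (Re_le_nrm _).
  move=> h.
  have -> : FL t s = cexp (s%:C ^+ 2 * vv t) * (cexp (- (s%:C ^+ 2 * vv t)) * FL t s).
    by rewrite mulrA -cexpD subrr cexp0 mul1r.
  rewrite h mulrCA; congr (_ * (_ * _)); apply: eq_tsum => m; congr (_ * _).
  rewrite /chiR /uR; congr cexp; rewrite dpC dpZl dpC rmorphM; ring.
have jL t : jet d (FL t) (\poly_(e < d.+1) (tsum (fun m => gN al (lnq m) * uL t m ^+ e) / (e`!)%:R)).
  have [v [K' [hK' hv]]] := theta_dom (- (2 * P * al)) (zt t) d al0.
  exact: jet_tsum hv hK'.
have jR t : jet d (FR t) (\poly_(e < d.+1) (tsum (fun m => gN al^-1 (lnq m) * uR t m ^+ e) / (e`!)%:R)).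
  have [v [K' [hK' hv]]] := theta_dom (twopii R) (zt t) d be0.
  exact: jet_tsum hv hK'.
set pL := fun t => \poly_(e < d.+1) (tsum (fun m => gN al (lnq m) * uL t m ^+ e) / (e`!)%:R) in jL.
set pR := fun t => \poly_(e < d.+1) (tsum (fun m => gN al^-1 (lnq m) * uR t m ^+ e) / (e`!)%:R) in jR.
have J1 := jet_sum (index_enum T) (fun t => jetM (jetC d (lam t)%:C) (jL t)).
have J2 := jet_sum (index_enum T) (fun t => jetM (jetC d ((lam t)%:C * K)) (jetM (jet_cexp2 d (vv t)) (jR t))).
have J12 : jet d (fun s => \sum_t (lam t)%:C * FL t s)
    (\sum_t ((lam t)%:C * K)%:P * ((texp d (vv t) \Po 'X^2) * pR t)).
  by apply: eq_jet J2 => s _ _; apply: eq_bigr => t _; rewrite FE; ring.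
have := jet_uniq J1 J12 (leqnn d); rewrite !coef_sum.
have eL : \sum_t ((lam t)%:C%:P * pL t)`_d = (- (2 * P * al)) ^+ d / (d`!)%:R * theta al.
  rewrite (pol_tsum al0) mulr_sumr; apply: eq_bigr => t _.
  rewrite coefCM coef_poly ltnSn.
  have -> : tsum (fun m => gN al (lnq m) * uL t m ^+ d) =
      (- (2 * P * al)) ^+ d * tsum (fun m => gN al (lnq m) * (dp (lpt m) (zt t))%:C ^+ d).
    by rewrite -(tsumZ _ (pow_summable (zt t) d al0)); apply: eq_tsum => m; rewrite /uL exprMn; ring.
  by ring.
have uRE t e : tsum (fun m => gN al^-1 (lnq m) * uR t m ^+ e) =
    twopii R ^+ e * tsum (fun m => gN al^-1 (lnq m) * (dp (lpt m) (zt t))%:C ^+ e).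
  by rewrite -(tsumZ _ (pow_summable (zt t) e be0)); apply: eq_tsum => m; rewrite /uR exprMn; ring.
have eR : \sum_t (((lam t)%:C * K)%:P * ((texp d (vv t) \Po 'X^2) * pR t))`_d =
    K * (twopii R ^+ d / (d`!)%:R) * theta al^-1.
  under eq_bigr => t _ do rewrite coefCM coefM mulr_sumr.
  rewrite exchange_big big_ord_recl /= [X in _ + X]big1 => [|i _].
    rewrite addr0 (pol_tsum be0) mulr_sumr; apply: eq_bigr => t _.
    rewrite coef_comp_X2 /= coef_texp // expr0 fact0 divr1 mul1r subn0 coef_poly ltnSn uRE; ring.
  (* The square term contributes even powers s^(2j) only. For j > 0 the accompanying sum over [t] is
     of the shape that [harm] annihilates, for each lattice point. *)
  pose k := lift ord0 i; have k0 : (0 < k)%N by [].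
  have kd : (k <= d)%N by rewrite -ltnS ltn_ord.
  rewrite -/k; under eq_bigr => t _ do rewrite coef_comp_X2.
  case ko: (odd k); first by rewrite big1 // => t _; rewrite mul0r mulr0.
  have kE : k./2.*2 = k by have := odd_double_half k; rewrite ko add0n.
  have j0 : (0 < k./2)%N by move: k0; rewrite -[X in (0 < X)%N]kE double_gt0.
  have jd : (k./2 <= d)%N by apply: leq_trans kd; rewrite -[X in (_ <= X)%N]kE -addnn leq_addr.
  set j := k./2 in kE j0 jd *.
  rewrite (eq_bigr (fun t => K * ((P * al) ^+ j / (j`!)%:R) * (twopii R ^+ (d - k) / ((d - k)`!)%:R) *
     ((lam t * dp (zt t) (zt t) ^+ j)%:C * tsum (fun m => gN al^-1 (lnq m) * (dp (lpt m) (zt t))%:C ^+ (d - k))))); last first.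
    move=> t _; rewrite coef_texp // coef_poly ltnS leq_subr uRE /vv exprMn rmorphM rmorphXn /=; ring.
  rewrite -mulr_sumr.
  under eq_bigr => t _ do rewrite -(tsumZ _ (pow_summable (zt t) (d - k) be0)).
  rewrite -tsum_sum; last by move=> t; apply: summableZ; apply: pow_summable.
  rewrite (_ : tsum _ = 0) ?mulr0 // -[RHS](tsum0 R 'rV[int]_n); apply: eq_tsum => m.
  rewrite (eq_bigr (fun t => gN al^-1 (lnq m) * (lam t * (dp (zt t) (zt t) ^+ j * dp (lpt m) (zt t) ^+ (d - j.*2)))%:C)).
    by rewrite -mulr_sumr -rmorph_sum harm ?mulr0 // kE.
  by move=> t _; rewrite kE !rmorphM !rmorphXn /=; ring.
rewrite eL eR => h.
have fd : ((d`!)%:R : C) != 0 by rewrite pnatr_eq0 -lt0n fact_gt0.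
have P0 : P != 0 by rewrite (_ : 0 = 0%:C) // (inj_eq (@complexI _)) gt_eqF // pi_gt0.
have q0 : (2 * P) ^+ d / (d`!)%:R != 0.
  by rewrite mulf_neq0 ?invr_eq0 ?expf_neq0 // mulf_neq0 // pnatr_eq0.
apply: (mulfI q0).
have -> : (2 * P) ^+ d / (d`!)%:R * ((- al) ^+ d * theta al) = (- (2 * P * al)) ^+ d / (d`!)%:R * theta al.
  have -> : - (2 * P * al) = 2 * P * - al by ring.
  by rewrite (exprMn _ (2 * P)); ring.
rewrite h; have -> : twopii R = 2 * P * 'i by rewrite /twopii; ring.
by rewrite (exprMn _ (2 * P)); ring.
Qed.

End Theta.

(** * Power series with prescribed zeros *)

Section PowerSeries.
Variable R : realType.
Local Notation C := R[i].
Implicit Types (a b c : nat -> C) (q w : C) (r : R).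

Definition pser a q : C := tsum (fun N : nat => a N * q ^+ N).
Definition psummable a r : Prop := exists K, sum_le (fun N : nat => nrm (a N) * r ^+ N) K.

Lemma pser_summable a r q : psummable a r -> nrm q <= r -> summable (fun N => a N * q ^+ N).
Proof.
move=> [K hK] qr; exists K => A; apply: le_trans (hK A); apply: ler_sum => N _.
rewrite nrmM nrmX ler_wpM2l ?nrm_ge0 //; apply: lerXn2r; rewrite ?nnegrE ?nrm_ge0 //.
exact: le_trans (nrm_ge0 _) qr.
Qed.

Lemma tsum_natS (f : nat -> C) : summable f -> tsum f = f 0%N + tsum (fun N => f N.+1).
Proof.
move=> sf; pose g N := if N == 0%N then f 0%N else 0; pose h N := if N == 0%N then 0 else f N.
have sg : summable g.
  by apply: (@fin_supp_summable _ _ g [fset 0%N]%fset) => N; rewrite inE /g => /negPf ->.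
have sh : summable h.
  case: sf => K hK; exists K => A; apply: le_trans (hK A); apply: ler_sum => N _.
  by rewrite /h; case: ifP => // _; rewrite nrm0 nrm_ge0.
have -> : tsum f = tsum g + tsum h.
  rewrite -(tsumD sg sh); apply: eq_tsum => N; rewrite /g /h.
  by case: eqP => [->|]; rewrite ?addr0 ?add0r.
congr (_ + _).
  rewrite (@fin_supp_tsum _ _ g [fset 0%N]%fset) ?big_seq_fset1 // => N; rewrite inE /g => /negPf ->.
  by [].
have h0 j : j.-1.+1 <> j -> h j = 0 by case: j.
by rewrite -(@tsum_inj _ _ _ succn predn (fun N => erefl) h sh h0).
Qed.

Lemma geom_sum_le (rho : R) : 0 <= rho -> rho < 1 -> sum_le (fun N : nat => rho ^+ N) (1 - rho)^-1.
Proof.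
move=> r0 r1; have p0 : 0 < 1 - rho by rewrite subr_gt0.
apply: sum_le_nat => [N|N]; first exact: exprn_ge0.
rewrite -(ler_pM2l p0) mulfV ?gt_eqF // big_mkord.
have -> : (1 - rho) * \sum_(i < N) rho ^+ i = 1 - rho ^+ N.
  by have := subrX1 rho N; move=> h; rewrite -opprB mulNr -h opprB.
by rewrite lerBlDr lerDl exprn_ge0.
Qed.

Lemma pser_bound a r q (A : R) : 0 < r -> 0 <= A -> (forall N, nrm (a N) * r ^+ N <= A) ->
  nrm q < r -> nrm (pser a q) <= A / (1 - nrm q / r).
Proof.
move=> r0 A0 hA qr; have q0 := nrm_ge0 q.
have rho0 : 0 <= nrm q / r by rewrite divr_ge0 // ltW.
have rho1 : nrm q / r < 1 by rewrite ltr_pdivrMr // mul1r.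
apply: (tsum_dom (u := fun N => A * (nrm q / r) ^+ N)).
  move=> N; rewrite nrmM nrmX.
  have rN : 0 < r ^+ N by apply: exprn_gt0.
  have -> : nrm (a N) * nrm q ^+ N = nrm (a N) * r ^+ N * (nrm q / r) ^+ N.
    by rewrite expr_div_n -mulrA [r ^+ N * _]mulrC mulfVK // gt_eqF.
  by apply: ler_wpM2r => //; apply: exprn_ge0.
by apply: sum_leZ => //; apply: geom_sum_le.
Qed.

(** The average runs over [2 M + 1] points of the circle, so it also picks up the coefficients with
    index congruent to [N]. [M] is chosen so large that all of these lie outside a finite set [F]
    whose complement contributes at most [e]. *)
Lemma cauchy_coef a r (A : R) : 0 < r -> psummable a r ->
  (forall x : R, nrm (pser a (r%:C * cexp ('i * x%:C))) <= A) -> forall N, nrm (a N) * r ^+ N <= A.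
Proof.
move=> r0 ps hA N; apply/ler_addgt0Pl => e e0; have [K hK] := ps.
pose u l := nrm (a l) * r ^+ l.
have u0 l : 0 <= u l by rewrite mulr_ge0 ?nrm_ge0 // exprn_ge0 // ltW.
have [F hF] := sum_le_tail u0 hK e0.
pose M := (N + \max_(l <- F) l)%N; set N' := M.*2.+1.
pose om (j : 'I_N') (l : int) := cexp (- twopii R * (Posz j - Posz M)%:~R * gp (hM R M) l).
have nom j l : nrm (om j l) = 1 by apply: nrm_chi.
have omD j k l : om j (k + l) = om j k * om j l.
  rewrite /om -cexpD; congr cexp.
  have -> : gp (hM R M) (k + l) = gp (hM R M) k + gp (hM R M) l by rewrite /gp intrD mulrDl rmorphD.
  ring.
have omX j (l : nat) : om j (Posz l) = om j 1 ^+ l.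
  elim: l => [|l IH]; first by rewrite /om /gp mul0r mulr0 cexp0 expr0.
  by rewrite exprSr -IH -omD -addn1.
have nq j : nrm (r%:C * om j 1) = r by rewrite nrmM nom mulr1 nrm_real gtr0_norm.
have sm j : summable (fun l : nat => a l * (r%:C * om j 1) ^+ l).
  by apply: (pser_summable ps); rewrite nq.
pose f l : C := a l * r%:C ^+ l.
have sf : summable f.
  by exists K => B; apply: le_trans (hK B); apply: ler_sum => l _; rewrite nrmM nrmX nrm_real gtr0_norm.
have lhs : nrm (\sum_(j < N') om j (- Posz N) * pser a (r%:C * om j 1)) <= N'%:R * A.
  apply: le_trans (nrm_sum _ _ _) _.
  have -> : N'%:R * A = \sum_(j < N') A by rewrite sumr_const card_ord mulr_natl.
  apply: ler_sum => j _; rewrite nrmM nom mul1r.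
  suff -> : om j 1 = cexp ('i * (- (2 * pi * (Posz j - Posz M)%:~R * hM R M))%:C) by exact: hA.
  rewrite /om; congr cexp; move: (Posz j - Posz M) => k; rewrite /twopii /gp mul1r.
  have -> : (- (2 * pi * k%:~R * hM R M))%:C = - (2 * (pi : R)%:C * k%:~R * (hM R M)%:C).
    by rewrite rmorphN !rmorphM /= rmorph_nat rmorph_int.
  ring.
have rhs : \sum_(j < N') om j (- Posz N) * pser a (r%:C * om j 1) =
    N'%:R * tsum (fun l : nat => if (N'%:Z %| Posz l - Posz N)%Z then f l else 0).
  rewrite (eq_bigr (fun j => tsum (fun l : nat => om j (- Posz N) * (a l * (r%:C * om j 1) ^+ l)))); last first.
    by move=> j _; rewrite (tsumZ _ (sm j)).
  rewrite -tsum_sum; last by move=> j; apply: summableZ.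
  rewrite -tsumZ.
    apply: eq_tsum => l.
    rewrite (eq_bigr (fun j => f l * om j (Posz l - Posz N))); last first.
      by move=> j _; rewrite exprMn omD omX /f; ring.
    rewrite -mulr_sumr roots_sum -/N'; case: ifP => _; by rewrite ?mulr0 // mulrC.
  case: sf => K' hK'; exists K' => B; apply: le_trans (hK' B); apply: ler_sum => l _.
  by case: ifP => // _; rewrite nrm0 nrm_ge0.
have N'0 : (0 : R) < N'%:R by rewrite ltr0n.
rewrite rhs nrmM nrm_nat ler_pM2l // in lhs.
pose g l : C := if (l != N) && (N'%:Z %| Posz l - Posz N)%Z then f l else 0.
have sg : summable g.
  case: sf => K' hK'; exists K' => B; apply: le_trans (hK' B); apply: ler_sum => l _.
  by rewrite /g; case: ifP => // _; rewrite nrm0 nrm_ge0.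
pose g0 l : C := if l == N then f N else 0.
have sg0 : summable g0.
  by apply: (@fin_supp_summable _ _ g0 [fset N]%fset) => l; rewrite inE /g0 => /negPf ->.
have tE : tsum (fun l : nat => if (N'%:Z %| Posz l - Posz N)%Z then f l else 0) = f N + tsum g.
  have <- : tsum g0 = f N.
    rewrite (@fin_supp_tsum _ _ g0 [fset N]%fset) ?big_seq_fset1 /g0 ?eqxx // => l.
    by rewrite inE => /negPf ->.
  rewrite -(tsumD sg0 sg); apply: eq_tsum => l; rewrite /g0 /g.
  case: eqP => [->|_] /=; last by rewrite add0r.
  by rewrite subrr dvdz0 addr0.
rewrite tE in lhs.
have gs : nrm (tsum g) <= e.
  apply: tsum_nrm_le => B; rewrite (big_fsetID _ (mem F)) /= big1_seq ?add0r => [|l].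
    apply: le_trans (hF [fset x in B | x \notin F]%fset _); last first.
      by apply/fdisjointP => i iF; rewrite !inE /= iF andbF.
    apply: ler_sum => l _; rewrite /g; case: ifP => _; last by rewrite nrm0.
    by rewrite /f nrmM nrmX nrm_real gtr0_norm.
  rewrite !inE /= => /andP[_ lF]; rewrite /g; case: ifP => [/andP[lN dv]|_]; last by rewrite nrm0.
  have lM : (l <= \max_(i <- F) i)%N by rewrite (big_rem l lF) leq_maxl.
  exfalso; case/dvdzP: dv => k hk.
  have : k != 0 by apply: contra lN => /eqP k0; move: hk; rewrite k0 mul0r; lia.
  have lN' : (l < N')%N by rewrite /N' /M; lia.
  have NN' : (N < N')%N by rewrite /N' /M; lia.
  move: (N') hk lN' NN' => n'; clear; nia.
have -> : nrm (a N) * r ^+ N = nrm (f N) by rewrite /f nrmM nrmX nrm_real gtr0_norm.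
have -> : f N = (f N + tsum g) - tsum g by rewrite addrK.
by apply: le_trans (nrmD _ _) _; rewrite nrmN addrC; apply: lerD.
Qed.

(** The quotient has coefficients c_n = sum over j of b_(n+j+1) w^j. As [nrm w < r] strictly, it
    still converges absolutely on the closed disc of the same radius, so divisions can be
    repeated. *)
Lemma pser_divide b r w : 0 < r -> psummable b r -> nrm w < r -> pser b w = 0 ->
  exists2 c, psummable c r & forall q, nrm q <= r -> pser b q = (q - w) * pser c q.
Proof.
move=> r0 pb wr bw; have [K hK] := pb; have w0 := nrm_ge0 w.
pose rho := nrm w / r; have rho0 : 0 <= rho by rewrite divr_ge0 // ltW.
have rho1 : rho < 1 by rewrite ltr_pdivrMr // mul1r.
have K0 : 0 <= K by apply: le_trans (hK fset0); rewrite big_seq_fset0.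
pose F (n j : nat) : C := b (n + j).+1 * w ^+ j * r%:C ^+ n.
have rn : (r%:C : C) != 0 by rewrite (_ : 0 = 0%:C) // (inj_eq (@complexI _)) gt_eqF.
have shiftK j : sum_le (fun n => nrm (b (n + j).+1) * r ^+ n) (K / r ^+ j.+1).
  move=> A; rewrite ler_pdivlMr ?exprn_gt0 // mulr_suml.
  have pq : cancel (fun n => (n + j.+1)%N) (fun n => (n - j.+1)%N) by move=> n; rewrite addnK.
  apply: le_trans (sum_le_reindex pq hK A); apply: ler_sum => n _ /=.
  by rewrite addnS -mulrA -exprD -addnS.
have sF : summable (fun x : nat * nat => F x.1 x.2).
  have h : sum_le (fun x : nat * nat => nrm (F x.2 x.1)) (K / r * (1 - rho)^-1).
    apply: (@sum_le_prod _ _ _ (fun x : nat * nat => nrm (F x.2 x.1)) (fun j => K / r * rho ^+ j)).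
    - by move=> x; apply: nrm_ge0.
    - move=> j; have := sum_leZ (exprn_ge0 j w0) (shiftK j).
      have -> : nrm w ^+ j * (K / r ^+ j.+1) = K / r * rho ^+ j.
        rewrite /rho expr_div_n exprS; field; by rewrite expf_neq0 gt_eqF.
      apply: eq_sum_le => n /=; rewrite /F !nrmM !nrmX nrm_real gtr0_norm //; ring.
    - by apply: sum_leZ; [rewrite divr_ge0 // ltW|apply: geom_sum_le].
  have pq : cancel (fun x : nat * nat => (x.2, x.1)) (fun x => (x.2, x.1)) by case.
  by exists (K / r * (1 - rho)^-1); have := sum_le_reindex pq h; apply: eq_sum_le => x.
pose c n := tsum (fun j => b (n + j).+1 * w ^+ j).
have sc n : summable (fun j => b (n + j).+1 * w ^+ j).
  have := summableZ (r%:C ^+ n)^-1 (summable_section n sF); apply: eq_summable => j.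
  by rewrite /F /= mulrC mulfK // expf_neq0.
have pc : psummable c r.
  have [K' hK'] := summable_tsum sF; exists K' => A; apply: le_trans (hK' A); apply: ler_sum => n _.
  have -> : tsum (fun j => F n j) = r%:C ^+ n * c n.
    by rewrite /c -(tsumZ _ (sc n)); apply: eq_tsum => j; rewrite /F; ring.
  by rewrite nrmM nrmX nrm_real gtr0_norm // mulrC.
have rec n : b n.+1 = c n - w * c n.+1.
  rewrite {1}/c (tsum_natS (sc n)) addn0 expr0 mulr1 /c -(tsumZ _ (sc n.+1)).
  rewrite (_ : tsum (fun j => b (n + j.+1).+1 * w ^+ j.+1) = tsum (fun j => w * (b (n.+1 + j).+1 * w ^+ j))).
    by rewrite addrK.
  by apply: eq_tsum => j; rewrite addnS addSn exprS; ring.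
have b0 : b 0%N = - (w * c 0%N).
  have := bw; rewrite /pser tsum_natS; last by apply: (pser_summable pb); apply: ltW.
  rewrite expr0 mulr1 => /eqP; rewrite addr_eq0 => /eqP ->; congr (- _).
  by rewrite /c -(tsumZ _ (sc 0%N)); apply: eq_tsum => j; rewrite add0n exprS; ring.
exists c => // q qr.
have sb := pser_summable pb qr; have scq := pser_summable pc qr.
have scS : summable (fun n => c n.+1 * q ^+ n.+1) := summable_reindex (p := succn) (q := predn) (fun n => erefl) scq.
have e1 : pser b q = b 0%N + tsum (fun n => b n.+1 * q ^+ n.+1) by rewrite /pser (tsum_natS sb) expr0 mulr1.
have e2 : pser c q = c 0%N + tsum (fun n => c n.+1 * q ^+ n.+1) by rewrite /pser (tsum_natS scq) expr0 mulr1.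
have e3 : tsum (fun n => b n.+1 * q ^+ n.+1) = q * pser c q - w * tsum (fun n => c n.+1 * q ^+ n.+1).
  rewrite /pser -(tsumZ q scq) -(tsumZ w scS) -(tsumB (summableZ q scq) (summableZ w scS)).
  by apply: eq_tsum => n; rewrite rec exprS; ring.
rewrite e1 e3 b0 mulrBl {3}e2; ring.
Qed.

Lemma div_circle b c r w (A : R) : 0 < r -> nrm w < r ->
  (forall q, nrm q <= r -> pser b q = (q - w) * pser c q) ->
  (forall x : R, nrm (pser b (r%:C * cexp ('i * x%:C))) <= A) ->
  forall x : R, nrm (pser c (r%:C * cexp ('i * x%:C))) <= A / (r - nrm w).
Proof.
move=> r0 wr hc hA x; set q := r%:C * _; have nq : nrm q = r.
  by rewrite nrmM nrm_cexp_im mulr1 nrm_real gtr0_norm.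
rewrite ler_pdivlMr ?subr_gt0 //; apply: le_trans (hA x); rewrite -/q hc ?nq // nrmM mulrC.
apply: ler_wpM2r; first exact: nrm_ge0.
by rewrite lerBlDr -{1}nq addrC; apply: nrm_le_add.
Qed.

(** As in the Schwarz lemma, the zero is divided out, the quotient is estimated from the circle, and
    the small linear factor is restored at [q]. *)
Lemma zero_bound1 b r w q (A : R) : 0 < r -> psummable b r -> nrm w < r -> pser b w = 0 -> 0 <= A ->
  (forall x : R, nrm (pser b (r%:C * cexp ('i * x%:C))) <= A) -> nrm q < r ->
  nrm (pser b q) <= (nrm q + nrm w) * (A / (r - nrm w) / (1 - nrm q / r)).
Proof.
move=> r0 pb wr bw A0 hA qr; have [c pc hc] := pser_divide r0 pb wr bw.
have hC := div_circle r0 wr hc hA.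
have A1 : 0 <= A / (r - nrm w) by rewrite divr_ge0 // subr_ge0 ltW.
have := pser_bound r0 A1 (cauchy_coef r0 pc hC) qr => h.
rewrite hc ?(ltW qr) // nrmM; apply: ler_pM => //; [exact: nrm_ge0|exact: nrm_ge0|].
by apply: le_trans (nrmD _ _) _; rewrite nrmN.
Qed.

Lemma zero_bound2 b r w1 w2 q (A : R) : 0 < r -> psummable b r -> nrm w1 < r -> nrm w2 < r ->
  w1 != w2 -> pser b w1 = 0 -> pser b w2 = 0 -> 0 <= A ->
  (forall x : R, nrm (pser b (r%:C * cexp ('i * x%:C))) <= A) -> nrm q < r ->
  nrm (pser b q) <= (nrm q + nrm w1) * ((nrm q + nrm w2) *
    (A / (r - nrm w1) / (r - nrm w2) / (1 - nrm q / r))).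
Proof.
move=> r0 pb w1r w2r w12 bw1 bw2 A0 hA qr; have [c pc hc] := pser_divide r0 pb w1r bw1.
have hC := div_circle r0 w1r hc hA.
have A1 : 0 <= A / (r - nrm w1) by rewrite divr_ge0 // subr_ge0 ltW.
have cw2 : pser c w2 = 0.
  have := hc w2 (ltW w2r); rewrite bw2 => /esym/eqP; rewrite mulf_eq0 subr_eq0 eq_sym (negPf w12).
  by move=> /eqP.
have := zero_bound1 r0 pc w2r cw2 A1 hC qr => h.
rewrite hc ?(ltW qr) // nrmM; apply: ler_pM => //; [exact: nrm_ge0|exact: nrm_ge0|].
by apply: le_trans (nrmD _ _) _; rewrite nrmN.
Qed.

End PowerSeries.

(** * Vanishing of cusp forms of small weight *)

Section Numerics.
Variable R : realType.
Implicit Types (x y : R).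

Lemma expR_double x (p q : R) : 0 <= p -> p <= expR x -> q <= p ^+ 2 -> q <= expR (x + x).
Proof.
move=> p0 px qp; rewrite expRD -expr2; apply: le_trans qp _.
by apply: lerXn2r; rewrite ?nnegrE // (le_trans p0).
Qed.

(** The point 35/16 is 7/10 of the lower bound 25/8 for [pi], and the value barely exceeds the 26/3
    wanted below. Seven doublings lead there from [1 + x <= expR x] at 35/2048; each fraction is a
    square rounded down. *)
Lemma expR_35_16 : 1954 / 225 <= expR (35 / 16 : R).
Proof.
rewrite (_ : 35 / 16 = 35 / 32 + 35 / 32); last by lra.
apply: (@expR_double _ (722 / 245)); [by lra| |by lra].
rewrite (_ : 35 / 32 = 35 / 64 + 35 / 64); last by lra.
apply: (@expR_double _ (103 / 60)); [by lra| |by lra].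
rewrite (_ : 35 / 64 = 35 / 128 + 35 / 128); last by lra.
apply: (@expR_double _ (359 / 274)); [by lra| |by lra].
rewrite (_ : 35 / 128 = 35 / 256 + 35 / 256); last by lra.
apply: (@expR_double _ (182 / 159)); [by lra| |by lra].
rewrite (_ : 35 / 256 = 35 / 512 + 35 / 512); last by lra.
apply: (@expR_double _ (199 / 186)); [by lra| |by lra].
rewrite (_ : 35 / 512 = 35 / 1024 + 35 / 1024); last by lra.
apply: (@expR_double _ (301 / 291)); [by lra| |by lra].
rewrite (_ : 35 / 1024 = 35 / 2048 + 35 / 2048); last by lra.
apply: (@expR_double _ (2083 / 2048)); [by lra| |by lra].
by apply: le_trans (expR_ge1Dx _); lra.
Qed.

Lemma expR_inv_le x (c : R) : 0 < c -> c <= expR x -> expR (- x) <= c^-1.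
Proof. by move=> c0 cx; rewrite expRN lef_pV2 ?posrE // expR_gt0. Qed.

(** As 7/10 is twice 17/20 - 1/2, this bounds the ratio of the nomes on the lines Re al = 17/20 and
    Re al = 1/2. *)
Lemma expN7pi10_le : expR (- (7 / 10 * pi)) <= 3 / 26 :> R.
Proof.
rewrite (_ : 3 / 26 = (26 / 3)^-1); last by rewrite invf_div.
apply: expR_inv_le; first by lra.
have := pi_gt R; have := expR_35_16 => h p.
apply: le_trans (_ : _ <= expR (35 / 16)) _; first by lra.
by rewrite ler_expR; lra.
Qed.

(** This bounds the nome at [al = 1] relative to the circle of radius exp(- pi). The exponent is
    split as 25/8 = 35/16 + 15/32 + 15/32. *)
Lemma expNpi_le : expR (- pi) <= 2 / 37 :> R.
Proof.
rewrite (_ : 2 / 37 = (37 / 2)^-1); last by rewrite invf_div.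
apply: expR_inv_le; first by lra.
have := pi_gt R; have := expR_35_16 => h p.
have h1 : 47 / 32 <= expR (15 / 32 : R) by apply: le_trans (expR_ge1Dx _); lra.
have h2 := @expR_double _ _ (2157 / 1000) _ h1; have {}h2 := h2 ltac:(lra) ltac:(lra).
apply: le_trans (_ : _ <= expR (35 / 16) * expR (15 / 32 + 15 / 32)) _.
  apply: le_trans (_ : _ <= 1954 / 225 * (2157 / 1000)) _; first by lra.
  by apply: ler_pM => //; lra.
by rewrite -expRD ler_expR; lra.
Qed.

(* [y / y2 <= exp (y / y2 - 1)] with [y2] the point where [y^k exp (- 25/4 m y)] is maximal. *)
Lemma weight_bound (m k : nat) y : (0 < m)%N -> (0 < k)%N -> 17 / 20 <= y ->
  (2 * y) ^+ k * expR (- (2 * pi * (y - 1 / 2))) ^+ m <=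
  (2 * (k%:R / (25 / 4 * m%:R))) ^+ k * (expR (85 / 16 * m%:R - k%:R) * (3 / 26) ^+ m).
Proof.
move=> m0 k0 hy; set y2 := k%:R / _.
have m0' : 0 < m%:R :> R by rewrite ltr0n.
have k0' : 0 < k%:R :> R by rewrite ltr0n.
have y20 : 0 < y2 by rewrite divr_gt0 // mulr_gt0 //; lra.
have h1 : y / y2 <= expR (y / y2 - 1) by apply: le_trans (expR_ge1Dx _); lra.
have y0 : 0 <= y by lra.
have h2 : (2 * y) ^+ k <= (2 * y2) ^+ k * expR (25 / 4 * m%:R * y - k%:R).
  have -> : 25 / 4 * m%:R * y - k%:R = k%:R * (y / y2 - 1).
    rewrite /y2; field; by rewrite !gt_eqF.
  rewrite expRM_natl -exprMn; apply: lerXn2r; rewrite ?nnegrE.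
  - by rewrite mulr_ge0.
  - by apply: mulr_ge0; [apply: mulr_ge0 => //; exact: ltW|exact: expR_ge0].
  rewrite -mulrA ler_wpM2l // -ler_pdivrMl // mulrC; exact: h1.
(* The exponent is split at 17/20: the excess uses [25 / 4 <= 2 * pi], and the constant part is the
   ratio bounded by 3/26. *)
have h3 : expR (- (2 * pi * (y - 1 / 2))) ^+ m <=
    expR (m%:R * (- (25 / 4 * (y - 17 / 20)))) * (3 / 26) ^+ m.
  rewrite expRM_natl -exprMn; apply: lerXn2r; rewrite ?nnegrE ?expR_ge0 //.
    by rewrite mulr_ge0 ?expR_ge0 //; lra.
  apply: le_trans (_ : _ <= expR (- (25 / 4 * (y - 17 / 20))) * expR (- (7 / 10 * pi))) _.
    by rewrite -expRD ler_expR; have := pi_gt R; nra.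
  by rewrite ler_wpM2l ?expR_ge0 // expN7pi10_le.
apply: le_trans (ler_pM _ _ h2 h3) _; [by rewrite exprn_ge0 // mulr_ge0|by rewrite exprn_ge0 // expR_ge0|].
rewrite le_eqVlt; apply/orP; left; apply/eqP.
have -> : 85 / 16 * m%:R - k%:R = 25 / 4 * m%:R * y - k%:R + m%:R * - (25 / 4 * (y - 17 / 20)) by lra.
rewrite [in RHS]expRD; ring.
Qed.

Lemma weight_le (m k k' : nat) y : (k <= k')%N -> 17 / 20 <= y ->
  (2 * y) ^+ k * expR (- (2 * pi * (y - 1 / 2))) ^+ m <=
  (2 * y) ^+ k' * expR (- (2 * pi * (y - 1 / 2))) ^+ m.
Proof.
move=> kk hy; apply: ler_wpM2r; first by rewrite exprn_ge0 // expR_ge0.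
by apply: ler_weXn2l => //; lra.
Qed.

(** With exponent [5 * m] the maximum in [weight_bound] is attained at a point independent of [m],
    so the bound is an m-th power. *)
Lemma weight_single (m : nat) y : (0 < m)%N -> 17 / 20 <= y ->
  (2 * y) ^+ (5 * m) * expR (- (2 * pi * (y - 1 / 2))) ^+ m <= (176 / 100) ^+ m.
Proof.
move=> m0 hy; apply: le_trans (weight_bound m0 _ hy) _; first by rewrite muln_gt0.
have m0' : m%:R != 0 :> R by rewrite pnatr_eq0 -lt0n.
have -> : 2 * ((5 * m)%:R / (25 / 4 * m%:R)) = 8 / 5 :> R by rewrite natrM; field.
have -> : 85 / 16 * m%:R - (5 * m)%:R = m%:R * (5 / 16) :> R by rewrite natrM; lra.
rewrite exprM expRM_natl -!exprMn; apply: lerXn2r; rewrite ?nnegrE.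
- by rewrite !mulr_ge0 ?expR_ge0 ?exprn_ge0 //; lra.
- by lra.
have h : expR (5 / 16 : R) <= 16 / 11.
  rewrite -[5 / 16]opprK (_ : 16 / 11 = (11 / 16)^-1); last by rewrite invf_div.
apply: expR_inv_le; first by lra.
  by apply: le_trans (expR_ge1Dx _); lra.
apply: le_trans (_ : _ <= (8 / 5) ^+ 5 * (16 / 11 * (3 / 26))) _; last by lra.
apply: ler_wpM2l; first by rewrite exprn_ge0 //; lra.
by apply: ler_wpM2r => //; lra.
Qed.

Lemma weight_7_1 y : 17 / 20 <= y ->
  (2 * y) ^+ 7 * expR (- (2 * pi * (y - 1 / 2))) ^+ 1 <= 10.
Proof.
move=> hy; apply: le_trans (weight_bound (m := 1) (k := 7) _ _ hy) _ => //.
have -> : 2 * (7%:R / (25 / 4 * 1%:R)) = 56 / 25 :> R by lra.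
have -> : 85 / 16 * 1%:R - 7%:R = - (27 / 16) :> R by lra.
have h : expR (- (27 / 16) : R) <= (4)^-1.
  apply: expR_inv_le; first by lra.
  have h1 : 91 / 64 <= expR (27 / 64 : R) by apply: le_trans (expR_ge1Dx _); lra.
  have h2 := @expR_double _ _ (202 / 100) _ h1; have {}h2 := h2 ltac:(lra) ltac:(lra).
  have h3 := @expR_double _ _ 4 _ h2; have {}h3 := h3 ltac:(lra) ltac:(lra).
  by move: h3; congr (_ <= expR _); lra.
apply: le_trans (_ : _ <= (56 / 25) ^+ 7 * (4^-1 * (3 / 26) ^+ 1)) _; last by rewrite expr1; lra.
by rewrite ler_wpM2l ?ler_wpM2r //; [lra|rewrite exprn_ge0 //; lra].
Qed.

(** Weight 26 with vanishing order 2, for degree 14 on the Leech lattice. Against the gain from the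
    two zeros, 17.6 leaves a factor of about 0.93. *)
Lemma weight_13_2 y : 17 / 20 <= y ->
  (2 * y) ^+ 13 * expR (- (2 * pi * (y - 1 / 2))) ^+ 2 <= 176 / 10.
Proof.
move=> hy; apply: le_trans (weight_bound (m := 2) (k := 13) _ _ hy) _ => //.
have -> : 2 * (13%:R / (25 / 4 * 2%:R)) = 52 / 25 :> R by lra.
have -> : 85 / 16 * 2%:R - 13%:R = - (35 / 16 + (3 / 32 + 3 / 32)) :> R by lra.
have h : expR (- (35 / 16 + (3 / 32 + 3 / 32)) : R) <= (1036 / 100)^-1.
  apply: expR_inv_le; first by lra.
  have h1 : 35 / 32 <= expR (3 / 32 : R) by apply: le_trans (expR_ge1Dx _); lra.
  have h2 := @expR_double _ _ (1196 / 1000) _ h1; have {}h2 := h2 ltac:(lra) ltac:(lra).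
  rewrite expRD; apply: le_trans (_ : _ <= 1954 / 225 * (1196 / 1000)) _; first by lra.
  by apply: ler_pM => //; [lra|lra|exact: expR_35_16].
apply: le_trans (_ : _ <= (52 / 25) ^+ 13 * ((1036 / 100)^-1 * (3 / 26) ^+ 2)) _; last first.
  have e3 : (52 / 25) ^+ 3 <= 9 :> R by lra.
  have e12 : (52 / 25) ^+ 12 <= 6561 :> R.
    have -> : (52 / 25) ^+ 12 = ((52 / 25) ^+ 3) ^+ 4 :> R by rewrite -exprM.
    apply: le_trans (_ : _ <= 9 ^+ 4) _; last by lra.
    by apply: lerXn2r; rewrite ?nnegrE //; lra.
  have e13 : (52 / 25) ^+ 13 <= 6561 * (52 / 25) :> R by rewrite exprSr ler_wpM2r //; lra.
  apply: le_trans (_ : _ <= 6561 * (52 / 25) * ((1036 / 100)^-1 * (3 / 26) ^+ 2)) _; last by lra.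
  by rewrite ler_wpM2r //; lra.
by rewrite ler_wpM2l ?ler_wpM2r //; [lra|rewrite exprn_ge0 //; lra].
Qed.

End Numerics.

Lemma sqr_sum_le (R : realType) (x y : R) : 0 < x -> x < 17 / 20 -> - (1 / 2) <= y -> y <= 1 / 2 ->
  x ^+ 2 + y ^+ 2 <= 389 / 400.
Proof. by move=> *; nra. Qed.

Lemma growth_bound (R : realType) (x n : R) : 0 < x -> 389 < n * (x * 11) -> 17 / 20 <= x * (1 + n * (11 / 389)).
Proof. by move=> *; nra. Qed.

(** * The contraction argument for the modular invariant *)

Section Vanishing.
Variable R : realType.
Local Notation C := R[i].
Local Notation P := ((pi : R)%:C : C).

(* With al = - 'i * tau, [ee al] is the nome q = exp (2 pi i tau), and the points
   [1] and [rho6] are the elliptic points tau = i and tau = exp (2 pi i / 3). *)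
Definition ee (al : C) : C := gN al 2.
Definition rho6 : C := (Num.sqrt 3 / 2) +i* (1 / 2).

Lemma nrm_ee al : nrm (ee al) = expR (- (2 * pi * Re al)).
Proof. by rewrite nrm_gN; congr expR; ring. Qed.

Lemma ee_neq0 al : ee al != 0.
Proof. exact: cexp_neq0. Qed.

Lemma ee_transl al (k : int) : ee (al - 'i * k%:~R) = ee al.
Proof.
rewrite /ee /gN; transitivity (cexp (- P * al * (2 : R)%:C) * cexp (twopii R * k%:~R)); last first.
  by rewrite cexp_2pii_int mulr1.
rewrite -cexpD; congr cexp.
rewrite (_ : (2 : R)%:C = 2) ?rmorph_nat // /twopii; ring.
Qed.

Lemma gN_even al (N : nat) : gN al (2 * N%:R) = ee al ^+ N.
Proof.
elim: N => [|N IH]; first by rewrite mulr0 /gN rmorph0 mulr0 cexp0.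
by rewrite exprSr -IH -gND; congr gN; rewrite -natr1; ring.
Qed.

(** The circle on which Cauchy's estimates are taken is the image of the line Re al = 1/2, so the
    supremum of [Phi] controls the series there. *)
Lemma circle_ee (x : R) : (expR (- pi))%:C * cexp ('i * x%:C) =
  ee ((1 / 2) +i* (- (x / (2 * pi)))).
Proof.
rewrite -cexp_real -cexpD /ee /gN; congr cexp.
have p1 : (pi : R) != 0 by rewrite gt_eqF // pi_gt0.
set t := x / _; have -> : x = 2 * pi * t by rewrite /t mulrC divfK // mulf_neq0 ?pnatr_eq0.
have -> : (1 / 2) +i* (- t) = 1 / 2 - 'i * t%:C :> C.
  rewrite (_ : 1 / 2 = (1 / 2 : R)%:C); last by rewrite rmorphM fmorphV rmorph1 rmorph_nat.
  by simpc.
have e : (1 / 2) * 2 = 1 :> C by rewrite divfK // pnatr_eq0.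
move: (1 / 2 : C) e => h e; have two : (2 : R)%:C = 2 by rewrite rmorph_nat.
have -> : (2 * pi * t)%:C = 2 * P * t%:C by rewrite !rmorphM /= two.
have -> : (- pi : R)%:C = - P by rewrite rmorphN.
have -> : - P * (h - 'i * t%:C) * (2 : R)%:C = - P * (h * 2 - 'i * t%:C * 2) by rewrite two; ring.
by rewrite e; ring.
Qed.

Lemma Re_inv (al : C) : Re al^-1 = Re al / nrm al ^+ 2.
Proof. by rewrite nrm_sqr; case: al. Qed.

Lemma sqrt3_bounds : 17 / 10 <= Num.sqrt (3 : R) < 2.
Proof.
have h : Num.sqrt 3 ^+ 2 = 3 :> R by rewrite sqr_sqrtr.
have h0 : 0 <= Num.sqrt 3 :> R by apply: sqrtr_ge0.
by apply/andP; split; nra.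
Qed.

Lemma Re_rho6 : Re rho6 = Num.sqrt 3 / 2. Proof. by []. Qed.

Variables (a : nat -> C) (m0 kap : nat).
Hypothesis m0_gt0 : (0 < m0)%N.
Hypothesis a_sum : forall r : R, 0 < r -> r < 1 -> psummable a r.
Hypothesis a_small : forall N, (N < m0)%N -> a N = 0.
Local Notation f al := (pser a (ee al)).
Hypothesis f_S : forall al : C, 0 < Re al -> nrm (f al^-1) = nrm al ^+ kap.*2 * nrm (f al).

(* The modular invariant y ^ (k / 2) |f| of a form f of weight k = 2 kap. *)
Definition Phi (al : C) : R := Re al ^+ kap * nrm (f al).

Lemma Phi_inv al : 0 < Re al -> Phi al^-1 = Phi al.
Proof.
move=> al0; rewrite /Phi [X in _ * X = _](f_S al0) [X in X ^+ _ * _ = _]Re_inv.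
have n0 : 0 < nrm al.
  by apply: lt_le_trans al0 _; apply: le_trans (Re_le_nrm _); apply: ler_norm.
rewrite expr_div_n -exprM mul2n; move: (nrm (f al)) => u.
by field; rewrite expf_neq0 // gt_eqF.
Qed.

Lemma Phi_transl al (k : int) : Phi (al - 'i * k%:~R) = Phi al.
Proof.
rewrite /Phi ee_transl; congr (_ ^+ _ * _).
have -> : (k%:~R : C) = (k%:~R : R)%:C by rewrite rmorph_int.
by case: al => x y /=; simpc; rewrite /=; ring.
Qed.

(** After a translation to imaginary part at most 1/2 in absolute value, a point below 17/20 has
    squared norm at most 389/400, so inversion raises its real part by the factor 400/389 or more.
    This exceeds 1 because 17/20 lies below sqrt 3 / 2; [n] bounds the number of inversions. *)
Lemma reduce_step n al : 0 < Re al -> 17 / 20 <= Re al * (400 / 389) ^+ n ->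
  exists2 be, 17 / 20 <= Re be & Phi be = Phi al.
Proof.
elim: n al => [|n IH] al al0; first by rewrite expr0 mulr1 => h; exists al.
move=> h; pose k := Num.floor (Im al + 1 / 2); pose be := al - 'i * k%:~R.
have Ek : (k%:~R : C) = (k%:~R : R)%:C by rewrite rmorph_int.
have Rbe : Re be = Re al by rewrite /be Ek; case: (al) => x y; simpc; rewrite /=; ring.
have Ibe : Im be = Im al - k%:~R by rewrite /be Ek; case: (al) => x y; simpc; rewrite /=; ring.
have [h1 h2] := andP (floor_itv (Im al + 1 / 2)); rewrite -/k intrD in h1 h2.
have [hb|hb] := leP (17 / 20) (Re be); first by exists be; [exact: hb|exact: Phi_transl].
have be0 : 0 < Re be by rewrite Rbe.
have nb : nrm be ^+ 2 <= 389 / 400.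
  rewrite nrm_sqr; apply: sqr_sum_le => //; rewrite Ibe; first by lra.
  by lra.
have nb0 : 0 < nrm be ^+ 2 by rewrite nrm_sqr ltr_pwDl ?sqr_ge0 // exprn_gt0.
have [ga hg Pg] : exists2 ga, 17 / 20 <= Re ga & Phi ga = Phi be^-1.
  apply: IH; first exact: Re_inv_gt0.
  apply: le_trans h _; rewrite exprS mulrA; apply: ler_wpM2r; first by rewrite exprn_ge0 //; lra.
  rewrite Re_inv -Rbe; apply: ler_wpM2l; first exact: ltW.
  by rewrite -[400 / 389]invf_div lef_pV2 // posrE; lra.
exists ga; first exact: hg.
have T : Phi be = Phi al := Phi_transl al k.
exact (etrans (etrans Pg (Phi_inv be0)) T).
Qed.

Lemma Phi_reduce al : 0 < Re al -> exists2 be, 17 / 20 <= Re be & Phi be = Phi al.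
Proof.
move=> al0; pose n := Num.Def.archi_bound (389 / (Re al * 11)).
apply: (@reduce_step n) => //.
have hn : 389 / (Re al * 11) < n%:R.
  by apply: archi_boundP; rewrite divr_ge0 // mulr_ge0 // ltW.
have b : 1 + n%:R * (11 / 389) <= (400 / 389) ^+ n :> R.
  elim: (n) => [|l IH]; first by rewrite expr0 mul0r addr0.
  rewrite exprSr -natr1; have l0 : 0 <= l%:R :> R by rewrite ler0n.
  apply: le_trans (_ : _ <= (1 + l%:R * (11 / 389)) * (400 / 389)) _; first by lra.
  by apply: ler_wpM2r => //; lra.
apply: le_trans (_ : _ <= Re al * (1 + n%:R * (11 / 389))) _; last by apply: ler_wpM2l => //; exact: ltW.
by apply: growth_bound => //; rewrite -ltr_pdivrMr // mulr_gt0.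
Qed.

Let r : R := expR (- pi).
Let b N : C := a (N + m0)%N.

Lemma r_gt0 : 0 < r. Proof. exact: expR_gt0. Qed.
Lemma r_lt1 : r < 1. Proof. by rewrite /r expR_lt1 oppr_lt0 pi_gt0. Qed.

Lemma pser_shift q : nrm q < 1 -> 0 < nrm q -> pser a q = q ^+ m0 * pser b q.
Proof.
move=> q1 q0; have sa := pser_summable (a_sum q0 q1) (lexx _).
have z N : (N - m0 + m0)%N <> N -> a N * q ^+ N = 0.
  by move=> h; rewrite a_small ?mul0r //; lia.
have pq : cancel (addn^~ m0) (subn^~ m0) by move=> N; rewrite addnK.
rewrite /pser -(tsum_inj pq sa z).
have sb : summable (fun N => b N * q ^+ N).
  have qm : q ^+ m0 != 0 by rewrite expf_neq0 //; apply: contraTneq q0 => ->; rewrite nrm0 ltxx.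
  have := summableZ (q ^+ m0)^-1 (summable_reindex pq sa); apply: eq_summable => N.
  by rewrite /comp /b exprD; field.
by rewrite -(tsumZ _ sb); apply: eq_tsum => N; rewrite /comp /b exprD; ring.
Qed.

Lemma b_sum : psummable b r.
Proof.
have [K hK] := a_sum r_gt0 r_lt1; exists (K / r ^+ m0).
have pq : cancel (addn^~ m0) (subn^~ m0) by move=> N; rewrite addnK.
have rm : 0 < r ^+ m0 by rewrite exprn_gt0 // r_gt0.
have := sum_leZ (ltW (_ : 0 < (r ^+ m0)^-1)) (sum_le_reindex pq hK).
rewrite invr_gt0 => /(_ rm); rewrite [_^-1 * K]mulrC; apply: eq_sum_le => N.
by rewrite /comp /b exprD; field; rewrite gt_eqF.
Qed.

Lemma ee_lt1 al : 0 < Re al -> nrm (ee al) < 1.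
Proof. by move=> h; rewrite nrm_ee expR_lt1 oppr_lt0 mulr_gt0 // mulr_gt0 // pi_gt0. Qed.

Lemma ee_gt0 al : 0 < nrm (ee al).
Proof. by rewrite nrm_ee expR_gt0. Qed.

Lemma ee_ratio al : nrm (ee al) = r * expR (- (2 * pi * (Re al - 1 / 2))).
Proof. by rewrite nrm_ee /r -expRD; congr expR; lra. Qed.

Lemma f_shift al : 0 < Re al -> f al = ee al ^+ m0 * pser b (ee al).
Proof. by move=> h; apply: pser_shift; [apply: ee_lt1|apply: ee_gt0]. Qed.

Lemma zero_shift al : 0 < Re al -> f al = 0 -> pser b (ee al) = 0.
Proof.
move=> h /eqP; rewrite f_shift // mulf_eq0 expf_eq0 (negPf (ee_neq0 al)) andbF /=.
by move/eqP.
Qed.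

Lemma ee_small al : 17 / 20 <= Re al -> nrm (ee al) <= r * (3 / 26).
Proof.
move=> h; rewrite ee_ratio; apply: ler_wpM2l; first exact: ltW r_gt0.
apply: le_trans (expN7pi10_le R); rewrite ler_expR; have := pi_gt0 R; nra.
Qed.

Lemma Phi_shift al : 0 < Re al -> Phi al =
  (2 * Re al) ^+ kap * expR (- (2 * pi * (Re al - 1 / 2))) ^+ m0 *
  (r ^+ m0 / 2 ^+ kap * nrm (pser b (ee al))).
Proof.
move=> h; rewrite /Phi f_shift // nrmM nrmX ee_ratio !exprMn; field.
by rewrite expf_neq0 // pnatr_eq0.
Qed.

(** [Z] is the gain from the zeros between the circle of radius [r] and the disc of radius 3 r / 26,
    while [G] bounds the growth of the remaining weight. The supremum [M] of [Phi] bounds the series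
    on the circle, and returning to Re al >= 17/20 yields [M <= G * Z * M]. *)
Lemma vanish_contract (G Z : R) : 0 <= Z -> G * Z < 1 ->
  (forall y : R, 17 / 20 <= y -> (2 * y) ^+ kap * expR (- (2 * pi * (y - 1 / 2))) ^+ m0 <= G) ->
  (forall (A : R) q, 0 <= A -> (forall x : R, nrm (pser b (r%:C * cexp ('i * x%:C))) <= A) ->
    nrm q <= r * (3 / 26) -> nrm (pser b q) <= A * Z) ->
  forall N, a N = 0.
Proof.
move=> Z0 GZ hG hZ; have r0 := r_gt0.
have D0 : 0 < r ^+ m0 / 2 ^+ kap by rewrite divr_gt0 // exprn_gt0.
have G0 : 0 <= G.
  apply: le_trans (hG (17 / 20) (lexx _)); rewrite mulr_ge0 ?exprn_ge0 ?expR_ge0 //; lra.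
have Re0 (be : C) : 17 / 20 <= Re be -> 0 < Re be by lra.
have W0 (be : C) : 17 / 20 <= Re be ->
    0 <= (2 * Re be) ^+ kap * expR (- (2 * pi * (Re be - 1 / 2))) ^+ m0.
  by move=> hb; rewrite mulr_ge0 // exprn_ge0 ?expR_ge0 // mulr_ge0 // ltW ?Re0.
have V0 (be : C) : 0 <= r ^+ m0 / 2 ^+ kap * nrm (pser b (ee be)).
  by rewrite mulr_ge0 ?nrm_ge0 // ltW.
have [K hK] := b_sum.
pose S : set R := [set t | exists2 al, 0 < Re al & t = Phi al]%classic.
(* The supremum must be finite before it can be compared with itself; the trivial bound for the
   series on the closed disc of radius [r] suffices for that. *)
have ubS : ubound S (G * (r ^+ m0 / 2 ^+ kap * K)).
  move=> t [al al0 ->]; have [be hb <-] := Phi_reduce al0; rewrite (Phi_shift (Re0 _ hb)).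
  have w0 := W0 _ hb; have v0 := V0 be; apply: ler_pM; [exact: w0|exact: v0|exact: hG|].
  apply: ler_wpM2l; first exact: ltW.
  apply: tsum_nrm_le => A; apply: le_trans (hK A); apply: ler_sum => N _.
  rewrite nrmM nrmX; apply: ler_wpM2l; first exact: nrm_ge0.
  apply: lerXn2r; rewrite ?nnegrE ?nrm_ge0 ?(ltW r0) //.
  by apply: le_trans (ee_small hb) _; nra.
have p1 : 0 < Re (1 : C) by exact: ltr01.
have S1 : S (Phi 1) by exists 1.
have hS : has_ubound S by exists (G * (r ^+ m0 / 2 ^+ kap * K)).
pose M := sup S; have PM al : 0 < Re al -> Phi al <= M.
  by move=> h; apply: (ub_le_sup hS); exists al.
have M0 : 0 <= M.
  by apply: le_trans (PM 1 p1); rewrite mulr_ge0 ?nrm_ge0 // exprn_ge0 // ltW.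
pose A := M * (2 ^+ kap / r ^+ m0).
have A0 : 0 <= A by rewrite mulr_ge0 // divr_ge0 // exprn_ge0 // ltW.
have hA (x : R) : nrm (pser b (r%:C * cexp ('i * x%:C))) <= A.
  rewrite /r circle_ee; set al := _ +i* _.
  have al0 : 0 < Re al by rewrite /=; lra.
  have := PM al al0; rewrite (Phi_shift al0) (_ : Re al = 1 / 2) //.
  rewrite subrr mulr0 oppr0 expR0 expr1n mulr1 (_ : 2 * (1 / 2) = 1); last by lra.
  rewrite expr1n mul1r -ler_pdivlMl // => h; apply: le_trans h _.
  by rewrite /A invf_div mulrC.
have MM : M <= G * Z * M.
  apply: ge_sup; first by exists (Phi 1).
  move=> t [al al0 ->]; have [be hb <-] := Phi_reduce al0; rewrite (Phi_shift (Re0 _ hb)).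
  have -> : G * Z * M = G * (r ^+ m0 / 2 ^+ kap * (A * Z)).
    by rewrite /A; field; rewrite !expf_neq0 ?gt_eqF.
  have w0 := W0 _ hb; have v0 := V0 be; apply: ler_pM; [exact: w0|exact: v0|exact: hG|].
  by apply: ler_wpM2l; [exact: ltW|apply: hZ => //; exact: ee_small].
have M00 : M = 0.
  apply/eqP; rewrite eq_le M0 andbT -(pmulr_rle0 M (_ : 0 < 1 - G * Z)) ?subr_gt0 //.
  by rewrite mulrBl mul1r subr_le0.
have hA0 (x : R) : nrm (pser b (r%:C * cexp ('i * x%:C))) <= 0.
  by have := hA x; rewrite /A M00 mul0r.
move=> N; have [/a_small//|mN] := ltnP N m0.
have := cauchy_coef r0 b_sum hA0 (N - m0)%N; rewrite /b subnK // pmulr_lle0 ?exprn_gt0 // => h.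
by apply: nrm_eq0; apply/eqP; rewrite eq_le h nrm_ge0.
Qed.

(** With all moduli measured in units of [r], this is the factor due to one zero; it increases both
    in the point and in the zero. *)
Lemma zfac_le (x w0 w : R) : 0 <= x -> x <= 3 / 26 -> 0 <= w -> w <= w0 -> w0 < 1 ->
  (x + w) / (1 - w) <= (3 / 26 + w0) / (1 - w0).
Proof.
move=> x0 hx hw ww w1; have w1' : w < 1 by apply: le_lt_trans w1.
rewrite ler_pdivrMr ?subr_gt0 // mulrAC ler_pdivlMr ?subr_gt0 //; nra.
Qed.

Lemma lfac_le (x : R) : x <= 3 / 26 -> (1 - x)^-1 <= 26 / 23.
Proof.
by move=> hx; rewrite -[26 / 23]invf_div lef_pV2 ?posrE; lra.
Qed.

Lemma single_factor (w : C) (w0 : R) : w0 < 1 -> nrm w <= r * w0 -> pser b w = 0 ->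
  forall (A : R) q, 0 <= A -> (forall x : R, nrm (pser b (r%:C * cexp ('i * x%:C))) <= A) ->
    nrm q <= r * (3 / 26) -> nrm (pser b q) <= A * ((3 / 26 + w0) / (1 - w0) * (26 / 23)).
Proof.
move=> w1 ww bw A q A0 hA hq; have r0 := r_gt0.
pose x := nrm q / r; pose v := nrm w / r.
have qE : nrm q = r * x by rewrite /x mulrC divfK ?gt_eqF.
have wE : nrm w = r * v by rewrite /v mulrC divfK ?gt_eqF.
have x0 : 0 <= x by rewrite divr_ge0 ?nrm_ge0 // ltW.
have v0 : 0 <= v by rewrite divr_ge0 ?nrm_ge0 // ltW.
have hx : x <= 3 / 26 by rewrite ler_pdivrMr // mulrC.
have hv : v <= w0 by rewrite ler_pdivrMr // mulrC.
have wr : nrm w < r by rewrite wE -[X in _ < X]mulr1 ltr_pM2l //; lra.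
have qr : nrm q < r by rewrite qE -[X in _ < X]mulr1 ltr_pM2l //; lra.
apply: le_trans (zero_bound1 r0 b_sum wr bw A0 hA qr) _; rewrite -/x qE wE.
have -> : (r * x + r * v) * (A / (r - r * v) / (1 - x)) = A * ((x + v) / (1 - v) * (1 - x)^-1).
  by field; rewrite !gt_eqF ?subr_gt0 //; nra.
apply: ler_wpM2l => //; apply: ler_pM.
- by apply: divr_ge0; [exact: addr_ge0|lra].
- by rewrite invr_ge0; lra.
- exact: zfac_le.
- exact: lfac_le.
Qed.

Lemma double_factor (w u : C) (w0 u0 : R) : w0 < 1 -> u0 < 1 -> nrm w <= r * w0 -> nrm u <= r * u0 ->
  w != u -> pser b w = 0 -> pser b u = 0 ->
  forall (A : R) q, 0 <= A -> (forall x : R, nrm (pser b (r%:C * cexp ('i * x%:C))) <= A) ->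
    nrm q <= r * (3 / 26) -> nrm (pser b q) <=
      A * ((3 / 26 + w0) / (1 - w0) * ((3 / 26 + u0) / (1 - u0) * (26 / 23))).
Proof.
move=> w1 u1 ww uu wu bw bu A q A0 hA hq; have r0 := r_gt0.
pose x := nrm q / r; pose v := nrm w / r; pose t := nrm u / r.
have qE : nrm q = r * x by rewrite /x mulrC divfK ?gt_eqF.
have wE : nrm w = r * v by rewrite /v mulrC divfK ?gt_eqF.
have uE : nrm u = r * t by rewrite /t mulrC divfK ?gt_eqF.
have x0 : 0 <= x by rewrite divr_ge0 ?nrm_ge0 // ltW.
have v0 : 0 <= v by rewrite divr_ge0 ?nrm_ge0 // ltW.
have t0 : 0 <= t by rewrite divr_ge0 ?nrm_ge0 // ltW.
have hx : x <= 3 / 26 by rewrite ler_pdivrMr // mulrC.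
have hv : v <= w0 by rewrite ler_pdivrMr // mulrC.
have ht : t <= u0 by rewrite ler_pdivrMr // mulrC.
have wr : nrm w < r by rewrite wE -[X in _ < X]mulr1 ltr_pM2l //; lra.
have ur : nrm u < r by rewrite uE -[X in _ < X]mulr1 ltr_pM2l //; lra.
have qr : nrm q < r by rewrite qE -[X in _ < X]mulr1 ltr_pM2l //; lra.
apply: le_trans (zero_bound2 r0 b_sum wr ur wu bw bu A0 hA qr) _; rewrite -/x qE wE uE.
have -> : (r * x + r * v) * ((r * x + r * t) * (A / (r - r * v) / (r - r * t) / (1 - x))) =
    A * ((x + v) / (1 - v) * ((x + t) / (1 - t) * (1 - x)^-1)).
  by field; rewrite !gt_eqF ?subr_gt0 //; nra.
have f1 : 0 <= (x + v) / (1 - v) by apply: divr_ge0; [exact: addr_ge0|lra].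
have f2 : 0 <= (x + t) / (1 - t) by apply: divr_ge0; [exact: addr_ge0|lra].
have f3 : 0 <= (1 - x)^-1 by rewrite invr_ge0; lra.
apply: ler_wpM2l => //; apply: ler_pM; [by []|by rewrite mulr_ge0|exact: zfac_le|].
by apply: ler_pM; [by []|by []|exact: zfac_le|exact: lfac_le].
Qed.

Lemma zfac_one : (3 / 26 + 2 / 37) / (1 - 2 / 37) = 163 / 910 :> R.
Proof. by have -> : 1 - 2 / 37 = 35 / 37 :> R; [lra|rewrite invf_div; lra]. Qed.

Lemma zfac_rho6 : (3 / 26 + 3 / 26) / (1 - 3 / 26) = 6 / 23 :> R.
Proof. by have -> : 1 - 3 / 26 = 23 / 26 :> R; [lra|rewrite invf_div; lra]. Qed.

Lemma ee_one_le : nrm (ee 1) <= r * (2 / 37).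
Proof.
rewrite nrm_ee /= (_ : - (2 * pi * 1) = - pi + - pi); last by lra.
by rewrite expRD -/r ler_pM2l ?r_gt0 // expNpi_le.
Qed.

Lemma ee_rho6_le : nrm (ee rho6) <= r * (3 / 26).
Proof. by apply: ee_small; rewrite Re_rho6; have := sqrt3_bounds; lra. Qed.

Lemma rho6_gt0 : 0 < Re rho6.
Proof. by rewrite Re_rho6; have := sqrt3_bounds; lra. Qed.

Lemma ee_one_rho6 : ee 1 != ee rho6.
Proof.
apply/eqP => /(congr1 nrm); rewrite !nrm_ee Re_rho6 => /expR_inj /oppr_inj /=.
have /andP[_ h] := sqrt3_bounds; have := pi_gt0 R; nra.
Qed.

Lemma vanish_single : (m0 <= 2)%N -> (kap <= 5 * m0)%N -> f 1 = 0 \/ f rho6 = 0 ->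
  forall N, a N = 0.
Proof.
move=> m2 km z.
(* [6 / 23] comes from the zero at [rho6], the worse of the two, and [26 / 23] from the geometric
   series. *)
have Gm : (176 / 100) ^+ m0 * (6 / 23 * (26 / 23)) < 1 :> R.
  by case: m0 m0_gt0 m2 => [|[|[|]]] // _ _; rewrite ?expr1; lra.
apply: (vanish_contract (Z := 6 / 23 * (26 / 23)) _ Gm); first by lra.
  by move=> y hy; apply: le_trans (weight_le _ km hy) _; apply: weight_single.
case: z => z A q A0 hA hq.
  apply: le_trans (single_factor _ ee_one_le _ A0 hA hq) _; first by lra.
    by apply: zero_shift => //=.
  by rewrite zfac_one; apply: ler_wpM2l => //; lra.
apply: le_trans (single_factor _ ee_rho6_le _ A0 hA hq) _; first by lra.
  by apply: zero_shift => //; exact: rho6_gt0.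
by rewrite zfac_rho6.
Qed.

Lemma vanish_double : (m0 = 1%N /\ (kap <= 7)%N) \/ (m0 = 2%N /\ (kap <= 13)%N) ->
  f 1 = 0 -> f rho6 = 0 -> forall N, a N = 0.
Proof.
move=> hm z1 z2.
(* The value of [G] for weight 26 also covers weight 14, where 10 would do. *)
apply: (vanish_contract (G := 176 / 10) (Z := 163 / 910 * (6 / 23 * (26 / 23)))).
- by lra.
- by lra.
- move=> y hy; case: hm => [[-> hk]|[-> hk]]; apply: le_trans (weight_le _ hk hy) _.
    by apply: le_trans (weight_7_1 hy) _; lra.
  exact: weight_13_2.
move=> A q A0 hA hq.
have b1 := zero_shift (ltr01 : 0 < Re (1 : C)) z1; have b2 := zero_shift rho6_gt0 z2.
apply: le_trans (double_factor _ _ ee_one_le ee_rho6_le ee_one_rho6 b1 b2 A0 hA hq) _; [by lra|by lra|].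
by rewrite zfac_one zfac_rho6.
Qed.

End Vanishing.

(** * The theta series as a power series in the nome *)

Section LatticeTheta.
Variables (R : realType) (n : nat) (B : 'M[R]_n) (Az Wz : 'M[int]_n).
Local Notation C := R[i].
Hypotheses (uB : B \in unitmx) (AzE : map_mx (fun k : int => k%:~R) Az = B *m B^T)
  (AWz : Az *m Wz = 1%:M) (WAz : Wz *m Az = 1%:M).
Hypothesis lnq_even : forall m, exists k : int, lnq B m = 2 * k%:~R.
Variables (T : finType) (lam : T -> R) (zt : T -> 'rV[R]_n) (d : nat).
Hypothesis harm : forall x j, (0 < j)%N -> (j.*2 <= d)%N ->
    \sum_t lam t * (dp (zt t) (zt t) ^+ j * dp x (zt t) ^+ (d - j.*2)) = 0.

Definition hnorm (m : 'rV[int]_n) : nat := Num.truncn (lnq B m / 2).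

Lemma lnqE m : lnq B m = 2 * (hnorm m)%:R.
Proof.
have [k hk] := lnq_even m; have := lnq_ge0 B m; rewrite /hnorm hk => h.
have k0 : 0 <= k by move: h; rewrite pmulr_rge0 // ler0z.
by case: k k0 {hk h} => // k _; rewrite -pmulrn [2 * _]mulrC mulfK ?pnatr_eq0 // natrK mulrC.
Qed.

Lemma lpt_inj : injective (lpt B).
Proof.
move=> x y /(congr1 (mulmx^~ (invmx B))); rewrite /= /lpt !mulmxK // => /rowP h.
by apply/rowP => i; have := h i; rewrite !mxE => /intr_inj.
Qed.

Lemma hnorm_finite N : exists A : {fset 'rV[int]_n}, forall m, hnorm m = N -> m \in A.
Proof.
have [K hK] := lnq_sum uB (@ltr01 R).
have [A hA] := large_terms_finite (fun m => expR_ge0 _) hK (expR_gt0 (- (1 * (2 * N%:R)))).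
by exists A => m hm; apply: hA; rewrite lnqE hm.
Qed.

Definition lpol (m : 'rV[int]_n) : C := (pol lam zt d (lpt B m))%:C.
Definition coef (N : nat) : C := tsum (fun m => if hnorm m == N then lpol m else 0).

Lemma coef_summable N : summable (fun m => if hnorm m == N then lpol m else 0).
Proof.
have [A hA] := hnorm_finite N; apply: (@fin_supp_summable _ _ _ A) => m.
by apply: contraNeq; case: (hnorm m =P N) => [/hA//|]; rewrite eqxx.
Qed.

Lemma theta_term al m : lpol m * gN al (lnq B m) = lpol m * ee al ^+ hnorm m.
Proof. by rewrite lnqE gN_even. Qed.

Lemma coef_fiber al N :
  tsum (fun m => if hnorm m == N then lpol m * gN al (lnq B m) else 0) = coef N * ee al ^+ N.
Proof.
rewrite [RHS]mulrC /coef -(tsumZ _ (coef_summable N)); apply: eq_tsum => m.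
by rewrite theta_term; case: eqP => [->|_]; rewrite ?mulr0 // mulrC.
Qed.

Lemma theta_pser al : 0 < Re al -> theta B lam zt d al = pser coef (ee al).
Proof.
move=> al0; rewrite /theta (tsum_fibers hnorm (theta_summable uB lam zt d al0)).
by apply: eq_tsum => N; apply: coef_fiber.
Qed.

(** Every [r] in (0, 1) is the modulus of a nome, so the claim is absolute convergence of the theta
    series at a real point, regrouped by norms. *)
Lemma coef_psummable (r : R) : 0 < r -> r < 1 -> psummable coef r.
Proof.
move=> r0 r1; pose y := - ln r / (2 * pi).
have p2 : 0 < 2 * pi :> R by rewrite mulr_gt0 // pi_gt0.
have y0 : 0 < Re (y%:C : C) by rewrite /= divr_gt0 // oppr_gt0 ln_lt0 // r0.
have hr : nrm (ee y%:C) = r.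
  by rewrite nrm_ee /= /y mulrC divfK ?gt_eqF // opprK lnK.
have s := summable_fibers hnorm (theta_summable uB lam zt d y0).
have qp : cancel (fun x : nat * 'rV[int]_n => (x.2, x.1)) (fun x => (x.2, x.1)) by case.
have [K hK] := summable_tsum (summable_reindex qp s); exists K.
move: hK; apply: eq_sum_le => N; rewrite -hr -nrmX -nrmM; congr nrm.
exact: coef_fiber.
Qed.

Lemma coef0 : (0 < d)%N -> coef 0 = 0.
Proof.
move=> d0; rewrite /coef -[RHS](tsum0 R 'rV[int]_n); apply: eq_tsum => m.
case: eqP => // h; have : lnq B m = 0 by rewrite lnqE h mulr0.
rewrite /lnq; have [m0 _|/dp_gt0 h1 h2] := eqVneq (lpt B m) 0; last by rewrite h2 ltxx in h1.
rewrite /lpol /pol m0 big1 // => t _.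
by rewrite /dp mul0mx mxE expr0n eqn0Ngt d0 mulr0.
Qed.

Lemma coef_empty N : (forall m, hnorm m != N) -> coef N = 0.
Proof.
by move=> h; rewrite /coef -[RHS](tsum0 R 'rV[int]_n); apply: eq_tsum => m; rewrite (negPf (h m)).
Qed.

Section Modular.
Variables (h e : nat).
Hypotheses (nE : n = h.*2.*2) (dE : d = e.*2).
Local Notation f al := (pser coef (ee al)).

Lemma coef_S al : 0 < Re al -> exists K : C, [/\ K ^+ 2 = al ^- n, al = 1 -> K = 1 &
  al ^+ d * f al = K * (-1) ^+ e * f al^-1].
Proof.
move=> al0; have [K [K2 K1 hK]] := theta_S uB AzE AWz WAz harm al0.
exists K; split; [exact: K2|exact: K1|].
have e1 := theta_pser al0; have e2 := theta_pser (Re_inv_gt0 al0).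
have hi : 'i ^+ d = (-1) ^+ e :> C by rewrite dE -mul2n exprM sqr_i.
have ha : (- al) ^+ d = al ^+ d by rewrite dE -mul2n !exprM sqrrN.
rewrite hi ha in hK.
exact (etrans (congr1 (fun u => al ^+ d * u) (esym e1))
  (etrans hK (congr1 (fun u => K * (-1) ^+ e * u) e2))).
Qed.

Lemma nrm_functional (al K u v : C) : 0 < Re al -> K ^+ 2 = al ^- n ->
  al ^+ d * u = K * (-1) ^+ e * v -> nrm v = nrm al ^+ (e + h).*2 * nrm u.
Proof.
move=> al0 K2 hK; have n0 : 0 < nrm al.
  by apply: lt_le_trans al0 _; apply: le_trans (Re_le_nrm _); apply: ler_norm.
have nK : nrm K = nrm al ^- h.*2.
  apply/eqP; rewrite -(@eqrXn2 _ 2) ?nrm_ge0 ?invr_ge0 ?exprn_ge0 // ?ltW //.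
  have -> : nrm K ^+ 2 = nrm (K ^+ 2) by rewrite nrmX.
  by rewrite K2 nrmV nrmX exprVn -exprM muln2 -nE.
have n1 : nrm ((-1) ^+ e : C) = 1 by rewrite nrmX nrmN nrm1 expr1n.
move: (congr1 nrm hK); rewrite !nrmM n1 nK mulr1 [nrm (al ^+ d)]nrmX => huv.
rewrite doubleD exprD -dE mulrAC huv mulrAC mulVf ?mul1r //.
by rewrite expf_neq0 // gt_eqF.
Qed.

Lemma coef_nrmS al : 0 < Re al -> nrm (f al^-1) = nrm al ^+ (e + h).*2 * nrm (f al).
Proof.
by move=> al0; have [K [K2 _ hK]] := coef_S al0; exact (nrm_functional al0 K2 hK).
Qed.

(** Inversion fixes 1 and the Poisson factor is 1 there, so for odd [e] the value equals its own
    negative. *)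
Lemma coef_zero1 : odd e -> f 1 = 0.
Proof.
move=> oe; have p1 : 0 < Re (1 : C) by exact: ltr01.
have [K [_ K1 hK]] := coef_S p1; rewrite K1 // invr1 in hK.
move: (f 1) hK => u; rewrite expr1n -signr_odd oe expr1 mulrN1 mulN1r mul1r => hu.
by move/eqP: hu; rewrite -addr_eq0 -mulr2n mulrn_eq0 /= => /eqP.
Qed.

Lemma rho6_neq0 : rho6 R != 0.
Proof. by apply: contraTneq (rho6_gt0 R) => ->; rewrite ltxx. Qed.

Lemma rho6_facts : [/\ (rho6 R)^-1 = rho6 R - 'i * 1%:~R, rho6 R ^+ 4 != 1,
  (rho6 R ^+ 4) ^+ 2 != 1 & (rho6 R ^+ 4) ^+ 3 = 1].
Proof.
have s3 : Num.sqrt 3 ^+ 2 = 3 :> R by rewrite sqr_sqrtr.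
have s0 : 0 < Num.sqrt 3 :> R by rewrite sqrtr_gt0.
have r2 : rho6 R ^+ 2 = (1 / 2) +i* (Num.sqrt 3 / 2).
  rewrite /rho6 expr2; move: s3; move: (Num.sqrt 3) => s s3; simpc.
  by apply/eqP; rewrite eq_complex /=; apply/andP; split; apply/eqP; nra.
have r4 : rho6 R ^+ 4 = (- (1 / 2)) +i* (Num.sqrt 3 / 2).
  rewrite (exprM _ 2 2) r2 expr2; move: s3; move: (Num.sqrt 3) => s s3; simpc.
  by apply/eqP; rewrite eq_complex /=; apply/andP; split; apply/eqP; nra.
have r8 : (rho6 R ^+ 4) ^+ 2 = (- (1 / 2)) +i* (- (Num.sqrt 3 / 2)).
  rewrite r4 expr2; move: s3; move: (Num.sqrt 3) => s s3; simpc.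
  by apply/eqP; rewrite eq_complex /=; apply/andP; split; apply/eqP; nra.
have r12 : (rho6 R ^+ 4) ^+ 3 = 1.
  rewrite exprS r8 r4; move: s3; move: (Num.sqrt 3) => s s3; simpc.
  by apply/eqP; rewrite eq_complex /=; apply/andP; split; apply/eqP; nra.
split => //.
- have r0 := rho6_neq0.
  apply: (mulfI r0); rewrite mulfV //.
  rewrite /rho6; move: s3; move: (Num.sqrt 3) => s s3; simpc.
  by apply/eqP; rewrite eq_complex /=; apply/andP; split; apply/eqP; nra.
- by rewrite r4 eq_complex /= negb_and; apply/orP; left; lra.
- by rewrite r8 eq_complex /= negb_and; apply/orP; left; lra.
Qed.

(** Squaring removes the unknown sign of [K] and gives [al ^+ (d * 2) = al ^- n], that is
    [(al ^+ 4) ^+ (e + h) = 1], where [al ^+ 4] has exact order 3. *)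
Lemma unit_weight (al K : C) : al != 0 -> al ^+ 4 != 1 -> (al ^+ 4) ^+ 2 != 1 -> (al ^+ 4) ^+ 3 = 1 ->
  K ^+ 2 = al ^- n -> al ^+ d = K * (-1) ^+ e -> (3 %| e + h)%N.
Proof.
move=> r0 z1 z2 z3 K2 hu.
have h4 : (al ^+ 4) ^+ (e + h) = 1.
  have h1 : al ^+ (d * 2) = al ^- n.
    by rewrite exprM hu exprMn K2 -exprM mulnC exprM sqrrN !expr1n mulr1.
  rewrite -exprM mulnDr exprD.
  have -> : (4 * e = d * 2)%N by rewrite dE; lia.
  have -> : (4 * h = n)%N by rewrite nE; lia.
  by rewrite h1 mulVf // expf_neq0.
move: h4; rewrite {1}(divn_eq (e + h) 3) exprD [(_ * 3)%N]mulnC exprM z3 expr1n mul1r => h4.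
rewrite /dvdn; have : ((e + h) %% 3 < 3)%N by rewrite ltn_mod.
by move: h4; case: ((e + h) %% 3)%N => [|[|[|]]] // /eqP; rewrite ?expr1 ?(negPf z1) ?(negPf z2).
Qed.

(** The inverse of [rho6] is one of its translates, so the series takes the same value at both; were
    it nonzero, it would cancel from the functional equation. *)
Lemma coef_zero_rho6 : ~~ (3 %| e + h)%N -> f (rho6 R) = 0.
Proof.
move=> k3; have [inv z1 z2 z3] := rho6_facts.
have [K [K2 _ hK]] := coef_S (rho6_gt0 R).
have ef : f (rho6 R)^-1 = f (rho6 R) := congr1 (pser coef) (etrans (congr1 (@ee R) inv) (ee_transl _ 1)).
have {}hK := etrans hK (congr1 (fun u => K * (-1) ^+ e * u) ef).
move: (f (rho6 R)) hK => u hu; apply/eqP; apply: contraNT k3 => u0.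
exact (unit_weight rho6_neq0 z1 z2 z3 K2 (mulIf u0 hu)).
Qed.

(* The weight is 2 (e + h); for odd [e] the theta series vanishes at the elliptic
   point i, and for [e + h] prime to 3 it vanishes at the elliptic point of order 3. *)
Definition good_weight (m0 : nat) : bool :=
  ((e + h <= 5 * m0) && (odd e || ~~ (3 %| e + h)) ||
   [&& odd e, ~~ (3 %| e + h) & e + h <= (if m0 == 1 then 7 else 13)])%N.

Lemma coef_vanish (m0 : nat) : (0 < m0 <= 2)%N -> good_weight m0 ->
  (forall N, (N < m0)%N -> coef N = 0) -> forall N, coef N = 0.
Proof.
move=> /andP[m1 m2] gw small.
case/orP: gw => [/andP[hk hz]|/and3P[oe k3 hk]].
  apply: (vanish_single m1 coef_psummable small coef_nrmS m2 hk).
  by case/orP: hz => [/coef_zero1|/coef_zero_rho6]; [left|right].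
apply: (vanish_double m1 coef_psummable small coef_nrmS _ (coef_zero1 oe) (coef_zero_rho6 k3)).
by move: m1 m2 hk; case: m0 {small} => [|[|[|]]] // _ _ hk; [left|right].
Qed.

End Modular.

Lemma coef_sum N (A : {fset 'rV[int]_n}) : (forall m, hnorm m = N -> m \in A) ->
  coef N = 0 -> \sum_(m <- A | hnorm m == N) pol lam zt d (lpt B m) = 0.
Proof.
move=> hA; rewrite /coef (@fin_supp_tsum _ _ _ A); last first.
  by move=> m; apply: contraNeq; case: (hnorm m =P N) => [/hA//|]; rewrite eqxx.
rewrite -big_mkcond /= /lpol -rmorph_sum /= => /(congr1 (@complex.Re R)).
by [].
Qed.

End LatticeTheta.

(** * Shells of even selfdual lattices *)

Section Shells.
Variable R : realType.

Lemma is_intR_floor (x : R) : is_intR x -> (Num.floor x)%:~R = x.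
Proof. by move=> [k ->]; rewrite intrKfloor. Qed.

Variable n : nat.
Implicit Types (x y u v : 'rV[R]_n) (L : 'rV[R]_n -> Prop).

Lemma dotvE u v : dotv u v = dp u v.
Proof. by rewrite /dotv /dp mxE; apply: eq_bigr => i _; rewrite mxE. Qed.

Lemma dp_rowE x (M : 'M[R]_n) i : dp x (row i M) = (x *m M^T) 0 i.
Proof. by rewrite /dp !mxE; apply: eq_bigr => j _; rewrite !mxE. Qed.

Lemma zv_delta (i : 'I_n) : zv R (delta_mx 0 i) = delta_mx 0 i.
Proof. by apply/rowP => j; rewrite !mxE; case: (_ && _). Qed.

(** The rows of [invmx G *m B] form the dual basis. By selfduality they lie in the lattice, so their
    coordinates, the entries of the inverse Gram matrix, are integers. *)
Lemma gram_integral L (B : 'M[R]_n) : B \in unitmx -> (forall x, L x <-> Zspan B x) -> selfdual L ->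
  exists Az Wz : 'M[int]_n, [/\ map_mx (fun k : int => k%:~R) Az = B *m B^T, Az *m Wz = 1%:M &
    Wz *m Az = 1%:M].
Proof.
move=> uB LB [intL dualL]; set G := B *m B^T.
have uG : G \in unitmx by rewrite unitmx_mul unitmx_tr uB.
have Lrow i : L (row i B) by apply/LB; exists (delta_mx 0 i); rewrite -/(zv R _) zv_delta rowE.
have Gint i j : is_intR (G i j).
  have := intL _ _ (Lrow i) (Lrow j); rewrite dotvE dp_rowE.
  by rewrite -row_mul mxE.
pose W := invmx G.
have Wint i j : is_intR (W i j).
  have : L (row i (W *m B)).
    apply/dualL => x /LB[z ->]; rewrite dotvE dp_rowE trmx_mul mulmxA -/(zv R z) -[zv R z *m B *m B^T]mulmxA.
    have -> : W^T = W by rewrite trmx_inv /G trmx_mul trmxK.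
    by rewrite mulmxK //; exists (z 0 i); rewrite mxE.
  move/LB => [z hz]; exists (z 0 j).
  have : row i W = zv R z by apply: (can_inj (mulmxK uB)); rewrite -row_mul.
  by move/rowP/(_ j); rewrite !mxE.
exists (\matrix_(i, j) Num.floor (G i j)), (\matrix_(i, j) Num.floor (W i j)).
have eG : map_mx (fun k : int => k%:~R) (\matrix_(i, j) Num.floor (G i j)) = G.
  by apply/matrixP => i j; rewrite mxE [X in X%:~R]mxE is_intR_floor.
have eW : map_mx (fun k : int => k%:~R) (\matrix_(i, j) Num.floor (W i j)) = W.
  by apply/matrixP => i j; rewrite mxE [X in X%:~R]mxE is_intR_floor.
have inj (M M' : 'M[int]_n) : map_mx (fun k : int => k%:~R : R) M = map_mx (fun k : int => k%:~R) M' -> M = M'.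
  by move/matrixP => h; apply/matrixP => i j; have := h i j; rewrite !mxE => /intr_inj.
have e1 : map_mx (fun k : int => k%:~R) (1%:M : 'M[int]_n) = 1%:M :> 'M[R]_n.
  by apply/matrixP => i j; rewrite !mxE; case: (i == j).
split; [exact: eG| |]; apply: inj; rewrite map_mxM e1 eG eW; [exact: mulmxV|exact: mulVmx].
Qed.

(** A single enumeration of the shell serves all degrees, as the design definitions demand. The
    order of vanishing [m0] may be 2 only if vectors of norm 2 are excluded. *)
Lemma shell_conds L (h : nat) (mu : R) : n = h.*2.*2 -> even_selfdual L -> (exists x, shell L mu x) ->
  exists s, enumerates s (shell L mu) /\ forall e m0 : nat, (0 < e)%N -> (0 < m0 <= 2)%N ->
    (m0 = 2%N -> lattice_min L 4%:R) -> good_weight h e m0 -> cond_C s e.*2.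
Proof.
move=> nE [[B [uB LB]] sdL evL] [x0 [Lx0 x0mu]].
have [Az [Wz [AzE AWz WAz]]] := gram_integral uB LB sdL.
have Llpt m : L (lpt B m) by apply/LB; exists m.
have lE m : lnq B m = dotv (lpt B m) (lpt B m) by rewrite dotvE.
have lev m : exists k : int, lnq B m = 2 * k%:~R.
  by have [k hk] := evL _ (Llpt m); exists k; rewrite lE hk.
have [z0 hz0] : exists z0, x0 = lpt B z0 by have /LB[z ->] := Lx0; exists z.
pose N := hnorm B z0.
have muE : mu = 2 * N%:R by rewrite -x0mu hz0 -lE (lnqE lev).
have [A hA] := hnorm_finite uB lev N.
exists [seq lpt B z | z <- [seq z <- enum_fset A | hnorm B z == N]].
have hs m : (hnorm B m == N) = (lnq B m == mu).
  by rewrite (lnqE lev) muE (inj_eq (mulfI _)) ?pnatr_eq0 // eqr_nat.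
split.
  split; first by rewrite (map_inj_uniq (lpt_inj uB)) filter_uniq // fset_uniq.
  move=> x; split.
    move=> /mapP[z]; rewrite mem_filter hs => /andP[/eqP hz _] ->.
    by split; [exact: Llpt|rewrite -lE].
  move=> [/LB[z ->] hz]; apply/mapP; exists z => //; rewrite mem_filter.
  have hN : hnorm B z == N by rewrite hs lE; apply/eqP; exact: hz.
  by rewrite hN /=; apply: hA; apply/eqP.
move=> e m0 e0 hm0 hmin gw P hP harmP.
have [T [lam [zt [hp harm]]]] := harmonic_repr hP harmP.
(* The constant coefficient vanishes because the form has positive degree and norm 0 means the
   origin; the next one, for [m0 = 2], because no vector has norm 2. *)
have small M : (M < m0)%N -> coef B lam zt e.*2 M = 0.
  case: M => [|[|M]]; first by move=> _; apply: coef0; rewrite ?double_gt0.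
    move=> hm; have m2 : m0 = 2%N by move: hm hm0; case: (m0) => [|[|[|]]].
    have [_ min4] := hmin m2; apply: coef_empty => m; apply/eqP => h1.
    have l2 : lnq B m = 2 by rewrite (lnqE lev) h1 mulr1.
    have m0' : lpt B m != 0.
      by apply/eqP => l0; move: l2; rewrite /lnq l0 /dp mul0mx mxE => /eqP; rewrite eq_sym pnatr_eq0.
    have := min4 _ (Llpt m) m0'; rewrite -lE l2 ler_nat.
    by [].
  by move: hm0; case: (m0) => [|[|[|]]].
have cN := coef_vanish uB AzE AWz WAz lev harm nE erefl hm0 gw small N.
have := coef_sum hA cN.
rewrite (eq_bigr (fun m => (e.*2)`!%:R * P.@[fun i => lpt B m 0 i])); last by move=> m _; apply: hp.
rewrite -mulr_sumr => /eqP; rewrite mulf_eq0 pnatr_eq0 eqn0Ngt fact_gt0 /= => /eqP hsum.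
by rewrite big_map big_filter.
Qed.

End Shells.

(** * The lattice W_8 is even and selfdual *)

Section E8.
Variable R : realType.

Lemma intRD (x y : R) : is_intR x -> is_intR y -> is_intR (x + y).
Proof. by move=> [k ->] [l ->]; exists (k + l); rewrite intrD. Qed.

Lemma intRN (x : R) : is_intR x -> is_intR (- x).
Proof. by move=> [k ->]; exists (- k); rewrite mulrNz. Qed.

Lemma intRM (x y : R) : is_intR x -> is_intR y -> is_intR (x * y).
Proof. by move=> [k ->] [l ->]; exists (k * l); rewrite intrM. Qed.

Lemma intR_int (k : int) : is_intR (k%:~R : R).
Proof. by exists k. Qed.

Lemma intR_nat (k : nat) : is_intR (k%:R : R).
Proof. by exists (Posz k). Qed.

Lemma intR_sum (I : finType) (F : I -> R) : (forall i, is_intR (F i)) -> is_intR (\sum_i F i).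
Proof. by move=> h; elim/big_ind: _ => // [|x y]; [exists 0|exact: intRD]. Qed.

Let o k (h : (k < 8)%N) : 'I_8 := Ordinal h.

Lemma forall8 (Q : 'I_8 -> Prop) : Q (@o 0 isT) -> Q (@o 1 isT) -> Q (@o 2 isT) -> Q (@o 3 isT) ->
  Q (@o 4 isT) -> Q (@o 5 isT) -> Q (@o 6 isT) -> Q (@o 7 isT) -> forall j, Q j.
Proof.
move=> q0 q1 q2 q3 q4 q5 q6 q7; case => [[|[|[|[|[|[|[|[|]]]]]]]] hi] //;
by rewrite (bool_irrelevance hi isT).
Qed.

Lemma sum8 (F : 'I_8 -> R) : \sum_i F i = F (@o 0 isT) + F (@o 1 isT) + F (@o 2 isT) + F (@o 3 isT) +
  F (@o 4 isT) + F (@o 5 isT) + F (@o 6 isT) + F (@o 7 isT).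
Proof.
rewrite !big_ord_recl big_ord0 addr0 !addrA.
by repeat (congr (_ + _)); congr F; apply: val_inj.
Qed.

(* The rows are [2 e_0], [e_i - e_0] for [0 < i < 7], and [(1/2, ..., 1/2)]. *)
Definition W8basis : 'M[R]_8 := \matrix_(i, j)
  if (i : nat) == 7 then 1 / 2 else if (i : nat) == 0 then (if (j : nat) == 0 then 2 else 0)
  else ((i : nat) == j)%:R - ((j : nat) == 0)%:R.

Lemma W8basis_mul (z : 'rV[R]_8) (j : 'I_8) : (z *m W8basis) 0 j =
  z 0 (@o 7 isT) / 2 + (if (j : nat) == 7 then 0 else if (j : nat) == 0 then
    2 * z 0 (@o 0 isT) - (z 0 (@o 1 isT) + z 0 (@o 2 isT) + z 0 (@o 3 isT) + z 0 (@o 4 isT) +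
    z 0 (@o 5 isT) + z 0 (@o 6 isT)) else z 0 j).
Proof. by rewrite mxE sum8 !mxE; move: j; apply: forall8 => /=; ring. Qed.

Lemma W8basis_unit : W8basis \in unitmx.
Proof.
rewrite -row_free_unit; apply: inj_row_free => v /rowP hv.
have e0 := hv (@o 0 isT); have e1 := hv (@o 1 isT); have e2 := hv (@o 2 isT).
have e3 := hv (@o 3 isT); have e4 := hv (@o 4 isT); have e5 := hv (@o 5 isT).
have e6 := hv (@o 6 isT); have e7 := hv (@o 7 isT).
move: e0 e1 e2 e3 e4 e5 e6 e7; rewrite !W8basis_mul !mxE /=; clear hv.
by move=> *; apply/rowP; apply: forall8; rewrite mxE; lra.
Qed.

Lemma W8_lattice : is_lattice (@W8 R).
Proof.
exists W8basis; split; first exact: W8basis_unit.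
move=> x; split.
  move=> [x2 xd [k hk]].
  have xd7 j : is_intR (x 0 j - x 0 (@o 7 isT)).
    have -> : x 0 j - x 0 (@o 7 isT) = (x 0 j - x 0 ord0) + - (x 0 (@o 7 isT) - x 0 ord0) by lra.
    by apply: intRD; [|apply: intRN]; apply: xd.
  (* The last coordinate of [x] determines the multiple of the half vector, differences to it give
     the middle coefficients, and the first coefficient is forced by the total 4 z_7 + 2 z_0 = 2
     k. *)
  exists (\row_j (if (j : nat) == 7 then Num.floor (2 * x 0 (@o 7 isT)) else if (j : nat) == 0 then
     k - 2 * Num.floor (2 * x 0 (@o 7 isT)) else Num.floor (x 0 j - x 0 (@o 7 isT)))).
  have f7 := is_intR_floor (x2 (@o 7 isT)); have fj j := is_intR_floor (xd7 j).
  have i2 : (2 : int)%:~R = 2 :> R by [].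
  rewrite sum8 in hk; apply/rowP => j; rewrite W8basis_mul !mxE /= intrB intrM i2 f7 !fj.
  by move: j; apply: forall8; rewrite /= ?fj; lra.
move=> [z ->].
have iz i : is_intR (z 0 i)%:~R by exists (z 0 i).
pose c (j : 'I_8) : R := (if (j : nat) == 7 then 0 else if (j : nat) == 0 then
    2 * (z 0 (@o 0 isT))%:~R - ((z 0 (@o 1 isT))%:~R + (z 0 (@o 2 isT))%:~R + (z 0 (@o 3 isT))%:~R +
    (z 0 (@o 4 isT))%:~R + (z 0 (@o 5 isT))%:~R + (z 0 (@o 6 isT))%:~R) else (z 0 j)%:~R).
have ic j : is_intR (c j).
  rewrite /c; case: ifP => _; first by exists 0.
  case: ifP => _; last exact: iz.
  apply: intRD; first by apply: intRM; [exact: (intR_nat 2)|exact: iz].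
  by apply: intRN; do 5!(apply: intRD; last exact: iz); exact: iz.
have xE j : (map_mx (fun k : int => k%:~R) z *m W8basis) 0 j = (z 0 (@o 7 isT))%:~R / 2 + c j.
  by rewrite W8basis_mul !mxE.
split.
- move=> i; rewrite xE (_ : 2%:R * _ = (z 0 (@o 7 isT))%:~R + 2%:R * c i); last by lra.
  by apply: intRD => //; apply: intRM => //; exact: intR_nat.
- move=> i; rewrite !xE (_ : _ - _ = c i - c ord0); last by lra.
  by apply: intRD => //; apply: intRN.
exists (2 * z 0 (@o 7 isT) + z 0 (@o 0 isT)); rewrite sum8 !xE /c /= intrD intrM; lra.
Qed.

(** The possibly half-integral part, the same in all coordinates, is separated from an integral
    vector; the parity condition on the coordinate sum then says that the integral vector has even
    sum. *)
Lemma W8_split (x : 'rV[R]_8) : W8 x -> exists (a : 'I_8 -> int) (k t : int),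
  [/\ forall i, x 0 i = x 0 ord0 + (a i)%:~R, 2 * x 0 ord0 = t%:~R &
    \sum_i (a i)%:~R = 2 * k%:~R - 4 * t%:~R :> R].
Proof.
move=> [x2 xd [k hk]]; have [t ht] := x2 ord0.
have ha i : x 0 i = x 0 ord0 + (Num.floor (x 0 i - x 0 ord0))%:~R.
  by rewrite is_intR_floor //; lra.
exists (fun i => Num.floor (x 0 i - x 0 ord0)), k, t; split => //.
rewrite -hk (eq_bigr (fun i => x 0 i - x 0 ord0)); last by move=> i _; rewrite is_intR_floor.
rewrite sumrB sumr_const card_ord -ht -mulr_natl; lra.
Qed.

Lemma dotv_split (x y : 'rV[R]_8) (x0 y0 : R) (a b : 'I_8 -> R) : (forall i, x 0 i = x0 + a i) ->
  (forall i, y 0 i = y0 + b i) ->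
  dotv x y = 8 * (x0 * y0) + x0 * \sum_i b i + y0 * \sum_i a i + \sum_i a i * b i.
Proof.
move=> hx hy; rewrite /dotv (eq_bigr (fun i => x0 * y0 + x0 * b i + y0 * a i + a i * b i)); last first.
  by move=> i _; rewrite hx hy; ring.
by rewrite !big_split /= sumr_const card_ord -!mulr_sumr mulr_natl.
Qed.

Lemma W8_integral : integral (@W8 R).
Proof.
move=> x y /W8_split[a [k [t [ha ht hk]]]] /W8_split[b [l [s [hb hs hl]]]].
rewrite (dotv_split ha hb) hk hl.
have -> : 8 * (x 0 ord0 * y 0 ord0) + x 0 ord0 * (2 * l%:~R - 4 * s%:~R) +
   y 0 ord0 * (2 * k%:~R - 4 * t%:~R) = (t * l + s * k - 2 * (t * s))%:~R.
  rewrite intrB intrD !intrM -ht -hs; ring.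
apply: intRD; first exact: intR_int.
by apply: intR_sum => i; apply: intRM; exact: intR_int.
Qed.

Lemma even_int_sqr (k : int) : exists l : int, k * k = k + 2 * l.
Proof.
exists ((k * k - k) %/ 2)%Z; have : (2 %| k * k - k)%Z.
  have [q [r [-> h]]] : exists q r : int, k = 2 * q + r /\ (r = 0 \/ r = 1).
    exists (k %/ 2)%Z, (k %% 2)%Z; split; first by rewrite {1}(divz_eq k 2) mulrC.
    by have := modz_ge0 k (isT : (2 : int) != 0); have := ltz_pmod k (isT : (0 : int) < 2); lia.
  case: h => ->; apply/dvdzP; [exists (2 * q * q - q)|exists (2 * q * q + q)]; ring.
by move=> /divzK h; rewrite [2 * _]mulrC h; ring.
Qed.

(** Squares of integers agree with the integers modulo 2, and the integral part of [x] has even sum;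
    the cross terms with the constant part are then even as well. *)
Lemma W8_even : even_lattice (@W8 R).
Proof.
move=> x /W8_split[a [k [t [ha ht hk]]]]; rewrite (dotv_split ha ha) hk.
have [l hl] : exists l : int, \sum_i (a i)%:~R * (a i)%:~R = \sum_i (a i)%:~R + 2 * l%:~R :> R.
  have /choice[l hl] i := even_int_sqr (a i).
  exists (\sum_i l i); rewrite rmorph_sum /= mulr_sumr -big_split /=; apply: eq_bigr => i _.
  by rewrite -intrM hl intrD intrM.
rewrite hl hk; exists (t * k - t * t + k - 2 * t + l).
rewrite !(intrB, intrD, intrM) -ht; ring.
Qed.

Lemma W8_intvec (a : 'I_8 -> int) (k : int) : \sum_i a i = 2 * k -> W8 (\row_i (a i)%:~R : 'rV[R]_8).
Proof.
move=> h; split.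
- by move=> i; rewrite mxE; apply: intRM; [exact: intR_nat|exact: intR_int].
- by move=> i; rewrite !mxE; apply: intRD; [|apply: intRN]; exact: intR_int.
exists k; rewrite (eq_bigr (fun i => (a i)%:~R)); last by move=> i _; rewrite mxE.
by rewrite -rmorph_sum /= h intrM.
Qed.

(** A dual vector is paired with 2 e_i, with e_i - e_0 and with (1/2, ..., 1/2); each pairing yields
    one of the three defining conditions. *)
Lemma W8_selfdual : selfdual (@W8 R).
Proof.
split; first exact: W8_integral.
move=> y; split; first by move=> Wy x Wx; apply: W8_integral.
move=> dy; split.
- move=> i; have W : W8 (\row_j ((2 * (j == i)%:R)%:~R) : 'rV[R]_8).
    apply: (@W8_intvec (fun j => 2 * (j == i)%:R) 1).
    by rewrite -mulr_sumr (bigD1 i) //= eqxx big1 ?addr0 // => j /negPf ->.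
  have := dy _ W; rewrite /dotv (bigD1 i) //= big1; first by rewrite mxE eqxx addr0.
  by move=> j /negPf ji; rewrite mxE ji mulr0 mul0r.
- move=> i; have [->|i0] := eqVneq i ord0; first by rewrite subrr; exists 0.
  have W : W8 (\row_j (((j == i)%:R - (j == ord0)%:R : int)%:~R) : 'rV[R]_8).
    apply: (@W8_intvec (fun j => (j == i)%:R - (j == ord0)%:R) 0).
    rewrite sumrB (bigD1 i) //= eqxx big1 ?addr0 => [|j /negPf -> //].
    by rewrite (bigD1 ord0) //= big1 ?addr0 => [|j /negPf -> //].
  have := dy _ W; rewrite /dotv (bigD1 i) //= (bigD1 ord0) 1?eq_sym //= big1 => [|j /andP[/negPf ji /negPf j0]].
    by rewrite !mxE !eqxx (negPf i0) eq_sym (negPf i0) subr0 sub0r mul1r addr0 mulN1r.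
  by rewrite mxE ji j0 subrr mul0r.
have W : W8 (const_mx (1 / 2) : 'rV[R]_8).
  split => [i|i|]; rewrite ?mxE; [by exists 1; lra|by exists 0; rewrite subrr|].
  by exists 2; rewrite (eq_bigr (fun=> 1 / 2)) => [|i _]; rewrite ?mxE // sumr_const card_ord -mulr_natl; lra.
have [k hk] := dy _ W; exists k; rewrite -hk /dotv mulr_sumr; apply: eq_bigr => i _.
by rewrite mxE; lra.
Qed.

Lemma W8_even_selfdual : even_selfdual (@W8 R).
Proof. by split; [exact: W8_lattice|exact: W8_selfdual|exact: W8_even]. Qed.

End E8.

Theorem theorem11p3 (R : realType) :
  (* (i) W_8: nonempty shells are 7 1/2-designs (s = 3) *)
  (forall m : R, (exists x, shell (@W8 R) m x) ->
     sph_half_design 3 (shell (@W8 R) m)) /\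
  (* (ii) rank 16: nonempty shells are 3 1/2-designs (s = 1) *)
  (forall L : 'rV[R]_16 -> Prop, even_selfdual L ->
     forall m : R, (exists x, shell L m x) ->
       sph_half_design 1 (shell L m)) /\
  (* (iii) Leech lattice (even selfdual, rank 24, minimum 4):
     nonempty shells are 11 1/2-designs (s = 5) *)
  (forall L : 'rV[R]_24 -> Prop, even_selfdual L -> lattice_min L 4%:R ->
     forall m : R, (exists x, shell L m x) ->
       sph_half_design 5 (shell L m)) /\
  (* (iv) rank 24, minimum 2: nonempty shells are 3-designs *)
  (forall L : 'rV[R]_24 -> Prop, even_selfdual L -> lattice_min L 2%:R ->
     forall m : R, (exists x, shell L m x) ->
       sph_design 3 (shell L m)).
Proof.
split; [|split; [|split]].
(* Weights 6, 8, 10 and 14; degree 8 would give weight 12, where Delta lives. *)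
- move=> m hm; have [s [hs hc]] := shell_conds (h := 2) erefl (W8_even_selfdual R) hm.
  exists s; split=> //; split; last exact: (hc 5 1).
  by move=> [|[|[|[|]]]] // _ _; [apply: (hc 1 1)|apply: (hc 2 1)|apply: (hc 3 1)].
(* Weights 10 and 14. *)
- move=> L hL m hm; have [s [hs hc]] := shell_conds (h := 4) erefl hL hm.
  exists s; split=> //; split; last exact: (hc 3 1).
  by move=> [|[|]] // _ _; apply: (hc 1 1).
(* Minimum 4 allows [m0 = 2]: weights 14, 16, 18, 20, 22 and 26, avoiding weight 24 with Delta^2. *)
- move=> L hL hmin m hm; have [s [hs hc]] := shell_conds (h := 6) erefl hL hm.
  exists s; split=> //; split; last exact: (hc 7 2).
  by move=> [|[|[|[|[|[|]]]]]] // _ _;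
    [apply: (hc 1 2)|apply: (hc 2 2)|apply: (hc 3 2)|apply: (hc 4 2)|apply: (hc 5 2)].
(* Only degree 2 is asked for: weight 14 with [m0 = 1]. *)
- move=> L hL _ m hm; have [s [hs hc]] := shell_conds (h := 6) erefl hL hm.
  exists s; split=> //.
  by move=> [|[|]] // _ _; apply: (hc 1 1).
Qed.
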